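(* Let $p_o>0$ and let $(\Delta_\delta)_{0<\delta\le p_o}$ be a family of functions each satisfying conditions (i)–(v) of the context. Then for every $y_o\in\mathbb R$, \[ \bar N[f^o_{p_o,y_o}]:=\lim_{\delta\to0^+}\bar N[f^\delta_{p_o,y_o}]=\frac12\,\frac{1}{e^{2\pi p_o}-1},\] and consequently \[ \lim_{y_o\to\pm\infty}\ \lim_{\delta\to0^+}\Big(\bar N[f^\delta_{p_o,y_o}]-\tfrac12\bar N^{Th}_{2\pi}[f^\delta_{p_o,y_o}]\Big)=0.\]
   Context: Fourier transforms: $\tilde g(p)=(2\pi)^{-1/2}\int g(y)e^{-ipy}dy$; $\theta$ is the Heaviside step function. Wave packet: for $p_o\ge\delta>0$, let $\Delta_\delta:\mathbb R\to\mathbb R$ and define $f^\delta_{p_o}$ by $\tilde f^\delta_{p_o}(p)=\theta(p)\sqrt{2|p|}\,\Delta_\delta(p-p_o)$, with: (i) $\int|\Delta_\delta|^2=1$; (ii) support of $\Delta_\delta$ in $(-\delta,\delta)$; (iii) $\tilde f^\delta_{p_o}\in C^r(\mathbb R)$ for some $r\ge0$, its derivatives of order $0,\dots,r$ vanish at the origin and at infinity, the $(r+1)$-th derivative exists a.e. and is bounded, the $(r+2)$-th exists a.e. and is integrable; (iv) $\Delta_\delta$ real and nonnegative; (v) $f^\delta_{p_o}$ and its derivative integrable. Set $f^\delta_{p_o,y_o}(y)=f^\delta_{p_o}(y-y_o)$. The generalised function $f^o_{p_o,y_o}$ is the limit $\delta\to0^+$ of $f^\delta_{p_o,y_o}$ (a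 state with momentum exactly $p_o$). With $x(y)=-\log(1+e^{-y})$: $\widetilde{\check f}(-k)=(2\pi)^{-1/2}\int f(y)e^{ikx(y)}dy$, $\bar N[f]=\int_0^\infty\frac{dk}{2k}|\widetilde{\check f}(-k)|^2$, $\bar N^{Th}_{2\pi}[f]=\int_0^\infty\frac{dp}{2p}\frac{|\tilde f(p)|^2}{e^{2\pi p}-1}$. *)

(* Defs.v *)
From HB Require Import structures.
From mathcomp Require Import all_boot all_order all_algebra.
From mathcomp Require Import all_classical all_reals all_analysis.
Set Implicit Arguments. Unset Strict Implicit. Unset Printing Implicit Defensive.
Import Order.TTheory GRing.Theory Num.Theory.
Import numFieldNormedType.Exports.
Local Open Scope classical_set_scope.
Local Open Scope ring_scope.

(* Complex-valued functions R -> C are represented by their real and imaginary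
   parts (u, v) : (R -> R) * (R -> R); |z|^2 = (Re z)^2 + (Im z)^2. *)

Definition heaviside {R : realType} (p : R) : R := if 0 <= p then 1 else 0.

Definition wp_tilde {R : realType} (Delta : R -> R) (po : R) (p : R) : R :=
  heaviside p * Num.sqrt (2 * `|p|) * Delta (p - po).

Definition c2pi {R : realType} : R := (Num.sqrt (2 * pi))^-1.

Definition invF_re {R : realType} (gt : R -> R) (y : R) : R :=
  c2pi * (\int[@lebesgue_measure R]_(p in [set: R]) (gt p * cos (p * y))).
Definition invF_im {R : realType} (gt : R -> R) (y : R) : R :=
  c2pi * (\int[@lebesgue_measure R]_(p in [set: R]) (gt p * sin (p * y))).

Definition wp_re {R : realType} (Delta : R -> R) (po : R) : R -> R :=
  invF_re (wp_tilde Delta po).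
Definition wp_im {R : realType} (Delta : R -> R) (po : R) : R -> R :=
  invF_im (wp_tilde Delta po).

Definition wp_shift {R : realType} (g : R -> R) (yo : R) (y : R) : R := g (y - yo).

Definition xmap {R : realType} (y : R) : R := - ln (1 + expR (- y)).

(* widetilde{check f}(-k) = (2pi)^{-1/2} int f(y) e^{i k x(y)} dy, for f = u + i v *)
Definition fcheck_re {R : realType} (u v : R -> R) (k : R) : R :=
  c2pi * (\int[@lebesgue_measure R]_(y in [set: R])
            (u y * cos (k * xmap y) - v y * sin (k * xmap y))).
Definition fcheck_im {R : realType} (u v : R -> R) (k : R) : R :=
  c2pi * (\int[@lebesgue_measure R]_(y in [set: R])
            (u y * sin (k * xmap y) + v y * cos (k * xmap y))).

Definition Nbar {R : realType} (u v : R -> R) : \bar R :=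
  (\int[@lebesgue_measure R]_(k in [set k : R | (0 < k)%R])
     ((((fcheck_re u v k) ^+ 2 + (fcheck_im u v k) ^+ 2) / (2 * k))%R)%:E)%E.

Definition fourier_re {R : realType} (u v : R -> R) (p : R) : R :=
  c2pi * (\int[@lebesgue_measure R]_(y in [set: R])
            (u y * cos (p * y) + v y * sin (p * y))).
Definition fourier_im {R : realType} (u v : R -> R) (p : R) : R :=
  c2pi * (\int[@lebesgue_measure R]_(y in [set: R])
            (v y * cos (p * y) - u y * sin (p * y))).

Definition NTh2pi {R : realType} (u v : R -> R) : \bar R :=
  (\int[@lebesgue_measure R]_(p in [set p : R | (0 < p)%R])
     ((((fourier_re u v p) ^+ 2 + (fourier_im u v p) ^+ 2) / (2 * p)
        / (expR (2 * pi * p) - 1))%R)%:E)%E.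

Definition wp_conditions {R : realType} (po delta : R) (Delta : R -> R) : Prop :=
  let ft := wp_tilde Delta po in
  let u := wp_re Delta po in
  let v := wp_im Delta po in
  (\int[@lebesgue_measure R]_(p in [set: R]) ((`|Delta p| ^+ 2)%R%:E) = 1)%E /\
  (forall p, Delta p != 0 -> - delta < p < delta) /\
  (exists r : nat,
     (forall j, (j <= r)%N -> continuous (derive1n j ft)) /\
     (forall j, (j < r)%N -> forall p, derivable (derive1n j ft) p 1) /\
     (forall j, (j <= r)%N -> derive1n j ft 0 = 0) /\
     (forall j, (j <= r)%N -> derive1n j ft x @[x --> +oo] --> 0) /\
     (forall j, (j <= r)%N -> derive1n j ft x @[x --> -oo] --> 0) /\
     {ae @lebesgue_measure R, forall p, derivable (derive1n r ft) p 1} /\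
     (exists M : R, {ae @lebesgue_measure R, forall p, `|derive1n r.+1 ft p| <= M}) /\
     {ae @lebesgue_measure R, forall p, derivable (derive1n r.+1 ft) p 1} /\
     (@lebesgue_measure R).-integrable [set: R] (EFin \o derive1n r.+2 ft)) /\
  (forall p, 0 <= Delta p) /\
  (@lebesgue_measure R).-integrable [set: R] (EFin \o u) /\
  (@lebesgue_measure R).-integrable [set: R] (EFin \o v) /\
  (forall y, derivable u y 1) /\ (forall y, derivable v y 1) /\
  (@lebesgue_measure R).-integrable [set: R] (EFin \o derive1 u) /\
  (@lebesgue_measure R).-integrable [set: R] (EFin \o derive1 v).

(* Main.v *)
(* Integrating by parts in y against the phase p (y - yo) + k x(y), whose derivative is at least
   p > 0, turns the transform of the packet at momentum k into the average over p, with weight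
   the packet in momentum space, of absolutely convergent integrals ([ampint]).  After the
   translation y = t + ln k these converge as k -> oo to c1(p) sin(p s) + c2(p) cos(p s), where
   s = ln k - yo.  Moreover c1^2 + c2^2 = 2 pi / (p (e^(2 pi p) - 1)): for |th| < pi/2 the rotated
   integral of e^(ipt) z E e^(-zE), with E = e^(-t) and z = e^(i th), is proportional to
   e^(-p th), so its moduli at th and -th have a known ratio, while their difference is a Fourier
   integral that can be computed as th -> pi/2.  When the packet concentrates at po the
   coefficients may be frozen at po, the momenta k < e^yo contribute O(delta), and since
   dk / k = ds Plancherel's formula on the half-line s >= 0, for an even energy density, gives
   half of the Planck factor. *)

Require Import Defs.
From HB Require Import structures.
From mathcomp Require Import all_boot all_order all_algebra.
From mathcomp Require Import all_classical all_reals all_analysis.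
From mathcomp Require Import measurable_realfun ring lra.
Set Implicit Arguments. Unset Strict Implicit. Unset Printing Implicit Defensive.
Import Order.TTheory GRing.Theory Num.Theory.
Import numFieldNormedType.Exports.
Local Open Scope classical_set_scope.
Local Open Scope ring_scope.

(** The integral over y at fixed p is not absolutely convergent, and its boundary terms oscillate
    without decaying; only their average over p tends to 0, by the Riemann-Lebesgue lemma. So the
    integration by parts is done on the average, and Fubini is applied to what remains. Complex
    numbers do not occur: an offset b is added to the phase, and b = 0 and b = -pi/2 give the real
    and imaginary parts. At th = 0 the rotated integral is Gamma(1 - ip), of squared modulus pi p /
    sinh(pi p) by the reflection formula. Here that value comes from an approximate identity: with
    eta = pi - 2 th, the difference of the squared moduli at -th and th is p times the integral of
    cos(ps) against sin(eta) / (cosh s - cos eta), a kernel of mass 2 (pi - eta) that concentrates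
    at s = 0. A packet of width delta has squared L2 norm close to 2 po but L1 norm of order
    sqrt(delta). Hence eta is fixed before delta, and the limit does not depend on yo. *)

Implicit Types R : realType.

(** * Integration on the real line: domination, Fubini, translation, fundamental theorem *)

Local Notation mu := (@lebesgue_measure _).
Local Notation plane R := [set: measurableTypeR R * measurableTypeR R].
Local Notation intble f := (lebesgue_measure.-integrable [set: _] (EFin \o f)).

Lemma intble_measurable {R} (f : R -> R) :
  intble f -> measurable_fun setT f.
Proof. by move=> /integrableP[/measurable_EFinP]. Qed.

Lemma intble_dom {R} (f g : R -> R) :
  measurable_fun setT f -> intble g -> (forall x, `|f x| <= g x) -> intble f.
Proof.
move=> mf ig fg; apply: (le_integrable measurableT _ _ ig).
  exact/measurable_EFinP.
by move=> x _ /=; rewrite lee_fin (le_trans (fg x))// ler_norm.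
Qed.

Lemma intbleD {R} (f g : R -> R) :
  intble f -> intble g -> intble (fun x => f x + g x).
Proof. by move=> fi gi; exact: (integrableD measurableT fi gi). Qed.

Lemma intbleB {R} (f g : R -> R) :
  intble f -> intble g -> intble (fun x => f x - g x).
Proof. by move=> fi gi; exact: (integrableB measurableT fi gi). Qed.

Lemma intbleZ {R} (k : R) (f : R -> R) :
  intble f -> intble (fun x => k * f x).
Proof. by move=> fi; exact: (integrableZl measurableT k fi). Qed.

Lemma intble_norm {R} (f : R -> R) :
  intble f -> intble (fun x => `|f x|).
Proof. by move=> fi; exact: (integrable_norm fi). Qed.

Lemma intble_bdM {R} (M : R) (h f : R -> R) :
  measurable_fun setT h -> (forall x, `|h x| <= M) -> intble f ->
  intble (fun x => f x * h x).
Proof.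
move=> mh hM fi; apply: (@intble_dom _ _ (fun x => M * `|f x|)).
- by apply: measurable_funM => //; exact: intble_measurable.
- exact/intbleZ/intble_norm.
- by move=> x; rewrite normrM mulrC ler_wpM2r.
Qed.

Lemma IntD {R} (f g : R -> R) : intble f -> intble g ->
  \int[mu]_x (f x + g x) = \int[mu]_x f x + \int[mu]_x g x.
Proof. exact: RintegralD. Qed.

Lemma IntB {R} (f g : R -> R) : intble f -> intble g ->
  \int[mu]_x (f x - g x) = \int[mu]_x f x - \int[mu]_x g x.
Proof. exact: RintegralB. Qed.

Lemma IntZ {R} (k : R) (f : R -> R) : intble f ->
  \int[mu]_x (k * f x) = k * \int[mu]_x f x.
Proof. exact: RintegralZl. Qed.

Lemma IntN {R} (f : R -> R) : intble f ->
  \int[mu]_x (- f x) = - \int[mu]_x f x.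
Proof.
move=> fi; rewrite -mulN1r -IntZ//; apply: eq_Rintegral => x _.
by rewrite mulN1r.
Qed.

Lemma eq_Int {R} (f g : R -> R) : f =1 g ->
  \int[mu]_x f x = \int[mu]_x g x.
Proof. by move=> fg; apply: eq_Rintegral => x _; exact: fg. Qed.

Lemma le_Int {R} (f g : R -> R) : intble f -> intble g ->
  (forall x, f x <= g x) -> \int[mu]_x f x <= \int[mu]_x g x.
Proof. by move=> fi gi fg; apply: le_Rintegral. Qed.

Lemma normr_Int_le {R} (f g : R -> R) : intble f -> intble g ->
  (forall x, `|f x| <= g x) -> `|\int[mu]_x f x| <= \int[mu]_x g x.
Proof.
move=> fi gi fg; apply: (le_trans (le_normr_Rintegral measurableT fi)).
by apply: le_Int => //; exact: intble_norm.
Qed.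

Lemma EFin_Int {R} (f : R -> R) : intble f ->
  (\int[mu]_x f x)%:E = (\int[mu]_x (f x)%:E)%E.
Proof. by move=> fi; rewrite /Rintegral fineK//; exact: integrable_fin_num. Qed.

Lemma Int_dct {R} (f_ : nat -> R -> R) (f g : R -> R) :
  (forall n, measurable_fun setT (f_ n)) -> (forall x, f_ n x @[n --> \oo] --> f x) ->
  intble g -> (forall n x, `|f_ n x| <= g x) ->
  intble f /\ \int[mu]_x f_ n x @[n --> \oo] --> \int[mu]_x f x.
Proof.
move=> mf ff gi fg.
have mlim : measurable_fun setT f.
  by apply: (measurable_fun_cvg mf) => // x _; exact: ff.
have h1 n : measurable_fun setT (EFin \o f_ n) by exact/measurable_EFinP.
have h2 : measurable_fun setT (EFin \o f) by exact/measurable_EFinP.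
have h3 : {ae mu, forall x, [set: R] x ->
    (fun n => (EFin \o f_ n) x) @ \oo --> (EFin \o f) x}.
  by apply: aeW => x _; apply: cvg_EFin; [exact: nearW | exact: ff].
have h4 : {ae mu, forall x n, [set: R] x ->
    (`|(EFin \o f_ n) x| <= (EFin \o g) x)%E}.
  by apply: aeW => x n _ /=; rewrite lee_fin.
have [fi _ h] := @dominated_convergence _ (measurableTypeR R) R mu setT
  measurableT (fun n => EFin \o f_ n) (EFin \o f) (EFin \o g) h1 h2 h3 gi h4.
split=> //; have fin := integrable_fin_num measurableT fi.
by apply: fine_cvg; rewrite /Rintegral fineK//; exact: h.
Qed.

Lemma Int_continuous {R} (f : R -> R -> R) (g : R -> R) :
  (forall x, measurable_fun setT (f x)) -> (forall y, continuous (f ^~ y)) ->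
  intble g -> (forall x y, `|f x y| <= g y) ->
  continuous (fun x => \int[mu]_y f x y).
Proof.
move=> mf cf gi fg a.
have fi x : intble (f x) by exact: (intble_dom (mf x) gi (fg x)).
have Ia : a \in (`]a - 1, a + 1[%classic : set R).
  by rewrite inE/= in_itv/=; apply/andP; split; lra.
have h := @continuity_under_integral R _ _ mu f setT measurableT (a - 1) (a + 1)
  (fun x _ => fi x) _ g gi _ a Ia.
by apply: h => [|x _]; apply: aeW => y _ //= x' _; exact: cf.
Qed.

(** A separated bound a(x) b(y) is the criterion behind every exchange of integrals below; Tonelli
    reduces it to the product of the integrals of a and b. *)
Lemma product_intble {R} (f : R -> R -> R) (a b : R -> R) :
  measurable_fun (plane R) (fun z => f z.1 z.2) ->
  intble a -> intble b -> (forall x y, `|f x y| <= a x * b y) ->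
  [/\ forall x, intble (f x), intble (fun x => \int[mu]_y f x y) &
    ((@lebesgue_measure R) \x (@lebesgue_measure R))%E.-integrable
    (plane R) (fun z => (f z.1 z.2)%:E)].
Proof.
move=> mf ai bi fab.
have m1 x : measurable_fun setT (f x).
  by have := measurable_fun_pair2 x mf.
have i1 x : intble (f x).
  by apply: (intble_dom (m1 x) (intbleZ (a x) bi)); exact: fab.
have mfE : measurable_fun (plane R)
   (fun z => (f z.1 z.2)%:E) by exact/measurable_EFinP.
have fi : ((@lebesgue_measure R) \x (@lebesgue_measure R))%E.-integrable
    (plane R) (fun z => (f z.1 z.2)%:E).
  apply/(@integrable12ltyP _ _ (measurableTypeR R) (measurableTypeR R) R
    lebesgue_measure lebesgue_measure _ mfE) => /=.
  have le1 x : (\int[mu]_y `|f x y|%:E <= (a x * \int[mu]_y b y)%:E)%E.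
    rewrite -IntZ// EFin_Int; last exact: intbleZ.
    apply: le_integral => //; first exact: intble_norm.
      exact: intbleZ.
    by move=> y _; rewrite lee_fin.
  apply: (@le_lt_trans _ _ (\int[mu]_x ((a x * \int[mu]_y b y)%:E))%E).
    apply: ge0_le_integral => //.
    - by move=> x _; exact: integral_ge0.
    - have mabs : measurable_fun (plane R)
        (fun z => `|(f z.1 z.2)%:E|%E).
        exact: (measurableT_comp (@abse_measurable R setT) mfE).
      have h0 z : (0 <= `|(f z.1 z.2)%:E|)%E by [].
      exact: (@measurable_fun_fubini_tonelli_F _ _ (measurableTypeR R)
        (measurableTypeR R) R lebesgue_measure _ mabs h0).
    - apply/measurable_EFinP; apply: measurable_funM => //.
      exact: intble_measurable.
  rewrite -(@EFin_Int _ (fun x => a x * \int[mu]_y b y)) ?ltry//.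
  rewrite (_ : (fun _ => _) = (fun x => (\int[mu]_y b y) * a x)).
    exact: intbleZ.
  by apply/funext => x; rewrite mulrC.
split => //.
have := @integrable_fubini_F _ _ (measurableTypeR R) (measurableTypeR R) R
  lebesgue_measure lebesgue_measure _ fi.
apply: eq_integrable => // x _ /=; by rewrite EFin_Int.
Qed.

Lemma Int_Fubini {R} (f : R -> R -> R) (a b : R -> R) :
  measurable_fun (plane R) (fun z => f z.1 z.2) ->
  intble a -> intble b -> (forall x y, `|f x y| <= a x * b y) ->
  [/\ forall x, intble (f x), forall y, intble (f ^~ y),
      intble (fun x => \int[mu]_y f x y), intble (fun y => \int[mu]_x f x y) &
      \int[mu]_x (\int[mu]_y f x y) = \int[mu]_y (\int[mu]_x f x y)].
Proof.
move=> mf ai bi fab.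
have [i1 F1 fi] := product_intble mf ai bi fab.
have mf' : measurable_fun (plane R)
  (fun z => f z.2 z.1).
  exact: (measurableT_comp mf (@measurable_swap _ _ (measurableTypeR R) (measurableTypeR R))).
have fba y x : `|f x y| <= b y * a x by rewrite mulrC.
have [i2 F2 _] := @product_intble R (fun y x => f x y) _ _ mf' bi ai fba.
split => //; apply: EFin_inj; rewrite !EFin_Int//.
transitivity (\int[mu]_x \int[mu]_y (f x y)%:E)%E.
  by apply: eq_integral => x _; rewrite EFin_Int.
transitivity (\int[mu]_y \int[mu]_x (f x y)%:E)%E; last first.
  by apply: eq_integral => x _; rewrite EFin_Int.
exact: (@Fubini _ _ (measurableTypeR R) (measurableTypeR R) R
  lebesgue_measure lebesgue_measure _ fi).
Qed.

(** The push-forward of Lebesgue measure along x + c agrees with it on half-open intervals, which by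
    uniqueness fixes it on all measurable sets. *)
Lemma Int_shift {R} (c : R) (f : R -> R) : intble f ->
  intble (fun x => f (x + c)) /\ \int[mu]_x f (x + c) = \int[mu]_x f x.
Proof.
move=> fi.
pose phi0 : measurableTypeR R -> measurableTypeR R := fun x => x + c.
have mphi : measurable_fun setT phi0 by apply: measurable_funD.
pose phi : {mfun measurableTypeR R >-> measurableTypeR R} :=
  MeasurableFun.Pack (MeasurableFun.Class (isMeasurableFun.Build _ _ _ _ _ mphi)).
have muE A : measurable A ->
    (@lebesgue_measure R) A = pushforward (@lebesgue_measure R) phi A.
  move=> mA; apply: lebesgue_measure_unique => //= _ [[a b]] _ <-.
  rewrite /pushforward (_ : _ @^-1` _ = `](a - c), (b - c)]%classic).
    rewrite !lebesgue_measure_itv/= !lte_fin ltrD2r; case: ifP => // _.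
    by rewrite -!EFinD; congr EFin; ring.
  apply/seteqP; split => x /=; rewrite !in_itv/= /phi0.
    by move=> /andP[h1 h2]; apply/andP; split; lra.
  by move=> /andP[h1 h2]; apply/andP; split; lra.
have mf := intble_measurable fi.
have mfE : measurable_fun setT (EFin \o f) by exact/measurable_EFinP.
have ic : intble (fun x => f (x + c)).
  apply/integrableP; split.
    by apply/measurable_EFinP; exact: (measurableT_comp mf mphi).
  have /integrableP[_] := fi; apply: le_lt_trans.
  rewrite [leRHS](@eq_measure_integral _ _ _ _ (pushforward (@lebesgue_measure R) phi)); last first.
    by move=> A mA _; exact: muE.
  rewrite ge0_integral_pushforward//=.
  exact: (measurableT_comp (@abse_measurable R setT) mfE).
split => //; rewrite /Rintegral; congr fine.
rewrite [RHS](@eq_measure_integral _ _ _ _ (pushforward (@lebesgue_measure R) phi)); last first.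
  by move=> A mA _; exact: muE.
rewrite (@integral_pushforward _ _ (measurableTypeR R) (measurableTypeR R) R phi)//.
Qed.

Lemma Int_truncate {R} (f : R -> R) : intble f ->
  \int[mu]_(x in `[- n%:R, n%:R]) f x @[n --> \oo] --> \int[mu]_x f x.
Proof.
move=> fi.
under eq_fun do rewrite Rintegral_mkcond.
apply: (Int_dct _ _ (intble_norm fi) _).2.
- move=> n; apply/(measurable_restrictT _ _).1 => //.
  apply: (measurable_funS measurableT _ (intble_measurable fi)) => //.
- move=> x; apply: cvg_near_cst.
  near=> n; rewrite patchE mem_set//= in_itv/= -ler_norml.
  by near: n; exact: nbhs_infty_ger.
- by move=> n x; rewrite patchE; case: ifP => //; rewrite normr0.
Unshelve. all: by end_near. Qed.

Lemma itv_FTC {R} (F f : R -> R) (a b : R) : a < b ->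
  (forall x : R, is_derive x 1 F (f x)) -> continuous f ->
  \int[mu]_(x in `[a, b]) f x = F b - F a.
Proof.
move=> ab dF cf.
have cF : continuous F.
  move=> x; apply/differentiable_continuous/derivable1_diffP.
  by have [] := dF x.
rewrite /Rintegral (@continuous_FTC2 _ f F)//.
- exact: continuous_subspaceT.
- split; first by move=> x _; have [] := dF x.
    by apply: cvg_at_right_filter; exact: cF.
  by apply: cvg_at_left_filter; exact: cF.
- by move=> x _; rewrite derive1E derive_val.
Qed.

(** Limits of F along the integers suffice: f is known to be integrable, so its integral is the
    limit of those over [-n, n]. *)
Lemma line_FTC {R} (F f : R -> R) (l l' : R) :
  (forall x : R, is_derive x 1 F (f x)) -> continuous f -> intble f ->
  F n%:R @[n --> \oo] --> l -> F (- n%:R) @[n --> \oo] --> l' ->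
  \int[mu]_x f x = l - l'.
Proof.
move=> dF cf fi Fl Fl'.
apply: (@cvg_unique _ _ _ _ _ _ (Int_truncate fi)) => //.
apply: cvg_trans (cvgB Fl Fl'); apply: near_eq_cvg; near=> n.
rewrite (itv_FTC _ dF cf)//.
suff : (0 : R) < n%:R by lra.
by rewrite ltr0n; near: n; exact: nbhs_infty_gt.
Unshelve. all: by end_near. Qed.

(** * Syntax-directed tactics for measurability, continuity and derivatives *)

Lemma mfunD d (T : measurableType d) (R : realType) (f g : T -> R) :
  measurable_fun setT f -> measurable_fun setT g ->
  measurable_fun setT (fun x => f x + g x).
Proof. exact: measurable_funD. Qed.

Lemma mfunM d (T : measurableType d) (R : realType) (f g : T -> R) :
  measurable_fun setT f -> measurable_fun setT g ->
  measurable_fun setT (fun x => f x * g x).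
Proof. exact: measurable_funM. Qed.

Lemma mfunN d (T : measurableType d) (R : realType) (f : T -> R) :
  measurable_fun setT f -> measurable_fun setT (fun x => - f x).
Proof. exact: measurable_funN. Qed.

Lemma mfunX d (T : measurableType d) (R : realType) (f : T -> R) n :
  measurable_fun setT f -> measurable_fun setT (fun x => f x ^+ n).
Proof. exact: measurable_funX. Qed.

Lemma mfun_comp d (T : measurableType d) (R : realType) (f : T -> R) (h : R -> R) :
  measurable_fun setT h -> measurable_fun setT f ->
  measurable_fun setT (fun x => h (f x)).
Proof. by move=> mh mf; exact: (measurableT_comp mh mf). Qed.

(** Reduced to [powR] through x^-1 = x |x|^-2; at 0 both sides vanish, by the convention for the
    inverse of 0 and the factor x. *)
Lemma measurable_invr {R} : measurable_fun setT (fun x : R => x^-1).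
Proof.
rewrite (_ : (fun x : R => x^-1) = fun x => x * powR `|x| (-1) ^+ 2).
  apply: mfunM => //; apply: mfunX.
  exact: (@mfun_comp _ _ R _ (@powR R ^~ (-1)) (@measurable_powR R (-1))
    (@normr_measurable R setT)).
apply/funext => x; rewrite powR_inv1// exprVn real_normK ?num_real//.
have [->|x0] := eqVneq x 0; first by rewrite mul0r invr0.
by field.
Qed.

Lemma mfunV d (T : measurableType d) (R : realType) (f : T -> R) :
  measurable_fun setT f -> measurable_fun setT (fun x => (f x)^-1).
Proof. exact: (mfun_comp measurable_invr). Qed.

Lemma mfun_cos d (T : measurableType d) (R : realType) (f : T -> R) :
  measurable_fun setT f -> measurable_fun setT (fun x => cos (f x)).
Proof. exact: (mfun_comp (continuous_measurable_fun (@continuous_cos R))). Qed.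

Lemma mfun_sin d (T : measurableType d) (R : realType) (f : T -> R) :
  measurable_fun setT f -> measurable_fun setT (fun x => sin (f x)).
Proof. exact: (mfun_comp (continuous_measurable_fun (@continuous_sin R))). Qed.

Lemma mfun_exp d (T : measurableType d) (R : realType) (f : T -> R) :
  measurable_fun setT f -> measurable_fun setT (fun x => expR (f x)).
Proof. exact: (mfun_comp (@measurable_expR R)). Qed.

Lemma mfun_ln d (T : measurableType d) (R : realType) (f : T -> R) :
  measurable_fun setT f -> measurable_fun setT (fun x => ln (f x)).
Proof. exact: (mfun_comp (@measurable_ln R)). Qed.

Lemma mfun_norm d (T : measurableType d) (R : realType) (f : T -> R) :
  measurable_fun setT f -> measurable_fun setT (fun x => `|f x|).
Proof. exact: (mfun_comp (@normr_measurable R setT)). Qed.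

Lemma mfun_max d (T : measurableType d) (R : realType) (f g : T -> R) :
  measurable_fun setT f -> measurable_fun setT g ->
  measurable_fun setT (fun x => Num.max (f x) (g x)).
Proof. exact: measurable_maxr. Qed.

Lemma mfun_fst {R} (f : R -> R) : measurable_fun setT f ->
  measurable_fun (plane R) (fun z => f z.1).
Proof. by move=> mf; exact: (measurableT_comp mf (@measurable_fst _ _ _ _)). Qed.

Lemma mfun_snd {R} (f : R -> R) : measurable_fun setT f ->
  measurable_fun (plane R) (fun z => f z.2).
Proof. by move=> mf; exact: (measurableT_comp mf (@measurable_snd _ _ _ _)). Qed.

(** Assumptions are tried at each node, which is how anonymous facts introduced by [have ?] enter;
    the eta-expansion lets the patterns match on a lambda. *)
Ltac meas := try assumption;
  try lazymatch goal with
  | |- measurable_fun _ (fun _ => _) => idtac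
  | |- measurable_fun ?D ?f => change (measurable_fun D (fun x => f x))
  end;
  lazymatch goal with
  | |- measurable_fun _ (fun x => x) => exact: measurable_id
  | |- measurable_fun _ (fun _ => ?c) => exact: measurable_cst
  | |- measurable_fun _ (fun z => z.1) => exact: measurable_fst
  | |- measurable_fun _ (fun z => z.2) => exact: measurable_snd
  | |- measurable_fun _ (fun x => _ + _) => apply: mfunD; meas
  | |- measurable_fun _ (fun x => _ * _) => apply: mfunM; meas
  | |- measurable_fun _ (fun x => - _) => apply: mfunN; meas
  | |- measurable_fun _ (fun x => _ ^+ _) => apply: mfunX; meas
  | |- measurable_fun _ (fun x => _^-1) => apply: mfunV; meas
  | |- measurable_fun _ (fun x => cos _) => apply: mfun_cos; meas
  | |- measurable_fun _ (fun x => sin _) => apply: mfun_sin; meas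
  | |- measurable_fun _ (fun x => expR _) => apply: mfun_exp; meas
  | |- measurable_fun _ (fun x => ln _) => apply: mfun_ln; meas
  | |- measurable_fun _ (fun x => `|_|) => apply: mfun_norm; meas
  | |- measurable_fun _ (fun x => Num.max _ _) => apply: mfun_max; meas
  | _ => idtac
  end.

Lemma cfunD {R} (f g : R -> R) : continuous f -> continuous g ->
  continuous (fun x => f x + g x).
Proof. by move=> cf cg x; apply: cvgD; [exact: cf|exact: cg]. Qed.

Lemma cfunM {R} (f g : R -> R) : continuous f -> continuous g ->
  continuous (fun x => f x * g x).
Proof. by move=> cf cg x; apply: cvgM; [exact: cf|exact: cg]. Qed.

Lemma cfunN {R} (f : R -> R) : continuous f -> continuous (fun x => - f x).
Proof. by move=> cf x; apply: cvgN; exact: cf. Qed.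

Lemma cfunX {R} (f : R -> R) n : continuous f ->
  continuous (fun x => f x ^+ n).
Proof.
move=> cf; elim: n => [|n IH]; first exact: cst_continuous.
by under [X in continuous X]eq_fun do rewrite exprS; exact: cfunM.
Qed.

Lemma cfun_comp {R} (h f : R -> R) : continuous h -> continuous f ->
  continuous (fun x => h (f x)).
Proof. by move=> ch cf x; apply: continuous_comp; [exact: cf|exact: ch]. Qed.

Lemma cfunV {R} (f : R -> R) : (forall x, f x != 0) -> continuous f ->
  continuous (fun x => (f x)^-1).
Proof. by move=> f0 cf x; apply: cvgV; [exact: f0|exact: cf]. Qed.

Lemma cfun_ln {R} (f : R -> R) : (forall x, 0 < f x) -> continuous f ->
  continuous (fun x => ln (f x)).
Proof.
by move=> f0 cf x; apply: continuous_comp; [exact: cf|exact/continuous_ln/f0].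
Qed.

Lemma cfun_cst {R} (c : R) : continuous (fun _ : R => c).
Proof. exact: cst_continuous. Qed.

Lemma cfun_id {R} : continuous (fun x : R => x).
Proof. by move=> x; exact: cvg_id. Qed.

Lemma cfun_norm {R} (f : R -> R) : continuous f ->
  continuous (fun x => `|f x|).
Proof. by move=> cf; apply: cfun_comp => //; exact: norm_continuous. Qed.

Lemma cfun_max {R} (f g : R -> R) : continuous f -> continuous g ->
  continuous (fun x => Num.max (f x) (g x)).
Proof. by move=> cf cg x; apply: continuous_max; [exact: cf|exact: cg]. Qed.

Ltac cont := try assumption;
  try lazymatch goal with
  | |- continuous (fun _ => _) => idtac
  | |- continuous ?f => change (continuous (fun x => f x))
  end;
  lazymatch goal with
  | |- continuous (fun x => x) => exact: cfun_id
  | |- continuous (fun _ => ?c) => exact: cfun_cst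
  | |- continuous (fun x => _ + _) => apply: cfunD; cont
  | |- continuous (fun x => _ * _) => apply: cfunM; cont
  | |- continuous (fun x => - _) => apply: cfunN; cont
  | |- continuous (fun x => _ ^+ _) => apply: cfunX; cont
  | |- continuous (fun x => _^-1) => apply: cfunV; [|cont]
  | |- continuous (fun x => cos _) => apply: (cfun_comp (@continuous_cos _)); cont
  | |- continuous (fun x => sin _) => apply: (cfun_comp (@continuous_sin _)); cont
  | |- continuous (fun x => expR _) => apply: (cfun_comp (@continuous_expR _)); cont
  | |- continuous (fun x => ln _) => apply: cfun_ln; [|cont]
  | |- continuous (fun x => `|_|) => apply: cfun_norm; cont
  | |- continuous (fun x => Num.max _ _) => apply: cfun_max; cont
  | _ => idtac
  end.

(* A transparent copy of [is_derive] on which type class resolution does not fire, so that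
   [derv] controls the shape of the derivative. *)
Definition has_deriv {R} (x : R) (f : R -> R) (df : R) := is_derive x 1 f df.

Lemma dfun_id {R} (x : R) : has_deriv x (fun y : R => y) 1.
Proof. exact: is_derive_id. Qed.

Lemma dfun_cst {R} (x c : R) : has_deriv x (fun y : R => c) 0.
Proof. exact: is_derive_cst. Qed.

Lemma dfunD {R} (x : R) (f g : R -> R) (df dg : R) :
  has_deriv x f df -> has_deriv x g dg ->
  has_deriv x (fun y => f y + g y) (df + dg).
Proof. by move=> hf hg; exact: (is_deriveD hf hg). Qed.

Lemma dfunN {R} (x : R) (f : R -> R) (df : R) :
  has_deriv x f df -> has_deriv x (fun y => - f y) (- df).
Proof. by move=> hf; exact: (is_deriveN hf). Qed.

Lemma dfunM {R} (x : R) (f g : R -> R) (df dg : R) :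
  has_deriv x f df -> has_deriv x g dg ->
  has_deriv x (fun y => f y * g y) (df * g x + f x * dg).
Proof.
move=> hf hg; apply: is_derive_eq (is_deriveM hf hg) _.
by rewrite /GRing.scale/= addrC; congr (_ + _); rewrite mulrC.
Qed.

Lemma dfun_comp {R} (x : R) (h f : R -> R) (dh df : R) :
  is_derive (f x) 1 h dh -> has_deriv x f df ->
  has_deriv x (fun y => h (f y)) (dh * df).
Proof. by move=> hh hf; exact: (is_derive1_comp hh hf). Qed.

Lemma dfunV {R} (x : R) (f : R -> R) (df : R) :
  f x != 0 -> has_deriv x f df ->
  has_deriv x (fun y => (f y)^-1) (- df / f x ^+ 2).
Proof.
move=> f0 hf; apply: is_derive_eq (is_deriveV f0 hf) _.
by rewrite /GRing.scale/= mulNr mulrC mulNr.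
Qed.

Lemma dfun_cos {R} (x : R) (f : R -> R) (df : R) :
  has_deriv x f df -> has_deriv x (fun y => cos (f y)) (- sin (f x) * df).
Proof. by move=> hf; apply: dfun_comp. Qed.

Lemma dfun_sin {R} (x : R) (f : R -> R) (df : R) :
  has_deriv x f df -> has_deriv x (fun y => sin (f y)) (cos (f x) * df).
Proof. by move=> hf; apply: dfun_comp. Qed.

Lemma dfun_exp {R} (x : R) (f : R -> R) (df : R) :
  has_deriv x f df -> has_deriv x (fun y => expR (f y)) (expR (f x) * df).
Proof. by move=> hf; apply: dfun_comp. Qed.

Lemma dfun_ln {R} (x : R) (f : R -> R) (df : R) : 0 < f x ->
  has_deriv x f df -> has_deriv x (fun y => ln (f y)) ((f x)^-1 * df).
Proof. by move=> f0; apply: dfun_comp; exact: is_derive1_ln. Qed.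

Lemma dfun_atan {R} (x : R) (f : R -> R) (df : R) :
  has_deriv x f df ->
  has_deriv x (fun y => atan (f y)) ((1 + f x ^+ 2)^-1 * df).
Proof. by move=> hf; apply: dfun_comp. Qed.

Lemma dfun_eq {R} (x : R) (f : R -> R) (df df' : R) :
  has_deriv x f df -> df = df' -> is_derive x 1 f df'.
Proof. by move=> h <-. Qed.

Ltac derv_rec := try eassumption;
  try lazymatch goal with
  | |- has_deriv _ (fun _ => _) _ => idtac
  | |- has_deriv ?x ?f ?d => change (has_deriv x (fun y => f y) d)
  end;
  lazymatch goal with
  | |- has_deriv _ (fun x => x) _ => exact: dfun_id
  | |- has_deriv _ (fun _ => ?c) _ => exact: dfun_cst
  | |- has_deriv _ (fun x => _ + _) _ => apply: dfunD; derv_rec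
  | |- has_deriv _ (fun x => - _) _ => apply: dfunN; derv_rec
  | |- has_deriv _ (fun x => _ * _) _ => apply: dfunM; derv_rec
  | |- has_deriv _ (fun x => cos _) _ => apply: dfun_cos; derv_rec
  | |- has_deriv _ (fun x => sin _) _ => apply: dfun_sin; derv_rec
  | |- has_deriv _ (fun x => expR _) _ => apply: dfun_exp; derv_rec
  | |- has_deriv _ (fun x => atan _) _ => apply: dfun_atan; derv_rec
  | |- has_deriv _ (fun x => ln _) _ => apply: dfun_ln; [|derv_rec]
  | |- has_deriv _ (fun x => _^-1) _ => apply: dfunV; [|derv_rec]
  | _ => idtac
  end.
Ltac derv := eapply dfun_eq; [derv_rec | cbv beta].

(** * Exponential damping and the Poisson kernel *)

(** Integrability is an output: on the half-line the fundamental theorem for nonnegative functions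
    yields a finite extended integral. F is an antiderivative for x > 0 only, so formulas without
    absolute values can be used. *)
Lemma even_intble {R} (f F : R -> R) (l : R) :
  (forall x, 0 <= f x) -> continuous f -> (forall x, f (- x) = f x) ->
  (forall x : R, 0 < x -> is_derive x 1 F (f x)) -> {for 0, continuous F} ->
  F x @[x --> +oo] --> l ->
  intble f /\ \int[mu]_x f x = 2 * (l - F 0).
Proof.
move=> f0 cf fN dF cF Fl.
have E : (\int[mu]_x (f x)%:E = (2 * (l - F 0))%:E)%E.
  rewrite ge0_symfun_integralT//; last by move=> x /=; rewrite fN.
  rewrite -set_itvcy (@ge0_continuous_FTC2y _ f F 0 l)//.
  - exact: continuous_subspaceT.
  - by move=> x x0; have [] := dF x x0.
  - exact: cvg_at_right_filter.
  - move=> x; rewrite in_itv/= andbT => x0.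
    by rewrite derive1E; have [_ ->] := dF x x0.
split; last by rewrite /Rintegral E.
apply/integrableP; split.
  by apply/measurable_EFinP; exact: continuous_measurable_fun.
rewrite (_ : (\int[mu]_x `|(EFin \o f) x| = (2 * (l - F 0))%:E)%E) ?ltry//.
by rewrite -E; apply: eq_integral => x _ /=; rewrite ger0_norm.
Qed.

Lemma cvgr_expRM {R} (a : R) : 0 < a ->
  expR (- (a * x)) @[x --> +oo] --> (0 : R).
Proof.
move=> a0; apply: (@cvg_comp _ _ _ (fun x => a * x) (fun x => expR (- x))
  _ (pinfty_nbhs R)); last exact: cvgr_expR.
exact: gt0_cvgMry.
Qed.

(** Serves twice: with a fixed rate as dominating function, and with a rate tending to 0 as Abel
    damping of Fourier integrals. *)
Definition expN {R} (a x : R) : R := expR (- (a * `|x|)).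

Lemma continuous_expN {R} (a : R) : continuous (expN a).
Proof. by rewrite /expN; cont. Qed.

Lemma expN_ge0 {R} (a x : R) : 0 <= expN a x.
Proof. exact: expR_ge0. Qed.

Lemma expN_intble {R} (a : R) : 0 < a ->
  intble (expN a) /\ \int[mu]_x expN a x = 2 / a.
Proof.
move=> a0; pose F (x : R) := - (expR (- (a * x)) / a).
have [i E] : intble (expN a) /\ \int[mu]_x expN a x = 2 * (0 - F 0).
  apply: even_intble.
  - by move=> x; exact: expR_ge0.
  - exact: continuous_expN.
  - by move=> x; rewrite /expN normrN.
  - move=> x x0; rewrite /F; derv.
    by rewrite /expN gtr0_norm//; field; rewrite gt_eqF.
  - suff : continuous F by exact.
    by rewrite /F; cont.
  - rewrite (_ : 0 = - (0 / a)); last by rewrite mul0r oppr0.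
    by apply: cvgN; apply: cvgMr_tmp; exact: cvgr_expRM.
split => //; rewrite E /F mulr0 oppr0 expR0; ring.
Qed.

Lemma intble_expN {R} (K : R) : intble (fun x => K * expN 1 x).
Proof. exact: intbleZ (expN_intble ltr01).1. Qed.

(** 2 pi times the Poisson kernel of the half-plane at height e, that is, the Fourier transform of
    [expN e]. Its mass 2 pi is the constant of inversion and Plancherel. *)
Definition poisson {R} (e x : R) : R := 2 * e / (e ^+ 2 + x ^+ 2).

Lemma poisson_ge0 {R} (e x : R) : 0 < e -> 0 <= poisson e x.
Proof.
move=> e0; apply: divr_ge0; first by apply: mulr_ge0 => //; exact: ltW.
by apply: addr_ge0; exact: sqr_ge0.
Qed.

Lemma poisson_den {R} (e x : R) : 0 < e -> 0 < e ^+ 2 + x ^+ 2.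
Proof. by move=> e0; rewrite ltr_pwDl ?exprn_gt0 ?sqr_ge0. Qed.

Lemma poisson_intble {R} (e : R) : 0 < e ->
  intble (poisson e) /\ \int[mu]_x poisson e x = 2 * pi.
Proof.
move=> e0; pose F (x : R) := 2 * atan (x / e).
have [i E] : intble (poisson e) /\ \int[mu]_x poisson e x = 2 * (2 * (pi / 2) - F 0).
  apply: even_intble.
  - by move=> x; exact: poisson_ge0.
  - rewrite /poisson; cont => x; by rewrite gt_eqF// poisson_den.
  - by move=> x; rewrite /poisson sqrrN.
  - move=> x x0; rewrite /F; derv; rewrite ?gt_eqF//.
    by rewrite /poisson; field; rewrite !gt_eqF ?poisson_den.
  - suff : continuous F by exact.
    rewrite /F; cont; apply: (@cfun_comp _ atan); last by cont.
    exact: continuous_atan.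
  - apply: cvgMl_tmp; apply: (@cvg_comp _ _ _ (fun x => x / e) atan _ (pinfty_nbhs R)).
      rewrite (_ : (fun x => x / e) = (fun x => e^-1 * x)).
        by apply: gt0_cvgMry => //; rewrite invr_gt0.
      by apply/funext => x; rewrite mulrC.
    exact: cvgy_atan.
by split => //; rewrite E /F mul0r atan0; lra.
Qed.

Lemma Int_expN_cos {R} (e x : R) : 0 < e ->
  \int[mu]_s (expN e s * cos (x * s)) = poisson e x.
Proof.
move=> e0.
have [ie Ee] := expN_intble e0.
have ic : intble (fun s => expN e s * cos (x * s)).
  by apply: (@intble_bdM _ 1) => //; [meas|move=> s; exact: cos_max].
have dn := poisson_den x e0.
pose F (s : R) := - (expR (- (e * s)) / e) +
  expR (- (e * s)) * (x * sin (x * s) - e * cos (x * s)) / (e ^+ 2 + x ^+ 2).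
(* [even_intble] asks for a nonnegative integrand, so [expN e], of known integral 2 / e, is added to
   make 1 + cos appear, and is subtracted at the end. *)
have [_ E] : intble (fun s => expN e s + expN e s * cos (x * s)) /\
    \int[mu]_s (expN e s + expN e s * cos (x * s)) = 2 * (0 - F 0).
  apply: even_intble.
  - move=> y; rewrite -{1}(mulr1 (expN e y)) -mulrDr; apply: mulr_ge0; first exact: expR_ge0.
    by rewrite -lerBlDl sub0r cos_geN1.
  - by have ? := @continuous_expN R e; cont.
  - by move=> s; rewrite /expN normrN mulrN cosN.
  - move=> s s0; rewrite /F; derv; rewrite ?gt_eqF//.
    by rewrite /expN gtr0_norm//; field; rewrite !gt_eqF.
  - suff : continuous F by exact.
    by rewrite /F; cont => _; rewrite gt_eqF.
  - rewrite -[X in _ --> X](addr0 0); apply: cvgD.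
      rewrite -[X in _ --> X]oppr0 -(mul0r e^-1).
      by apply: cvgN; apply: cvgMr_tmp; exact: cvgr_expRM.
    rewrite -(mul0r (e ^+ 2 + x ^+ 2)^-1); apply: cvgMr_tmp.
    apply/cvgr0Pnorm_le => eps eps0.
    have M0 : 0 < `|x| + e + 1 by rewrite ltr_wpDl// addr_ge0// ltW.
    have := cvgr_expRM e0 => /cvgr0Pnorm_le/(_ (eps / (`|x| + e + 1))).
    rewrite divr_gt0// => /(_ isT) h.
    have : \forall s \near +oo, `|expR (- (e * s))| <= eps / (`|x| + e + 1) by exact: h.
    apply: filterS => y.
    rewrite ler_pdivlMr// normrM; apply: le_trans; rewrite ler_wpM2l//.
    rewrite (le_trans (ler_normB _ _))// !normrM (gtr0_norm e0).
    rewrite -[leRHS]addrA lerD ?ler_piMr ?sin_max//.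
    rewrite (@le_trans _ _ e)// ?lerDl// ler_piMr ?cos_max// ltW//.
move: E; rewrite IntD// Ee /F !mulr0 oppr0 expR0 sin0 cos0 => h.
rewrite -[LHS](addKr (2 / e)) h.
by rewrite /poisson; field; rewrite !gt_eqF.
Qed.

(** * Fourier analysis of functions dominated by an exponential *)

(** Holds for every continuous function supported in [m, P] with m > 0 ([supp_expdom]). It gives at
    once boundedness, integrability of measurable functions, and the separated bounds for
    [Int_Fubini]. *)
Definition expdom {R} (K : R) (G : R -> R) := forall x, `|G x| <= K * expN 1 x.

Lemma expN_le1 {R} (a x : R) : 0 <= a -> expN a x <= 1.
Proof. by move=> a0; rewrite /expN expR_le1 oppr_le0 mulr_ge0. Qed.

Lemma expdom_ge0 {R} (K : R) (G : R -> R) : expdom K G -> 0 <= K.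
Proof.
move=> /(_ 0); rewrite /expN normr0 mulr0 oppr0 expR0 mulr1.
exact: le_trans.
Qed.

Lemma expdom_bd {R} (K : R) (G : R -> R) : expdom K G -> forall x, `|G x| <= K.
Proof.
move=> GK x; rewrite (le_trans (GK x))// ler_piMr ?expN_le1//.
exact: expdom_ge0 GK.
Qed.

Lemma expdom_intble {R} (K : R) (G : R -> R) :
  measurable_fun setT G -> expdom K G -> intble G.
Proof.
by move=> mG GK; apply: intble_dom mG (intbleZ K (expN_intble ltr01).1) GK.
Qed.

Lemma measurable_shift {R} (G : R -> R) (c : R) :
  measurable_fun setT G -> measurable_fun setT (fun x : R => G (x + c)).
Proof. by move=> mG; apply: mfun_comp => //; meas. Qed.

Lemma measurable_expN {R} (a : R) : measurable_fun setT (expN a).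
Proof. by apply: continuous_measurable_fun; exact: continuous_expN. Qed.

Lemma measurable_poisson {R} (e : R) : measurable_fun setT (poisson e).
Proof. by rewrite /poisson; meas. Qed.

Lemma expN_shift {R} (h x : R) : `|h| <= 1 ->
  expN 1 (x + h) <= expR 1 * expN 1 x.
Proof.
move=> h1; rewrite /expN !mul1r -expRD ler_expR.
have : `|x| <= `|x + h| + `|h|.
  by rewrite -{1}(addrK h x) (le_trans (ler_normB _ _)).
by lra.
Qed.

(** Translating p by pi / T reverses the sign of the sine, so twice the integral pairs G(p) - G(p +
    pi / T) with a bounded factor; continuity of G and dominated convergence finish. The phase
    [beta n] may vary arbitrarily with n, which [bdry_cvg] exploits. *)
Lemma Riemann_Lebesgue {R} (K : R) (G : R -> R) (T beta : nat -> R) :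
  continuous G -> expdom K G -> (forall n, T n != 0) ->
  (T n)^-1 @[n --> \oo] --> 0 ->
  \int[mu]_p (G p * sin (p * T n + beta n)) @[n --> \oo] --> 0.
Proof.
move=> cG GK T0 Tn.
have mG : measurable_fun setT G by exact: continuous_measurable_fun.
have iG := expdom_intble mG GK.
have K0 := expdom_ge0 GK.
pose h n := pi / T n.
have h0 : h n @[n --> \oo] --> 0.
  by rewrite -[X in _ --> X](mulr0 pi); exact: cvgMl_tmp.
(* The shift is cut to [-1, 1] to have one dominating function for all n ([expN_shift]); eventually
   it equals pi / T n. *)
pose k n := Num.max (-1) (Num.min 1 (h n)).
have k1 n : `|k n| <= 1.
  by rewrite ler_norml /k le_max lexx/= ge_max ge_min lexx; lra.
have kh : \forall n \near \oo, k n = h n.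
  have := h0 => /cvgr0Pnorm_le/(_ 1 ltr01); apply: filterS => n.
  by rewrite ler_norml => /andP[h1 h2]; rewrite /k min_r// max_r.
have k0 : k n @[n --> \oo] --> 0.
  by apply: cvg_trans h0; apply: near_eq_cvg; apply: filterS kh => n ->.
have mk n : measurable_fun setT (fun x : R => `|G x - G (x + k n)|).
  by have ? := measurable_shift (k n) mG; meas.
have [_ D] : intble (fun _ : R => 0) /\
    \int[mu]_p `|G p - G (p + k n)| @[n --> \oo] --> \int[mu]_(p in [set: R]) (0 : R).
  apply: (@Int_dct _ _ _ (fun x => K * (1 + expR 1) * expN 1 x)).
  - exact: mk.
  - move=> x; rewrite (_ : 0 = `|G x - G x|); last by rewrite subrr normr0.
    apply: cvg_norm.
    apply: cvgB; first exact: cvg_cst.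
    apply: (@cvg_comp _ _ _ (fun n => x + k n) G _ (nbhs x)); last exact: cG.
    have : x + k n @[n --> \oo] --> x + 0 by apply: cvgD => //; exact: cvg_cst.
    by rewrite addr0.
  - exact: intble_expN.
  - move=> n x; rewrite normr_id (le_trans (ler_normB _ _))//.
    rewrite mulrDr mulr1 mulrDl lerD//.
    rewrite (le_trans (GK _))// -mulrA ler_wpM2l//.
    exact: expN_shift.
rewrite Rintegral_cst// mul0r in D.
apply/cvgr0Pnorm_le => e e0.
near=> n.
have Ekn : k n = h n by near: n.
have De : `|\int[mu]_p `|G p - G (p + k n)| | <= e.
  by near: n; move: e e0; apply/cvgr0Pnorm_le.
set I := \int[mu]_p _.
have msin : measurable_fun setT (fun p : R => sin (p * T n + beta n)) by meas.
have i1 : intble (fun p => G p * sin (p * T n + beta n)).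
  by apply: (@intble_bdM _ 1) => // x; exact: sin_max.
have [i2 I2] := Int_shift (h n) i1.
have iGs := (Int_shift (h n) iG).1.
have i3 : intble (fun p => G (p + h n) * sin (p * T n + beta n)).
  by apply: (@intble_bdM _ 1) => // x; exact: sin_max.
have I3 : I = - \int[mu]_p (G (p + h n) * sin (p * T n + beta n)).
  rewrite -IntN// /I -I2; apply: eq_Int => p.
  rewrite (_ : (p + h n) * T n + beta n = p * T n + beta n + pi).
    by rewrite sinDpi mulrN.
  by rewrite /h; field.
have I4 : I *+ 2 = \int[mu]_p ((G p - G (p + h n)) * sin (p * T n + beta n)).
  transitivity (\int[mu]_p (G p * sin (p * T n + beta n)
      - G (p + h n) * sin (p * T n + beta n))).
    by rewrite IntB// mulr2n {2}I3.
  by apply: eq_Int => p; rewrite mulrBl.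
have h2I : `|I *+ 2| <= e.
  apply: le_trans De; rewrite I4 Ekn.
  have iD : intble (fun p => G p - G (p + h n)) by exact: intbleB.
  rewrite (le_trans _ (ler_norm _))//; apply: normr_Int_le.
  - by apply: (@intble_bdM _ 1) => // x; exact: sin_max.
  - exact: intble_norm iD.
  - by move=> x; rewrite normrM ler_piMr ?sin_max.
apply: le_trans h2I; rewrite normrMn mulr2n lerDl//.
Unshelve. all: by end_near. Qed.

(** Real and imaginary parts of the unnormalised transform with kernel e^(ips); applied to the
    packet in momentum space they give, up to [c2pi], the packet in position space. *)
Definition ftC {R} (G : R -> R) (s : R) : R := \int[mu]_p (G p * cos (p * s)).
Definition ftS {R} (G : R -> R) (s : R) : R := \int[mu]_p (G p * sin (p * s)).

Lemma intble_cos {R} (G : R -> R) (a b : R) : intble G ->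
  intble (fun p => G p * cos (p * a + b)).
Proof.
by move=> iG; apply: (@intble_bdM _ 1) => //; [meas|move=> x; exact: cos_max].
Qed.

Lemma intble_sin {R} (G : R -> R) (a b : R) : intble G ->
  intble (fun p => G p * sin (p * a + b)).
Proof.
by move=> iG; apply: (@intble_bdM _ 1) => //; [meas|move=> x; exact: sin_max].
Qed.

Lemma intble_cos0 {R} (G : R -> R) (a : R) : intble G ->
  intble (fun p => G p * cos (p * a)).
Proof.
by move=> iG; apply: (@intble_bdM _ 1) => //; [meas|move=> x; exact: cos_max].
Qed.

Lemma intble_sin0 {R} (G : R -> R) (a : R) : intble G ->
  intble (fun p => G p * sin (p * a)).
Proof.
by move=> iG; apply: (@intble_bdM _ 1) => //; [meas|move=> x; exact: sin_max].
Qed.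

Lemma ftC_bd {R} (G : R -> R) (s : R) : intble G ->
  `|ftC G s| <= \int[mu]_p `|G p|.
Proof.
move=> iG; apply: normr_Int_le; [exact: intble_cos0|exact: intble_norm iG|].
by move=> x; rewrite normrM ler_piMr ?cos_max.
Qed.

Lemma ftS_bd {R} (G : R -> R) (s : R) : intble G ->
  `|ftS G s| <= \int[mu]_p `|G p|.
Proof.
move=> iG; apply: normr_Int_le; [exact: intble_sin0|exact: intble_norm iG|].
by move=> x; rewrite normrM ler_piMr ?sin_max.
Qed.

Lemma continuous_ftC {R} (G : R -> R) : intble G -> continuous (ftC G).
Proof.
move=> iG; have mG := intble_measurable iG.
apply: (@Int_continuous _ _ (fun p => `|G p|)).
- by move=> s; meas.
- by move=> p; cont.
- exact: intble_norm iG.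
- by move=> s p; rewrite normrM ler_piMr ?cos_max.
Qed.

Lemma continuous_ftS {R} (G : R -> R) : intble G -> continuous (ftS G).
Proof.
move=> iG; have mG := intble_measurable iG.
apply: (@Int_continuous _ _ (fun p => `|G p|)).
- by move=> s; meas.
- by move=> p; cont.
- exact: intble_norm iG.
- by move=> s p; rewrite normrM ler_piMr ?sin_max.
Qed.

Lemma poisson_le {R} (e x : R) : 0 < e -> poisson e x <= 2 / e.
Proof.
move=> e0; rewrite /poisson ler_pdivrMr ?poisson_den// -subr_ge0.
rewrite (_ : _ - _ = 2 * x ^+ 2 / e); last by field; rewrite gt_eqF.
by apply: divr_ge0; [apply: mulr_ge0 => //; exact: sqr_ge0|exact: ltW].
Qed.

Lemma ft_mix_bd {R} (G : R -> R) (a s : R) : intble G ->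
  `|cos a * ftC G s + sin a * ftS G s| <= \int[mu]_p `|G p| + \int[mu]_p `|G p|.
Proof.
move=> iG; rewrite (le_trans (ler_normD _ _))// lerD// normrM.
  by rewrite (le_trans _ (ftC_bd s iG))// ler_piMl ?cos_max.
by rewrite (le_trans _ (ftS_bd s iG))// ler_piMl ?sin_max.
Qed.

(** Abel-damped inversion at p: Fubini moves the damping inside, where its cosine transform is the
    Poisson kernel, so the damped integral is a smoothing of G around p. *)
Lemma ft_poisson {R} (K : R) (G : R -> R) (e p : R) :
  measurable_fun setT G -> expdom K G -> 0 < e ->
  \int[mu]_s (expN e s * (cos (p * s) * ftC G s + sin (p * s) * ftS G s)) =
  \int[mu]_x (G (x + p) * poisson e x).
Proof.
move=> mG GK e0; have iG := expdom_intble mG GK.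
have me := @measurable_expN R e.
pose f s q := expN e s * (G q * cos ((q - p) * s)).
have [||||i1 i2 i3 i4 E] := @Int_Fubini _ f (expN e) (fun q => K * expN 1 q).
- by have ? := mfun_fst me; have ? := mfun_snd mG; rewrite /f; meas.
- exact: (expN_intble e0).1.
- exact: intble_expN.
- move=> s q; rewrite normrM ger0_norm ?expN_ge0// ler_wpM2l ?expN_ge0//.
  by rewrite (le_trans _ (GK q))// normrM ler_piMr ?cos_max.
transitivity (\int[mu]_s (\int[mu]_q f s q)).
  apply: eq_Int => s; rewrite /f IntZ; last first.
    apply: (@intble_bdM _ 1) => //; [by meas|by move=> x; exact: cos_max].
  congr (_ * _); rewrite /ftC /ftS -!IntZ; [|exact: intble_sin0|exact: intble_cos0].
  rewrite -IntD; [|exact/intbleZ/intble_cos0|exact/intbleZ/intble_sin0].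
  apply: eq_Int => q; rewrite mulrBl cosB; ring.
rewrite E; transitivity (\int[mu]_q (G q * poisson e (q - p))).
  apply: eq_Int => q; rewrite -Int_expN_cos// -IntZ.
    by apply: eq_Int => s; rewrite /f; ring.
  apply: (@intble_bdM _ 1) => //; [by meas|by move=> x; exact: cos_max|].
  exact: (expN_intble e0).1.
have iP : intble (fun q => G q * poisson e (q - p)).
  apply: (@intble_bdM _ (2 / e)); last exact: iG.
    by rewrite /poisson; meas.
  by move=> x; rewrite ger0_norm ?poisson_ge0 ?poisson_le.
rewrite -(Int_shift p iP).2; apply: eq_Int => x.
by rewrite addrK.
Qed.

Lemma splitr_half {R} (a : R) : a = 2^-1 * (a + a).
Proof. lra. Qed.

Lemma mul_le_half_sqr {R} (a b : R) : a * b <= 2^-1 * (a ^+ 2 + b ^+ 2).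
Proof. by have := sqr_ge0 (a - b); rewrite sqrrB; lra. Qed.

(** Expanding one factor of the energy turns the damped energy into the Poisson average over x of
    the autocorrelation of G at lag x, and each autocorrelation is at most the integral of G^2. *)
Lemma ft_energy_poisson {R} (K : R) (G : R -> R) (e : R) :
  measurable_fun setT G -> expdom K G -> 0 < e ->
  intble (fun s => expN e s * (ftC G s ^+ 2 + ftS G s ^+ 2)) /\
  \int[mu]_s (expN e s * (ftC G s ^+ 2 + ftS G s ^+ 2)) <=
    2 * pi * \int[mu]_p (G p ^+ 2).
Proof.
move=> mG GK e0; have iG := expdom_intble mG GK.
have K0 := expdom_ge0 GK; have GbK := expdom_bd GK.
have me := @measurable_expN R e.
have mC := continuous_measurable_fun (continuous_ftC iG).
have mS := continuous_measurable_fun (continuous_ftS iG).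
have iG2 : intble (fun p => G p ^+ 2) by exact: (@intble_bdM _ K).
pose N := \int[mu]_p `|G p|.
pose f s p := expN e s * (G p * (cos (p * s) * ftC G s + sin (p * s) * ftS G s)).
have [||||i1 i2 i3 i4 E] := @Int_Fubini _ f (fun s => (N + N) * expN e s) (fun q => K * expN 1 q).
- have ? := mfun_fst me; have ? := mfun_snd mG.
  by have ? := mfun_fst mC; have ? := mfun_fst mS; rewrite /f; meas.
- exact: intbleZ (expN_intble e0).1.
- exact: intble_expN.
- move=> s q; rewrite /f !normrM (ger0_norm (expN_ge0 _ _)).
  rewrite [leRHS](_ : _ = expN e s * (K * expN 1 q * (N + N))); last by ring.
  apply: ler_wpM2l; first exact: expN_ge0.
  by apply: ler_pM; [| |exact: GK|exact: ft_mix_bd].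
have EL s : \int[mu]_p f s p = expN e s * (ftC G s ^+ 2 + ftS G s ^+ 2).
  transitivity (\int[mu]_p (expN e s * ftC G s * (G p * cos (p * s)) +
     expN e s * ftS G s * (G p * sin (p * s)))).
    by apply: eq_Int => p; rewrite /f; ring.
  rewrite IntD; [|exact/intbleZ/intble_cos0|exact/intbleZ/intble_sin0].
  rewrite !IntZ; [|exact/intble_sin0|exact/intble_cos0].
  by rewrite -/(ftC G s) -/(ftS G s); ring.
have iE : intble (fun s => expN e s * (ftC G s ^+ 2 + ftS G s ^+ 2)).
  rewrite (_ : (fun s => _) = (fun s => \int[mu]_p f s p)); first exact: i3.
  by apply/funext => s; rewrite EL.
split; [exact: iE|].
rewrite -(eq_Int EL) E.
have mP := @measurable_poisson R e.
have [iP eP] := poisson_intble e0.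
pose g p x := G p * (G (x + p) * poisson e x).
have mg : measurable_fun (plane R) (fun z => g z.1 z.2).
  have ? := mfun_fst mG; have ? := mfun_snd mP.
  have ? : measurable_fun (plane R)
      (fun z => G (z.2 + z.1)) by apply: (mfun_comp mG); meas.
  by rewrite /g; meas.
have [||||j1 j2 j3 j4 E'] := @Int_Fubini _ g (fun p => K * expN 1 p) (fun x => K * poisson e x).
- exact: mg.
- exact: intble_expN.
- exact: (intbleZ _ iP).
- move=> p x; rewrite /g normrM normrM (ger0_norm (poisson_ge0 _ e0)).
  apply: ler_pM; [exact: normr_ge0| |exact: GK|].
    by apply: mulr_ge0; [exact: normr_ge0|exact: poisson_ge0].
  by apply: ler_wpM2r; [exact: poisson_ge0|exact: GbK].
have EM p : \int[mu]_s f s p = \int[mu]_x g p x.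
  rewrite IntZ; last first.
    apply: (@intble_bdM _ (2 / e)); [exact: mP| |exact: (Int_shift p iG).1].
    by move=> x; rewrite ger0_norm ?poisson_ge0 ?poisson_le.
  rewrite -(ft_poisson p mG GK e0) -IntZ.
    by apply: eq_Int => s; rewrite /f; ring.
  apply: (@intble_bdM _ (N + N)); last exact: (expN_intble e0).1.
    by meas.
  by move=> s; exact: ft_mix_bd.
rewrite (eq_Int EM) E' -eP mulrC -IntZ; last exact: iP.
apply: le_Int; [exact: j4|exact: intbleZ|move=> x].
have iGx := (Int_shift x iG2).
rewrite (_ : \int[mu]_p g p x = poisson e x * \int[mu]_p (G p * G (p + x))); last first.
  rewrite -IntZ; last first.
    apply: (@intble_bdM _ K); [exact: measurable_shift|by move=> p; exact: GbK|exact: iG].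
  by apply: eq_Int => p; rewrite /g [x + p]addrC; ring.
rewrite [leRHS]mulrC; apply: ler_wpM2l; first exact: poisson_ge0.
(* G(p) G(p + x) is at most half the sum of the squares, and both squares have the same integral by
   translation. *)
have <- : \int[mu]_p (2^-1 * (G p ^+ 2 + G (p + x) ^+ 2)) = \int[mu]_p G p ^+ 2.
  rewrite IntZ; last exact: (intbleD iG2 iGx.1).
  by rewrite (IntD iG2 iGx.1) iGx.2 -splitr_half.
apply: le_Int.
- apply: (@intble_bdM _ K); [exact: measurable_shift|by move=> p; exact: GbK|exact: iG].
- exact/intbleZ/(intbleD iG2 iGx.1).
- by move=> p; exact: mul_le_half_sqr.
Qed.

(** The damping is removed by monotone convergence, which also yields integrability of the energy.
    It applies where integrability of the transforms themselves is unknown, as in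
    [coef_err_energy]. *)
Lemma Bessel {R} (K : R) (G : R -> R) :
  measurable_fun setT G -> expdom K G ->
  intble (fun s => ftC G s ^+ 2 + ftS G s ^+ 2) /\
  \int[mu]_s (ftC G s ^+ 2 + ftS G s ^+ 2) <= 2 * pi * \int[mu]_p (G p ^+ 2).
Proof.
move=> mG GK; have iG := expdom_intble mG GK.
have mC := continuous_measurable_fun (continuous_ftC iG).
have mS := continuous_measurable_fun (continuous_ftS iG).
pose P s := ftC G s ^+ 2 + ftS G s ^+ 2.
have P0 s : 0 <= P s by apply: addr_ge0; exact: sqr_ge0.
have mP : measurable_fun setT P by rewrite /P; meas.
pose e (n : nat) : R := n.+1%:R^-1.
have e0 n : 0 < e n by rewrite invr_gt0.
have cvgI : (\int[mu]_s (expN (e n) s * P s)%:E)%E @[n --> \oo] -->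
    (\int[mu]_s (P s)%:E)%E.
  have cvgP s : expN (e n) s * P s @[n --> \oo] --> P s.
    rewrite -[X in _ --> X]mul1r; apply: cvgMr_tmp.
    have : - (e n * `|s|) @[n --> \oo] --> - (0 * `|s|).
      by apply: cvgN; apply: cvgMr_tmp; exact: cvg_harmonic.
    rewrite mul0r oppr0 => h; rewrite -(expR0 R).
    apply: (@cvg_comp _ _ _ (fun n => - (e n * `|s|)) expR _ (nbhs (0 : R))).
      exact: h.
    exact: continuous_expR.
  rewrite (_ : (\int[mu]_s (P s)%:E)%E =
      (\int[mu]_s limn (fun n => (expN (e n) s * P s)%:E))%E).
    apply: (@cvg_monotone_convergence _ (measurableTypeR R) R mu setT measurableT
      (fun n s => (expN (e n) s * P s)%:E)).
    - move=> n; apply/measurable_EFinP; have ? := @measurable_expN R (e n); meas.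
    - by move=> n s _; rewrite lee_fin mulr_ge0// expN_ge0.
    - move=> s _ m n mn; rewrite lee_fin ler_wpM2r// /expN ler_expR lerN2.
      by rewrite ler_wpM2r// /e lef_pV2 ?posrE// ler_nat ltnS.
  apply: eq_integral => s _; apply/esym/cvg_lim => //.
  by apply: cvg_EFin; [exact: nearW|exact: cvgP].
have leI : (\int[mu]_s (P s)%:E <= (2 * pi * \int[mu]_p (G p ^+ 2))%:E)%E.
  rewrite -(cvg_lim _ cvgI)//; apply: lime_le.
    by apply/cvg_ex; eexists; exact: cvgI.
  near=> n.
  have [i1 h] := ft_energy_poisson mG GK (e0 n).
  by rewrite -EFin_Int ?lee_fin.
have iP : intble P.
  apply/integrableP; split; first exact/measurable_EFinP.
  rewrite (_ : (\int[mu]_x `|(EFin \o P) x|)%E = (\int[mu]_x (P x)%:E)%E).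
    exact: le_lt_trans leI (ltry _).
  by apply: eq_integral => x _ /=; rewrite ger0_norm.
split => //; by rewrite -lee_fin EFin_Int.
Unshelve. all: by end_near. Qed.

Lemma poisson_tail {R} (d e x : R) : 0 < d -> 0 < e -> d <= `|x| ->
  poisson e x <= e * (1 + (d ^+ 2)^-1) * poisson 1 x.
Proof.
move=> d0 e0 dx.
have d2x : d ^+ 2 <= x ^+ 2.
  by rewrite -(real_normK (num_real x)) lerXn2r ?nnegrE ?(ltW d0).
have x20 : 0 < x ^+ 2 by exact: lt_le_trans (exprn_gt0 2 d0) d2x.
have h1 : poisson e x <= 2 * e / x ^+ 2.
  rewrite /poisson ler_wpM2l ?mulr_ge0 ?(ltW e0)// lef_pV2 ?posrE ?poisson_den//.
  by rewrite lerDr sqr_ge0.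
apply: (le_trans h1).
rewrite [leRHS](_ : _ = 2 * e * ((1 + (d ^+ 2)^-1) / (1 ^+ 2 + x ^+ 2))); last first.
  by rewrite /poisson; ring.
rewrite ler_wpM2l ?mulr_ge0 ?(ltW e0)// ler_pdivlMr ?poisson_den//.
rewrite mulrDr expr1n mulr1 mulVf ?gt_eqF// addrC lerD2l.
by rewrite lef_pV2 ?posrE// exprn_gt0.
Qed.

Lemma half_over_pi {R} (a : R) : a / (4 * pi) * (2 * pi) = a / 2.
Proof. by move: pi (pi_gt0 R) => q q0; field; rewrite gt_eqF. Qed.

(** Approximate identity: close to 0 by continuity of G at p, away from 0 because the kernel is O(e)
    times [poisson 1] there ([poisson_tail]). *)
Lemma poisson_approx {R} (K : R) (G : R -> R) (p : R) :
  continuous G -> (forall x, `|G x| <= K) ->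
  \int[mu]_x (G (x + p) * poisson n.+1%:R^-1 x) @[n --> \oo] --> 2 * pi * G p.
Proof.
move=> cG GK.
have K0 : 0 <= K by exact: le_trans (GK 0).
pose e (n : nat) : R := n.+1%:R^-1.
have e0 n : 0 < e n by rewrite invr_gt0.
have mG := continuous_measurable_fun cG.
have mGp := measurable_shift p mG.
have pi0 := @pi_gt0 R.
have [iP1 EP1] := @poisson_intble R 1 ltr01.
apply/cvgrPdist_le => eps eps0.
pose eta := eps / (4 * pi).
have eta0 : 0 < eta by rewrite divr_gt0// mulr_gt0.
have := cG p => /cvgrPdist_le/(_ _ eta0) /nbhs_ballP[d /= d0 hd].
pose A := 2 * K * (1 + ((d : R) ^+ 2)^-1).
have A0 : 0 <= A.
  by rewrite /A; apply: mulr_ge0; [apply: mulr_ge0|apply: addr_ge0 => //; rewrite invr_ge0 sqr_ge0].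
near=> n.
have [iP EP] := poisson_intble (e0 n).
have iGP : intble (fun x => poisson (e n) x * G (x + p)).
  by apply: (@intble_bdM _ K); [exact: mGp|move=> x; exact: GK|exact: iP].
have -> : 2 * pi * G p - \int[mu]_x (G (x + p) * poisson (e n) x) =
    \int[mu]_x (poisson (e n) x * (G p - G (x + p))).
  rewrite -EP mulrC -IntZ; last exact: iP.
  rewrite [in X in _ - X](_ : (fun x => G (x + p) * _) = (fun x => poisson (e n) x * G (x + p))).
    rewrite -IntB; [|exact: (intbleZ _ iP)|exact: iGP].
    by apply: eq_Int => x; ring.
  by apply/funext => x; rewrite mulrC.
have bound x : `|poisson (e n) x * (G p - G (x + p))| <=
    eta * poisson (e n) x + A * e n * poisson 1 x.
  have P0 := poisson_ge0 x (e0 n).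
  have P10 := poisson_ge0 x (@ltr01 R).
  have Ae0 : 0 <= A * e n by apply: mulr_ge0 => //; exact: ltW.
  rewrite normrM (ger0_norm P0).
  have [xd|dx] := ltP `|x| d.
    have h : `|G p - G (x + p)| <= eta.
      by apply: hd; rewrite /ball/= opprD addrCA subrr addr0 normrN.
    rewrite -[leLHS]addr0; apply: lerD; last exact: mulr_ge0.
    by rewrite mulrC; exact: ler_wpM2r.
  rewrite -[leLHS]add0r; apply: lerD; first by apply: mulr_ge0 => //; exact: ltW.
  have h2 : `|G p - G (x + p)| <= 2 * K.
    by rewrite (le_trans (ler_normB _ _))//; have := GK p; have := GK (x + p); lra.
  have h3 := poisson_tail d0 (e0 n) dx.
  apply: (@le_trans _ _ (e n * (1 + (d ^+ 2)^-1) * poisson 1 x * (2 * K))).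
    by apply: ler_pM.
  by rewrite /A; lra.
apply: (@le_trans _ _ (\int[mu]_x (eta * poisson (e n) x + A * e n * poisson 1 x))).
  apply: normr_Int_le.
  - apply: (@intble_bdM _ (2 * K)); [by meas| |exact: iP].
    by move=> x; rewrite (le_trans (ler_normB _ _))//; have := GK p; have := GK (x + p); lra.
  - by apply: intbleD; [exact: (intbleZ _ iP)|exact: (intbleZ _ iP1)].
  - exact: bound.
rewrite IntD; [|exact: (intbleZ _ iP)|exact: (intbleZ _ iP1)].
rewrite (IntZ eta iP) (IntZ (A * e n) iP1).
have e1 : eta * (2 * pi) = eps / 2 by exact: half_over_pi.
rewrite EP EP1 e1.
suff : A * e n * (2 * pi) <= eps / 2 by lra.
rewrite -ler_pdivlMr ?mulr_gt0//.
near: n.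
have c : A * e n @[n --> \oo] --> A * 0 by apply: cvgMl_tmp; exact: cvg_harmonic.
rewrite mulr0 in c.
have := c => /cvgr0Pnorm_le/(_ (eps / 2 / (2 * pi))).
rewrite !divr_gt0 ?mulr_gt0// => /(_ isT); apply: filterS => n.
by apply: le_trans; exact: ler_norm.
Unshelve. all: by end_near. Qed.

(** The damped integral has two limits: the undamped integral, by dominated convergence, and 2 pi
    G(p), by [ft_poisson] and [poisson_approx]. *)
Lemma Fourier_inversion {R} (K : R) (G : R -> R) (p : R) :
  continuous G -> expdom K G -> intble (ftC G) -> intble (ftS G) ->
  \int[mu]_s (cos (p * s) * ftC G s + sin (p * s) * ftS G s) = 2 * pi * G p.
Proof.
move=> cG GK iC iS; have mG := continuous_measurable_fun cG.
have mC := intble_measurable iC; have mS := intble_measurable iS.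
pose e (n : nat) : R := n.+1%:R^-1.
have e0 n : 0 < e n by rewrite invr_gt0.
pose H s := cos (p * s) * ftC G s + sin (p * s) * ftS G s.
have mH : measurable_fun setT H by rewrite /H; meas.
have [_ D] : intble H /\ \int[mu]_s (expN (e n) s * H s) @[n --> \oo] --> \int[mu]_s H s.
  apply: (@Int_dct _ _ _ (fun s => `|ftC G s| + `|ftS G s|)).
  - by move=> n; have ? := @measurable_expN R (e n); meas.
  - move=> s; rewrite -[X in _ --> X]mul1r; apply: cvgMr_tmp.
    have : - (e n * `|s|) @[n --> \oo] --> - (0 * `|s|).
      by apply: cvgN; apply: cvgMr_tmp; exact: cvg_harmonic.
    rewrite mul0r oppr0 => h; rewrite -(expR0 R).
    apply: (@cvg_comp _ _ _ (fun n => - (e n * `|s|)) expR _ (nbhs (0 : R))).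
      exact: h.
    exact: continuous_expR.
  - by apply: intbleD; [exact: (intble_norm iC)|exact: (intble_norm iS)].
  - move=> n s; rewrite normrM (ger0_norm (expN_ge0 _ _)).
    rewrite (le_trans (ler_piMl (normr_ge0 _) (expN_le1 _ (ltW (e0 n)))))//.
    rewrite (le_trans (ler_normD _ _))// lerD// normrM ler_piMl ?cos_max ?sin_max//.
have L := @poisson_approx R K G p cG (expdom_bd GK).
apply: (@cvg_unique _ _ _ _ _ _ D) => //.
apply: cvg_trans L; apply: near_eq_cvg; apply: nearW => n.
by rewrite (ft_poisson p mG GK (e0 n)).
Qed.

(** Since the transforms are integrable, Fubini applies without damping and the inner integral is
    evaluated by inversion; hence an equality, where [Bessel] has an inequality. *)
Lemma Plancherel {R} (K : R) (G : R -> R) :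
  continuous G -> expdom K G -> intble (ftC G) -> intble (ftS G) ->
  \int[mu]_s (ftC G s ^+ 2 + ftS G s ^+ 2) = 2 * pi * \int[mu]_p (G p ^+ 2).
Proof.
move=> cG GK iC iS; have mG := continuous_measurable_fun cG.
have iG := expdom_intble mG GK.
have mC := intble_measurable iC; have mS := intble_measurable iS.
pose f s p := G p * (cos (p * s) * ftC G s + sin (p * s) * ftS G s).
have [||||_ _ _ _ E] := @Int_Fubini _ f (fun s => `|ftC G s| + `|ftS G s|) (fun q => K * expN 1 q).
- have ? := mfun_snd mG.
  by have ? := mfun_fst mC; have ? := mfun_fst mS; rewrite /f; meas.
- by apply: intbleD; [exact: (intble_norm iC)|exact: (intble_norm iS)].
- exact: intble_expN.
- move=> s q; rewrite /f normrM mulrC; apply: ler_pM; [exact: normr_ge0|exact: normr_ge0| |exact: GK].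
  rewrite (le_trans (ler_normD _ _))// lerD// normrM ler_piMl ?cos_max ?sin_max//.
have EL s : \int[mu]_p f s p = ftC G s ^+ 2 + ftS G s ^+ 2.
  transitivity (\int[mu]_p (ftC G s * (G p * cos (p * s)) +
     ftS G s * (G p * sin (p * s)))).
    by apply: eq_Int => p; rewrite /f; ring.
  rewrite IntD; [|exact/intbleZ/intble_cos0|exact/intbleZ/intble_sin0].
  rewrite !IntZ; [|exact/intble_sin0|exact/intble_cos0].
  by rewrite -/(ftC G s) -/(ftS G s) !expr2.
rewrite -(eq_Int EL) E -IntZ; last first.
  by apply: (@intble_bdM _ K); [exact: mG|exact: expdom_bd GK|exact: iG].
apply: eq_Int => p; rewrite /f IntZ; last first.
  apply: intbleD.
    rewrite (_ : (fun s => _) = (fun s => ftC G s * cos (s * p))).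
      exact: intble_cos0.
    by apply/funext => s; rewrite mulrC [p * s]mulrC.
  rewrite (_ : (fun s => _) = (fun s => ftS G s * sin (s * p))).
    exact: intble_sin0.
  by apply/funext => s; rewrite mulrC [p * s]mulrC.
rewrite (Fourier_inversion p cG GK iC iS); ring.
Qed.

(** * The rotated Gamma integral as a function of the angle *)

Lemma sin_lipschitz {R} (a b : R) : `|sin a - sin b| <= `|a - b|.
Proof.
wlog ab : a b / a < b.
  move=> H; have [ab|ba|->] := ltgtP a b; first exact: H.
    by rewrite distrC [leRHS]distrC; exact: H.
  by rewrite !subrr normr0.
have dS (x : R) : x \in `]a, b[ -> is_derive x 1 sin (cos x).
  by move=> _; exact: is_derive_sin.
have cS : {within `[a, b], continuous (@sin R)}.
  by apply: continuous_subspaceT; exact: continuous_sin.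
have [c _ h] := MVT ab dS cS.
by rewrite distrC h normrM distrC ler_piMl ?cos_max.
Qed.

Lemma one_sub_cos_le {R} (x : R) : 1 - cos x <= x ^+ 2 / 2.
Proof.
have -> : 1 - cos x = 2 * sin (x / 2) ^+ 2.
  by rewrite {1}(_ : x = x / 2 *+ 2); [rewrite cos_mulr2n sin2cos2; ring|rewrite mulr2n; lra].
have := sin_lipschitz (x / 2) 0; rewrite sin0 !subr0 => h.
have : sin (x / 2) ^+ 2 <= (x / 2) ^+ 2.
  by rewrite -[leLHS]real_normK ?num_real// -[leRHS]real_normK ?num_real// lerXn2r ?nnegrE.
by nra.
Qed.

Lemma expN1E {R} (t : R) :
  expN 1 t = if 0 <= t then expR (- t) else expR t.
Proof.
rewrite /expN mul1r; case: ifPn => h; first by rewrite ger0_norm.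
by rewrite ltr0_norm ?opprK// ltNge.
Qed.

Lemma cube_expR_le {R} (c x : R) : 0 < c -> 0 <= x ->
  x ^+ 3 * expR (- (c * x)) <= 6 / c ^+ 3.
Proof.
move=> c0 x0; have cx0 : 0 <= c * x by apply: mulr_ge0 => //; exact: ltW.
have := expR_ge1Dxn 2 cx0; rewrite (_ : 3`!%:R = 6 :> R)// => h.
rewrite expRN ler_pdivrMr ?expR_gt0// mulrAC ler_pdivlMr ?exprn_gt0//.
rewrite -exprMn mulrC mulrC [x * c]mulrC.
have : (c * x) ^+ 3 / 6 <= expR (c * x) by lra.
by lra.
Qed.

(** One bound for [gk], its th-derivative and [kap]. For t >= 0 the bracket is at most 3. For t < 0
    one has E = e^(-t) >= 1 and the claim follows from 3 E^3 e^(-cE) <= 18 / c^3, the cubic term of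
    the exponential series. *)
Lemma gkernel_dom {R} (c t : R) : 0 < c ->
  expR (- t) * (1 + 2 * expR (- t)) * expR (- (c * expR (- t)))
    <= (3 + 18 / c ^+ 3) * expN 1 t.
Proof.
move=> c0; rewrite expN1E.
have c3 : 0 <= 18 / c ^+ 3 by apply: divr_ge0 => //; apply: exprn_ge0; exact: ltW.
have eE : expR (- (c * expR (- t))) <= 1.
  by rewrite expR_le1 oppr_le0; apply: mulr_ge0; [exact: ltW|exact: expR_ge0].
have e0 := expR_ge0 (- (c * expR (- t))).
case: ifPn => ht.
  have E1 : expR (- t) <= 1 by rewrite expR_le1 oppr_le0.
  have E0 := expR_gt0 (- t).
  by nra.
have E1 : 1 <= expR (- t) by rewrite -expR0 ler_expR oppr_ge0 ltW// ltNge.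
have h := cube_expR_le c0 (expR_ge0 (- t)).
rewrite -[in X in _ <= _ * X](opprK t) [in X in _ <= _ * X]expRN.
rewrite ler_pdivlMr ?expR_gt0//.
move: (expR (- t)) (expR (- (c * expR (- t)))) E1 h e0 eE => x e x1 h e0 e1.
have h3 : x * (1 + 2 * x) * e * x <= 3 * (x ^+ 3 * e).
  rewrite -subr_ge0 (_ : _ - _ = x ^+ 2 * e * (x - 1)); last by ring.
  by apply: mulr_ge0; [apply: mulr_ge0 => //; exact: sqr_ge0|lra].
apply: (le_trans h3).
rewrite (_ : 18 = 3 * 6 :> R); last by ring.
rewrite -mulrA in c3 *.
lra.
Qed.

(* [gX p b th] is the real part of [e^(ib)] times the integral of [e^(ipt) z E e^(-zE)],
   where [E = e^(-t)] and [z = e^(i th)]. *)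
Definition gk {R} (p b th t : R) : R :=
  expR (- t) * expR (- (cos th * expR (- t))) *
  cos (th + p * t - sin th * expR (- t) + b).

Definition gX {R} (p b th : R) : R := \int[mu]_t gk p b th t.

Definition dgk {R} (p b th t : R) : R :=
  expR (- t) * expR (- (cos th * expR (- t))) *
  (sin th * expR (- t) * cos (th + p * t - sin th * expR (- t) + b)
   - (1 - cos th * expR (- t)) * sin (th + p * t - sin th * expR (- t) + b)).

Lemma is_derive_gk {R} (p b th t : R) :
  is_derive th 1 (fun th => gk p b th t) (dgk p b th t).
Proof. by rewrite /gk; derv; rewrite /dgk; ring. Qed.

(** Cauchy-Riemann in t and th: the complex integrand is e^(ipt) times a function of e^(i th - t),
    on which the th-derivative is -i times the t-derivative. Up to p times [gk] the th-derivative is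
    therefore an exact t-derivative, which does the work of rotating a contour. *)
Lemma dgk_t {R} (p b th t : R) :
  is_derive t 1 (fun t => expR (- t) * expR (- (cos th * expR (- t))) *
     sin (th + p * t - sin th * expR (- t) + b))
   (dgk p b th t + p * gk p b th t).
Proof. by derv; rewrite /dgk /gk; ring. Qed.

Lemma gk_bd {R} (p b th t c : R) : 0 < c -> c <= cos th ->
  `|gk p b th t| <= (3 + 18 / c ^+ 3) * expN 1 t /\
  `|dgk p b th t| <= (3 + 18 / c ^+ 3) * expN 1 t.
Proof.
move=> c0 cth; have h := gkernel_dom t c0.
have E0 := expR_ge0 (- t).
have Ee : expR (- (cos th * expR (- t))) <= expR (- (c * expR (- t))).
  by rewrite ler_expR lerN2 ler_wpM2r.
have e0 := expR_ge0 (- (cos th * expR (- t))).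
split.
  rewrite (le_trans _ h)// /gk !normrM !(ger0_norm (expR_ge0 _)).
  apply: (@le_trans _ _ (expR (- t) * expR (- (cos th * expR (- t))))).
    by rewrite ler_piMr ?cos_max// mulr_ge0.
  rewrite -mulrA ler_wpM2l// (le_trans Ee)// ler_peMl ?expR_ge0//.
  by lra.
rewrite (le_trans _ h)// /dgk !normrM !(ger0_norm (expR_ge0 _)).
rewrite -[leRHS]mulrA [_ * expR (- (c * _))]mulrC mulrA.
apply: ler_pM; [by rewrite mulr_ge0|exact: normr_ge0|by rewrite ler_wpM2l|].
rewrite (le_trans (ler_normB _ _))//.
have : `|sin th * expR (- t) * cos (th + p * t - sin th * expR (- t) + b)| <= expR (- t).
  rewrite !normrM (ger0_norm E0).
  rewrite -[leRHS]mulr1 ler_pM ?mulr_ge0 ?cos_max//.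
  by rewrite ler_piMl ?sin_max.
have : `|(1 - cos th * expR (- t)) * sin (th + p * t - sin th * expR (- t) + b)| <= 1 + expR (- t).
  rewrite normrM -[leRHS]mulr1 ler_pM ?sin_max//.
  rewrite (le_trans (ler_normB _ _))// normr1 lerD2l normrM (ger0_norm E0).
  by rewrite ler_piMl ?cos_max.
by lra.
Qed.

Lemma measurable_gk {R} (p b th : R) : measurable_fun setT (gk p b th).
Proof. by rewrite /gk; meas. Qed.

Lemma gk_intble {R} (p b th : R) : 0 < cos th -> intble (gk p b th).
Proof.
move=> c0; apply: intble_dom (measurable_gk p b th) _ (fun t => (gk_bd p b t c0 (lexx _)).1).
exact: intble_expN.
Qed.

Lemma dgk_intble {R} (p b th : R) : 0 < cos th -> intble (dgk p b th).
Proof.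
move=> c0; apply: (@intble_dom _ _ (fun t => (3 + 18 / cos th ^+ 3) * expN 1 t)).
- by rewrite /dgk; meas.
- exact: intble_expN.
- by move=> t; exact: (gk_bd p b t c0 (lexx _)).2.
Qed.

Lemma expN_cvg {R} (a : R) : 0 < a ->
  expN a n%:R @[n --> \oo] --> 0 /\ expN a (- n%:R) @[n --> \oo] --> 0.
Proof.
move=> a0.
have h : expN a n%:R @[n --> \oo] --> 0.
  have := cvg_comp _ _ (@cvgr_idn R) (cvgr_expRM a0).
  apply: cvg_trans; apply: near_eq_cvg; apply: nearW => n /=.
  by rewrite /expN ger0_norm.
split => //; rewrite (_ : (fun n : nat => expN a (- n%:R)) = (fun n => expN a n%:R))//.
by apply/funext => n; rewrite /expN normrN.
Qed.

Lemma cvg_expdom {R} (K a : R) (F : R -> R) : 0 < a ->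
  (forall t, `|F t| <= K * expN a t) ->
  F n%:R @[n --> \oo] --> 0 /\ F (- n%:R) @[n --> \oo] --> 0.
Proof.
move=> a0 h; have [c1 c2] := expN_cvg a0.
split; apply/norm_cvg0P.
  apply: (@squeeze_cvgr _ _ _ _ (fun _ => 0) (fun n => K * expN a n%:R)).
  - by apply: nearW => n; rewrite normr_ge0/= h.
  - exact: cvg_cst.
  - by rewrite -(mulr0 K); exact: cvgMl_tmp.
apply: (@squeeze_cvgr _ _ _ _ (fun _ => 0) (fun n => K * expN a (- n%:R))).
- by apply: nearW => n; rewrite normr_ge0/= h.
- exact: cvg_cst.
- by rewrite -(mulr0 K); exact: cvgMl_tmp.
Qed.

Lemma Int_dgk {R} (p b th : R) : 0 < cos th ->
  \int[mu]_t dgk p b th t = - p * gX p b th.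
Proof.
move=> c0; have i1 := gk_intble p b c0; have i2 := dgk_intble p b c0.
have i3 : intble (fun t => dgk p b th t + p * gk p b th t).
  by apply: intbleD; [exact: i2|exact: (intbleZ _ i1)].
pose F t := expR (- t) * expR (- (cos th * expR (- t))) *
     sin (th + p * t - sin th * expR (- t) + b).
have Fbd t : `|F t| <= (3 + 18 / cos th ^+ 3) * expN 1 t.
  (* The sine is the cosine with offset b - pi/2, so the bound on [gk] applies to the boundary
     term. *)
  have -> : F t = gk p (b - pi / 2) th t.
    by rewrite /gk addrA cosBpihalf.
  exact: (gk_bd p _ t c0 (lexx _)).1.
have [F1 F2] := cvg_expdom ltr01 Fbd.
have := line_FTC (dgk_t p b th) _ i3 F1 F2.
rewrite subrr IntD; [|exact: i2|exact: (intbleZ _ i1)].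
rewrite (IntZ p i1) -/(gX p b th) => h.
have : continuous (fun t => dgk p b th t + p * gk p b th t).
  by rewrite /dgk /gk; cont.
by move=> /h; lra.
Qed.

Lemma is_derive_gX {R} (p b th : R) : 0 < cos th ->
  is_derive th 1 (gX p b) (- p * gX p b th).
Proof.
move=> c0; rewrite -Int_dgk//.
have c20 : 0 < cos th / 2 by rewrite divr_gt0.
(* Near th the cosine stays above cos th / 2, which provides one dominating function for all angles
   of the neighbourhood. *)
have := @continuous_cos R th => /cvgrPdist_le/(_ _ c20) /nbhs_ballP[d /= d0 hd].
have cx x : (`]th - d, th + d[%classic : set R) x -> cos th / 2 <= cos x.
  rewrite /= in_itv/= => /andP[x1 x2].
  have : `|cos th - cos x| <= cos th / 2.
    by apply: hd; rewrite /ball/= ltr_distl; apply/andP; split; lra.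
  by rewrite ler_norml => /andP[_]; lra.
have Ith : (`]th - d, th + d[%classic : set R) th.
  by rewrite /= in_itv/=; apply/andP; split; lra.
have intf x : (`]th - d, th + d[%classic : set R) x -> mu.-integrable setT (EFin \o gk p b x).
  by move=> /cx h; apply: gk_intble; exact: lt_le_trans h.
have derf x (y : R) : (`]th - d, th + d[%classic : set R) x -> setT y ->
    derivable (fun th => gk p b th y) x 1.
  by move=> _ _; have [] := is_derive_gk p b x y.
pose G (y : R) := (3 + 18 / (cos th / 2) ^+ 3) * expN 1 y.
have G0 y : 0 <= G y.
  by rewrite (le_trans _ (gk_bd p b y c20 (cx _ Ith)).1).
have iG : mu.-integrable setT (EFin \o G) by exact: intble_expN.
have Gub x (y : R) : (`]th - d, th + d[%classic : set R) x -> setT y ->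
    `|derive1 (fun th => gk p b th y) x| <= G y.
  move=> /cx h _; rewrite derive1E; have [_ ->] := is_derive_gk p b x y.
  exact: (gk_bd p b y c20 h).2.
have h1 := @derivable_under_integral R _ _ mu (gk p b) setT measurableT th (th - d) (th + d)
  Ith intf derf G G0 iG Gub.
have h2 := @differentiation_under_integral R _ _ mu (gk p b) setT measurableT th (th - d) (th + d)
  Ith intf derf G G0 iG Gub.
apply: DeriveDef; first exact: h1.
rewrite -derive1E [LHS]h2; apply: eq_Int => t.
by rewrite partial1of2E; have [_ ->] := is_derive_gk p b th t.
Qed.

(** By the differential equation [is_derive_gX] the product has derivative 0. The equation is
    available for |th| < pi/2, so the angle pi/2 has to be reached as a limit. *)
Lemma gX_scale {R} (p b th1 th2 : R) : - (pi / 2) < th1 -> th1 < th2 ->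
  th2 < pi / 2 -> expR (p * th1) * gX p b th1 = expR (p * th2) * gX p b th2.
Proof.
move=> h1 h12 h2.
have c0 (x : R) : x \in `[th1, th2] -> 0 < cos x.
  rewrite in_itv/= => /andP[x1 x2]; apply: cos_gt0_pihalf.
  by rewrite (lt_le_trans h1 x1) (le_lt_trans x2 h2).
pose F x := expR (p * x) * gX p b x.
have dF (x : R) : x \in `[th1, th2] -> is_derive x 1 F 0.
  move=> /c0 cx; have h : has_deriv x (gX p b) _ := is_derive_gX p b cx.
  by rewrite /F; derv; ring.
have dF' (x : R) : x \in `]th1, th2[ -> is_derive x 1 F 0.
  by move=> xi; apply: dF; exact: subset_itv_oo_cc xi.
have cF : {within `[th1, th2], continuous F}.
  by apply: derivable_within_continuous => x xi; have [] := dF x xi.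
have [c _] := @MVT _ F (fun _ => 0) _ _ h12 dF' cF.
by rewrite mul0r => /eqP; rewrite subr_eq0 => /eqP.
Qed.

Definition kap {R} (c t : R) : R :=
  expR (- t) * expR (- (c * expR (- t))).

Lemma kap_ge0 {R} (c t : R) : 0 <= kap c t.
Proof. by apply: mulr_ge0; exact: expR_ge0. Qed.

Lemma kap_bd {R} (c t : R) : 0 < c -> kap c t <= (3 + 18 / c ^+ 3) * expN 1 t.
Proof.
move=> c0; rewrite (le_trans _ (gkernel_dom t c0))// /kap -mulrA ler_wpM2l ?expR_ge0//.
by rewrite ler_peMl ?expR_ge0//; have := expR_ge0 (- t); lra.
Qed.

(** Half of the decay in t and t + s is traded for decay in s, which makes the bound separated. *)
Lemma expN_split {R} (t s : R) :
  expN 1 t * expN 1 (t + s) <= expN 2^-1 t * expN 2^-1 s.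
Proof.
rewrite /expN -!expRD ler_expR !mul1r.
have h1 : `|s| <= `|t + s| + `|t|.
  by rewrite -{1}(addKr t s) addrC (le_trans (ler_normB _ _)).
have h2 := normr_ge0 (t + s); have h3 := normr_ge0 t.
lra.
Qed.

Lemma kap_intble {R} (c : R) : 0 < c -> intble (kap c).
Proof.
move=> c0; apply: (@intble_dom _ _ (fun t => (3 + 18 / c ^+ 3) * expN 1 t)).
- by rewrite /kap; meas.
- exact: intble_expN.
- by move=> t; rewrite ger0_norm ?kap_ge0// kap_bd.
Qed.

(** With offsets 0 and -pi/2 the two integrals are the real and imaginary parts of one complex
    integral. In the double integral for its squared modulus only the phase difference survives, and
    passing to the lag s leaves an inner t-integral of gamma type. *)
Lemma gX_energy {R} (p th : R) : 0 < cos th ->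
  [/\ intble (fun s => \int[mu]_t (kap (cos th) t * kap (cos th) (t + s) *
      cos (p * s - sin th * (expR (- s) - 1) * expR (- t)))),
    (forall s, intble (fun t => kap (cos th) t * kap (cos th) (t + s) *
      cos (p * s - sin th * (expR (- s) - 1) * expR (- t)))) &
  gX p 0 th ^+ 2 + gX p (- (pi / 2)) th ^+ 2 =
  \int[mu]_s \int[mu]_t (kap (cos th) t * kap (cos th) (t + s) *
      cos (p * s - sin th * (expR (- s) - 1) * expR (- t)))].
Proof.
move=> c0; set c := cos th; set S := sin th.
pose K := 3 + 18 / c ^+ 3.
have K0 : 0 <= K by rewrite addr_ge0// divr_ge0// exprn_ge0// ltW.
have mk : measurable_fun setT (kap c) by rewrite /kap; meas.
have ik := kap_intble c0.
pose al t := th + p * t - S * expR (- t).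
have Ec t : gk p 0 th t = kap c t * cos (al t) by rewrite /gk addr0.
have Es t : gk p (- (pi / 2)) th t = kap c t * sin (al t) by rewrite /gk cosBpihalf.
have i0 := gk_intble p 0 c0; have i1 := gk_intble p (- (pi / 2)) c0.
pose f t s := kap c t * kap c (t + s) * cos (p * s - S * (expR (- s) - 1) * expR (- t)).
have mf : measurable_fun (plane R) (fun z => f z.1 z.2).
  have ? := mfun_fst mk.
  have ? : measurable_fun (plane R)
      (fun z => kap c (z.1 + z.2)) by apply: (mfun_comp mk); meas.
  by rewrite /f; meas.
have fd t s : `|f t s| <= K ^+ 2 * expN 2^-1 t * expN 2^-1 s.
  rewrite /f 2!normrM (ger0_norm (kap_ge0 _ _)) (ger0_norm (kap_ge0 _ _)).
  rewrite (le_trans (ler_piMr (mulr_ge0 (kap_ge0 _ _) (kap_ge0 _ _)) (cos_max _)))//.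
  rewrite (le_trans (ler_pM (kap_ge0 _ _) (kap_ge0 _ _) (kap_bd _ c0) (kap_bd _ c0)))//.
  rewrite mulrACA -expr2 -[leRHS]mulrA ler_wpM2l ?sqr_ge0//.
  exact: expN_split.
have h2 : (0 : R) < 2^-1 by rewrite invr_gt0.
have [_ j2 _ j4 E] := Int_Fubini mf (intbleZ (K ^+ 2) (expN_intble h2).1)
  (expN_intble h2).1 fd.
split; [exact: j4|exact: j2|].
rewrite -E.
transitivity (\int[mu]_t (gX p 0 th * gk p 0 th t + gX p (- (pi / 2)) th * gk p (- (pi / 2)) th t)).
  rewrite IntD; [|exact: (intbleZ _ i0)|exact: (intbleZ _ i1)].
  by rewrite (IntZ _ i0) (IntZ _ i1) !expr2.
apply: eq_Int => t.
transitivity (\int[mu]_s (kap c t * (kap c s * cos (al s - al t)))).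
  rewrite Ec Es.
  transitivity (\int[mu]_s (kap c t * cos (al t) * gk p 0 th s +
      kap c t * sin (al t) * gk p (- (pi / 2)) th s)).
    rewrite IntD; [|exact: (intbleZ _ i0)|exact: (intbleZ _ i1)].
    by rewrite (IntZ _ i0) (IntZ _ i1) -/(gX p 0 th) -/(gX p (- (pi / 2)) th); ring.
  by apply: eq_Int => s; rewrite Ec Es cosB; ring.
have iF : intble (fun s => kap c t * (kap c s * cos (al s - al t))).
  apply: intbleZ; apply: (@intble_bdM _ 1); [by rewrite /al; meas| |exact: ik].
  by move=> x; exact: cos_max.
rewrite -(Int_shift t iF).2; apply: eq_Int => s; rewrite /f.
rewrite -mulrA [s + t]addrC; congr (_ * (_ * cos _)).
by rewrite /al opprD expRD; ring.
Qed.

(** With x = e^(-t) this is the integral of x e^(-Ax) sin(Bx) over x > 0, the imaginary part of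
    Gamma(2) / (A - iB)^2. *)
Lemma Int_gamma2_sin {R} (A B : R) : 0 < A ->
  intble (fun t => expR (- t) ^+ 2 * expR (- (A * expR (- t))) * sin (B * expR (- t))) /\
  \int[mu]_t (expR (- t) ^+ 2 * expR (- (A * expR (- t))) * sin (B * expR (- t))) =
    2 * A * B / (A ^+ 2 + B ^+ 2) ^+ 2.
Proof.
move=> A0.
have D0 := poisson_den B A0.
(* [Phi] is minus an antiderivative of x e^(-Ax) sin(Bx); t = +oo corresponds to x = 0, where its
   value is the answer. *)
pose Phi x := expR (- (A * x)) * (x * (A * sin (B * x) + B * cos (B * x)) / (A ^+ 2 + B ^+ 2)
  + ((A ^+ 2 - B ^+ 2) * sin (B * x) + 2 * A * B * cos (B * x)) / (A ^+ 2 + B ^+ 2) ^+ 2).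
pose f t := expR (- t) ^+ 2 * expR (- (A * expR (- t))) * sin (B * expR (- t)).
have dF (t : R) : is_derive t 1 (fun t => Phi (expR (- t))) (f t).
  rewrite /Phi; derv; rewrite /f; field.
  by rewrite gt_eqF.
have iF : intble f.
  apply: (@intble_dom _ _ (fun t => (3 + 18 / A ^+ 3) * expN 1 t)).
  - by rewrite /f; meas.
  - exact: intble_expN.
  - move=> t; rewrite (le_trans _ (gkernel_dom t A0))// /f normrM normrM.
    rewrite (ger0_norm (expR_ge0 _)) (ger0_norm (sqr_ge0 _)).
    have E0 := expR_ge0 (- t); have e0 := expR_ge0 (- (A * expR (- t))).
    rewrite (le_trans (ler_piMr _ (sin_max _)))//.
    by rewrite ler_wpM2r// expr2 ler_wpM2l//; lra.
split => //.
have cPhi : continuous Phi by rewrite /Phi; cont.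
have c1 : Phi (expR (- n%:R)) @[n --> \oo] --> 2 * A * B / (A ^+ 2 + B ^+ 2) ^+ 2.
  rewrite (_ : 2 * A * B / (A ^+ 2 + B ^+ 2) ^+ 2 = Phi 0); last first.
    by rewrite /Phi !mulr0 oppr0 expR0 sin0 cos0 mul0r !mulr0 !add0r mul1r mulr1 mul0r add0r.
  have h : expR (- n%:R : R) @[n --> \oo] --> (0 : R) by exact: cvgn_expR.
  exact: (cvg_comp _ _ h (cPhi 0)).
have c2 : Phi (expR (- (- n%:R))) @[n --> \oo] --> 0.
  pose K := (A + `|B|) / (A ^+ 2 + B ^+ 2) +
    (`|A ^+ 2 - B ^+ 2| + `|2 * A * B|) / (A ^+ 2 + B ^+ 2) ^+ 2.
  have a1 : 0 <= (A + `|B|) / (A ^+ 2 + B ^+ 2).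
    by apply: divr_ge0; [apply: addr_ge0 => //; exact: ltW|exact: ltW].
  have a2 : 0 <= (`|A ^+ 2 - B ^+ 2| + `|2 * A * B|) / (A ^+ 2 + B ^+ 2) ^+ 2.
    by apply: divr_ge0; [apply: addr_ge0|exact: sqr_ge0].
  have K0 : 0 <= K by exact: addr_ge0.
  have bd (n : nat) : `|Phi (expR (- (- n%:R)))| <= K * ((3 + 18 / A ^+ 3) * expN 1 (- n%:R)).
    rewrite (le_trans _ (ler_wpM2l K0 (gkernel_dom _ A0)))//.
    have x1 : 1 <= expR (- - n%:R) :> R by rewrite opprK -expR0 ler_expR.
    move: (expR (- - n%:R)) x1 => x x1.
    rewrite /Phi normrM (ger0_norm (expR_ge0 _)) mulrC mulrA ler_wpM2r ?expR_ge0//.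
    have b1 : `|x * (A * sin (B * x) + B * cos (B * x)) / (A ^+ 2 + B ^+ 2)| <=
       (A + `|B|) / (A ^+ 2 + B ^+ 2) * x.
      have hM : `|A * sin (B * x) + B * cos (B * x)| <= A + `|B|.
        rewrite (le_trans (ler_normD _ _))// !normrM (gtr0_norm A0).
        by rewrite lerD// ler_piMr ?sin_max ?cos_max// ltW.
      rewrite normrM normrM normfV (gtr0_norm D0) (ger0_norm (le_trans ler01 x1)).
      rewrite [leRHS](_ : _ = x * (A + `|B|) / (A ^+ 2 + B ^+ 2)); last by ring.
      apply: ler_wpM2r; first by rewrite invr_ge0 ltW.
      by apply: ler_wpM2l => //; exact: le_trans x1.
    have b2 : `|((A ^+ 2 - B ^+ 2) * sin (B * x) + 2 * A * B * cos (B * x)) / (A ^+ 2 + B ^+ 2) ^+ 2|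
       <= (`|A ^+ 2 - B ^+ 2| + `|2 * A * B|) / (A ^+ 2 + B ^+ 2) ^+ 2.
      rewrite normrM normfV (gtr0_norm (exprn_gt0 2 D0)) ler_wpM2r ?invr_ge0 ?exprn_ge0 ?(ltW D0)//.
      by rewrite (le_trans (ler_normD _ _))// [in X in X + _]normrM [in X in _ + X]normrM lerD// ler_piMr ?sin_max ?cos_max.
    rewrite (le_trans (ler_normD _ _))// (le_trans (lerD b1 b2))//.
    rewrite /K [leRHS]mulrDl; apply: lerD.
      by rewrite ler_wpM2l// ler_peMr; lra.
    by rewrite ler_peMr//; nra.
  apply/norm_cvg0P.
  apply: (@squeeze_cvgr _ _ _ _ (fun _ => 0)
    (fun n => K * ((3 + 18 / A ^+ 3) * expN 1 (- n%:R)))).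
  - by apply: nearW => n; rewrite normr_ge0/= bd.
  - exact: cvg_cst.
  - rewrite -(mulr0 K); apply: cvgMl_tmp; rewrite -(mulr0 (3 + 18 / A ^+ 3)).
    by apply: cvgMl_tmp; exact: (expN_cvg ltr01).2.
have cf : continuous f by rewrite /f; cont.
by rewrite (line_FTC dF cf iF c1 c2) subr0.
Qed.

(** 1 / (2 (cosh s - cos eta)), not the hyperbolic cosecant. At eta = 0 it degenerates to 1 / (4
    sinh(s/2)^2), and this double pole at s = 0 is why the family concentrates there. *)
Definition csch {R} (eta s : R) : R :=
  (expR s + expR (- s) - 2 * cos eta)^-1.

Lemma expR_cosh_ge {R} (s : R) : (expN 1 s)^-1 <= expR s + expR (- s).
Proof.
rewrite expN1E; case: ifPn => _; rewrite -expRN ?opprK.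
  by rewrite lerDl expR_ge0.
by rewrite lerDr expR_ge0.
Qed.

Lemma expR_cosh_ge2 {R} (s : R) : s ^+ 2 / 4 <= expR s + expR (- s) - 2.
Proof.
have -> : expR s + expR (- s) - 2 = (expR (s / 2) - expR (- (s / 2))) ^+ 2.
  have e1 : expR s = expR (s / 2) ^+ 2 by rewrite -expRM_natl; congr expR; field.
  have e2 : expR (- s) = expR (- (s / 2)) ^+ 2 by rewrite -expRM_natl; congr expR; field.
  have e3 := expRxMexpNx_1 (s / 2).
  by rewrite sqrrB e1 e2 e3; ring.
rewrite (_ : s ^+ 2 / 4 = (s / 2) ^+ 2); last by field.
rewrite -[leLHS]real_normK ?num_real// -[leRHS]real_normK ?num_real// lerXn2r ?nnegrE//.
move: (s / 2) => x.
wlog x0 : x / 0 <= x.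
  move=> H; have [h|h] := leP 0 x; first exact: H.
  have := H (- x); rewrite opprK normrN distrC; apply; lra.
have h1 := expR_ge1Dx x.
have h2 : expR (- x) <= 1 by rewrite expR_le1 oppr_le0.
rewrite ger0_norm// ger0_norm; lra.
Qed.

Lemma csch_den {R} (eta s : R) : 0 < eta < pi ->
  0 < expR s + expR (- s) - 2 * cos eta.
Proof.
move=> /andP[e0 ep].
have h := expR_cosh_ge2 s; have h2 := sqr_ge0 s.
have : cos eta < 1.
  rewrite -cos0 ltr_cos// in_itv/= ?lexx ?pi_ge0//.
  by rewrite !ltW.
lra.
Qed.

Lemma csch_bd {R} (eta s : R) : 0 < eta < pi ->
  0 <= csch eta s <= (1 - `|cos eta|)^-1 * expN 1 s.
Proof.
move=> e0p; have d0 := csch_den s e0p.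
have /andP[e0 ep] := e0p.
have c1 : 0 < 1 - `|cos eta|.
  rewrite subr_gt0 lt_neqAle cos_max andbT norm_cos_eq1.
  by rewrite gt_eqF// sin_gt0_pi// e0.
rewrite /csch invr_ge0 ltW//= -[expN 1 s]invrK -invfM lef_pV2 ?posrE//; last first.
  by rewrite mulr_gt0// invr_gt0 /expN expR_gt0.
have h := expR_cosh_ge s.
have h2 := expR_cosh_ge2 s; have h3 := sqr_ge0 s.
have h4 := ler_norm (cos eta).
have h5 : (expN 1 s)^-1 * (1 - `|cos eta|) <= (expR s + expR (- s)) * (1 - `|cos eta|).
  by rewrite ler_wpM2r// ltW.
rewrite mulrC; apply: (le_trans h5).
move: (expR s + expR (- s)) h2 h4 => x h2 h4.
have h6 := normr_ge0 (cos eta).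
nra.
Qed.

Lemma measurable_csch {R} (eta : R) : measurable_fun setT (csch eta).
Proof. by rewrite /csch; meas. Qed.

Lemma csch_intble {R} (eta : R) : 0 < eta < pi -> intble (csch eta).
Proof.
move=> e0p; apply: intble_dom (measurable_csch eta) (intbleZ (1 - `|cos eta|)^-1 (expN_intble ltr01).1) _.
by move=> s; have /andP[h1 h2] := csch_bd s e0p; rewrite ger0_norm.
Qed.

(** The right-hand side is 2 (pi - eta), so the mass tends to 2 pi as eta -> 0. The antiderivative
    comes from x = e^s, which turns the denominator into ((x - cos eta)^2 + sin(eta)^2) / x. *)
Lemma Int_csch {R} (eta : R) : 0 < eta < pi ->
  2 * sin eta * \int[mu]_s csch eta s = pi + 2 * atan (cos eta / sin eta).
Proof.
move=> e0p; have s0 : 0 < sin eta by exact: sin_gt0_pi.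
have i := csch_intble e0p.
pose F s := 2 * atan ((expR s - cos eta) / sin eta).
have dF (s : R) : is_derive s 1 F (2 * sin eta * csch eta s).
  have d0 := csch_den s e0p.
  rewrite /F; derv; rewrite /csch expRN.
  have h := sin2cos2 eta.
  have x0 := expR_gt0 s.
  rewrite expRN in d0; move: (expR s) x0 d0 => x x0 d0.
  have hk : sin eta ^+ 2 + (x - cos eta) ^+ 2 = x * (x + x^-1 - 2 * cos eta).
    by rewrite h; field; rewrite gt_eqF.
  have -> : 1 + ((x - cos eta) / sin eta) ^+ 2 = x * (x + x^-1 - 2 * cos eta) / sin eta ^+ 2.
    by rewrite -hk; field; rewrite gt_eqF.
  move: (x + x^-1 - 2 * cos eta) d0 => d d0.
  by field; rewrite !gt_eqF.
have c1 : F n%:R @[n --> \oo] --> pi.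
  rewrite (_ : pi = 2 * (pi / 2)); last by move: pi => q; field.
  apply: cvgMl_tmp.
  have h : (expR (n%:R : R) - cos eta) / sin eta @[n --> \oo] --> +oo.
    apply/cvgryPge => A; near=> n.
    rewrite ler_pdivlMr// lerBrDr (le_trans _ (expR_ge1Dx _))//.
    rewrite (@le_trans _ _ n%:R)//; last by rewrite lerDr.
    by near: n; exact: nbhs_infty_ger.
  exact: (cvg_comp _ _ h (@cvgy_atan R)).
have c2 : F (- n%:R) @[n --> \oo] --> - (2 * atan (cos eta / sin eta)).
  rewrite -mulrN -atanN; apply: cvgMl_tmp.
  have h : (expR (- n%:R : R) - cos eta) / sin eta @[n --> \oo] --> (0 - cos eta) / sin eta.
    by apply: cvgMr_tmp; apply: cvgB; [exact: cvgn_expR|exact: cvg_cst].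
  rewrite sub0r mulNr in h.
  exact: (cvg_comp _ _ h (@continuous_atan R _)).
have cf : continuous (fun s => 2 * sin eta * csch eta s).
  by rewrite /csch; cont => s; rewrite gt_eqF// csch_den.
by rewrite -IntZ// (line_FTC dF cf (intbleZ _ i) c1 c2) opprK.
Unshelve. all: by end_near. Qed.

(** The bound is uniform in eta. For |s| <= 2 the quadratic zero of 1 - cos(ps) compensates the
    near-singularity, and e^2 only converts a constant into a multiple of [expN 1]; for |s| > 2 one
    has e^|s| >= 4, which absorbs 2 cos(eta). *)
Lemma cos_csch_bd {R} (p eta s : R) : 0 < eta < pi ->
  0 <= (1 - cos (p * s)) * csch eta s <= (4 + 2 * p ^+ 2 * expR 2) * expN 1 s.
Proof.
move=> e0p; have d0 := csch_den s e0p.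
have /andP[v0 _] := csch_bd s e0p.
have u0 : 0 <= 1 - cos (p * s) by rewrite subr_ge0 cos_le1.
apply/andP; split; first exact: mulr_ge0.
have N0 : 0 < expN 1 s by exact: expR_gt0.
rewrite /csch ler_pdivrMr//.
have C1 := cos_le1 eta.
have h2 := expR_cosh_ge2 s.
have p20 := sqr_ge0 p.
have E20 := expR_ge0 (2 : R).
have [s2|s2] := leP `|s| 2.
  have h : 1 <= expR 2 * expN 1 s.
    by rewrite /expN mul1r -expRD -[leLHS](expR0 R) ler_expR; lra.
  have h3 : 1 - cos (p * s) <= 2 * p ^+ 2 * (expR s + expR (- s) - 2 * cos eta).
    apply: (le_trans (one_sub_cos_le _)); rewrite exprMn.
    apply: (@le_trans _ _ (2 * p ^+ 2 * (s ^+ 2 / 4))); first by lra.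
    by apply: ler_wpM2l; [lra|lra].
  apply: (le_trans h3); apply: ler_wpM2r; first exact: ltW.
  apply: (@le_trans _ _ (2 * p ^+ 2 * (expR 2 * expN 1 s))); last by nra.
  by rewrite ler_peMr//; lra.
have h : 4 <= (expN 1 s)^-1.
  rewrite /expN -expRN opprK mul1r.
  have e1 : 2 <= expR (1 : R) by have := expR_ge1Dx (1 : R); lra.
  apply: (@le_trans _ _ (expR 2)); last by rewrite ler_expR ltW.
  have -> : expR 2 = expR (1 : R) ^+ 2 by rewrite -expRM_natl mulr1.
  by nra.
have h3 := expR_cosh_ge s.
have h4 : (expN 1 s)^-1 / 2 <= expR s + expR (- s) - 2 * cos eta by lra.
have h5 : 1 - cos (p * s) <= 2 by have := cos_geN1 (p * s); lra.
apply: (le_trans h5).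
apply: (@le_trans _ _ ((4 + 2 * p ^+ 2 * expR 2) * expN 1 s * ((expN 1 s)^-1 / 2))).
  rewrite [leRHS](_ : _ = (4 + 2 * p ^+ 2 * expR 2) / 2); last by field; rewrite gt_eqF.
  have : 0 <= p ^+ 2 * expR 2 by apply: mulr_ge0.
  by lra.
apply: ler_wpM2l => //; apply: mulr_ge0; last exact: ltW.
have : 0 <= p ^+ 2 * expR 2 by apply: mulr_ge0.
by lra.
Qed.

Lemma harmonic_0pi {R} (n : nat) : 0 < (n.+1%:R^-1 : R) < pi.
Proof.
rewrite invr_gt0 ltr0n/= (@le_lt_trans _ _ 1)//.
  by rewrite invf_le1 ?ler1n ?ltr0n.
by have := @pi_ge2 R; lra.
Qed.

(** The part with 1 - cos(ps) has a bounded integral against [csch], so the factor sin(eta) kills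
    it; the mass 2 (pi - eta) is left. The limit is thus 2 pi cos(0), for every p. *)
Lemma Int_cos_csch_lim {R} (p : R) :
  2 * sin (n.+1%:R^-1) * \int[mu]_s (cos (p * s) * csch (n.+1%:R^-1) s) @[n --> \oo]
   --> 2 * pi.
Proof.
pose e (n : nat) : R := n.+1%:R^-1.
have e0p n : 0 < e n < pi by exact: harmonic_0pi.
have e0 n : 0 < e n by have /andP[] := e0p n.
have s0 n : 0 < sin (e n) by exact: sin_gt0_pi.
have ce : e n @[n --> \oo] --> 0 by exact: cvg_harmonic.
have cs : sin (e n) @[n --> \oo] --> 0.
  by rewrite -(sin0 R); exact: (cvg_comp _ _ ce (@continuous_sin R 0)).
pose K := 4 + 2 * p ^+ 2 * expR 2.
have mcos : measurable_fun setT (fun s : R => 1 - cos (p * s)) by meas.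
have i1 n : intble (fun s => csch (e n) s * (1 - cos (p * s))).
  apply: (@intble_bdM _ 2); [exact: mcos| |exact: (csch_intble (e0p n))].
  by move=> s; rewrite (le_trans (ler_normB _ _))// normr1; have := cos_max (p * s); lra.
have bd n : 0 <= \int[mu]_s (csch (e n) s * (1 - cos (p * s))) <= K * 2.
  apply/andP; split.
    apply: Rintegral_ge0 => s _; rewrite mulrC.
    by have /andP[] := cos_csch_bd p s (e0p n).
  have [iN EN] := expN_intble (@ltr01 R).
  rewrite (_ : K * 2 = \int[mu]_s (K * expN 1 s)); last by rewrite IntZ// EN divr1.
  apply: le_Int; [exact: i1|exact: intbleZ|].
  by move=> s; rewrite mulrC; have /andP[] := cos_csch_bd p s (e0p n).
have E n : 2 * sin (e n) * \int[mu]_s (cos (p * s) * csch (e n) s) =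
   pi + 2 * atan (cos (e n) / sin (e n)) -
   2 * (sin (e n) * \int[mu]_s (csch (e n) s * (1 - cos (p * s)))).
  rewrite -(Int_csch (e0p n)) mulrA -mulrBr; congr (_ * _).
  rewrite -(IntB (csch_intble (e0p n)) (i1 n)); apply: eq_Int => s; ring.
have c1 : 2 * (sin (e n) * \int[mu]_s (csch (e n) s * (1 - cos (p * s)))) @[n --> \oo] --> (2 * 0 : R).
  apply: cvgMl_tmp.
  apply: (@squeeze_cvgr _ _ _ _ (fun _ => 0) (fun n => sin (e n) * (K * 2))).
  - apply: nearW => n; have /andP[b0 b1] := bd n.
    by rewrite mulr_ge0 ?(ltW (s0 n))//= ler_wpM2l// ltW.
  - exact: cvg_cst.
  - by rewrite -(mul0r (K * 2)); exact: cvgMr_tmp.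
have c2 : cos (e n) / sin (e n) @[n --> \oo] --> +oo.
  apply/cvgryPge => A; near=> n.
  have h1 : e n <= 1 by rewrite invf_le1 ?ler1n ?ltr0n.
  have h2 := one_sub_cos_le (e n).
  have h3 := sin_lipschitz (e n) 0.
  rewrite sin0 !subr0 (gtr0_norm (s0 n)) (gtr0_norm (e0 n)) in h3.
  have h4 : 2^-1 <= cos (e n).
    have : e n ^+ 2 <= 1 by rewrite expr_le1// ltW.
    by lra.
  rewrite ler_pdivlMr//; apply: le_trans h4.
  have h5 : (Num.max A 0) * sin (e n) <= Num.max A 0 * e n.
    by apply: ler_wpM2l => //; rewrite le_max lexx orbT.
  apply: (@le_trans _ _ (Num.max A 0 * sin (e n))).
    by rewrite ler_wpM2r ?(ltW (s0 n))// le_max lexx.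
  apply: (le_trans h5).
  rewrite /e ler_pdivrMr ?ltr0n//.
  have h6 : 2 * Num.max A 0 <= n%:R by near: n; exact: nbhs_infty_ger.
  have h7 : n.+1%:R = n%:R + 1 :> R by rewrite natr1.
  by rewrite h7; lra.
rewrite (_ : 2 * pi = pi + 2 * (pi / 2) - 2 * 0); last by move: pi => q; field.
rewrite (_ : (fun n => _) = (fun n => pi + 2 * atan (cos (e n) / sin (e n)) -
   2 * (sin (e n) * \int[mu]_s (csch (e n) s * (1 - cos (p * s)))))); last exact/funext.
apply: cvgB c1; apply: cvgD; first exact: cvg_cst.
by apply: cvgMl_tmp; exact: (cvg_comp _ _ c2 (@cvgy_atan R)).
Unshelve. all: by end_near. Qed.

Lemma energy_algebra {R} (c S x : R) : 0 < x -> c ^+ 2 + S ^+ 2 = 1 ->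
  0 < x + x^-1 - 2 * (S ^+ 2 - c ^+ 2) ->
  - 2 * x^-1 * (2 * (c * (1 + x^-1)) * (S * (x^-1 - 1)) /
     ((c * (1 + x^-1)) ^+ 2 + (S * (x^-1 - 1)) ^+ 2) ^+ 2) =
  2 * (2 * c * S) * (x - x^-1) / (x + x^-1 - 2 * (S ^+ 2 - c ^+ 2)) ^+ 2.
Proof.
move=> x0 cS d0.
have -> : (c * (1 + x^-1)) ^+ 2 + (S * (x^-1 - 1)) ^+ 2 =
   (x + x^-1 - 2 * (S ^+ 2 - c ^+ 2)) / x.
  transitivity ((c ^+ 2 + S ^+ 2) * (1 + x^-1 ^+ 2) + 2 * (c ^+ 2 - S ^+ 2) / x).
    by field; rewrite gt_eqF.
  by rewrite cS; field; rewrite gt_eqF.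
move: (x + x^-1 - 2 * (S ^+ 2 - c ^+ 2)) d0 => d d0.
by field; rewrite !gt_eqF.
Qed.

(** The angle is parametrised so that th -> pi/2 means eta -> 0. The difference removes the part of
    the double integral that is even in sin th and leaves a gamma integral in t; one integration by
    parts in s then produces the cosine transform of [csch]. *)
Lemma gX_energy_diff {R} (p eta : R) : 0 < eta < pi ->
  let th := (pi - eta) / 2 in
  (gX p 0 (- th) ^+ 2 + gX p (- (pi / 2)) (- th) ^+ 2)
  - (gX p 0 th ^+ 2 + gX p (- (pi / 2)) th ^+ 2)
  = p * (2 * sin eta * \int[mu]_s (cos (p * s) * csch eta s)).
Proof.
move=> e0p th; have /andP[e0 ep] := e0p.
have ceta : cos eta = sin th ^+ 2 - cos th ^+ 2.
  have -> : eta = pi - th *+ 2 by rewrite /th mulr2n; lra.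
  rewrite cosB cospi sinpi cos_mulr2n; have := cos2Dsin2 th; lra.
have seta : sin eta = 2 * cos th * sin th.
  have -> : eta = pi - th *+ 2 by rewrite /th mulr2n; lra.
  by rewrite sinB cospi sinpi sin_mulr2n; ring.
have c0 : 0 < cos th.
  by apply: cos_gt0_pihalf; rewrite /th; apply/andP; split; lra.
have c0' : 0 < cos (- th) by rewrite cosN.
have [iA jA EA] := gX_energy p c0'.
have [iB jB EB] := gX_energy p c0.
rewrite EA EB -(IntB iA iB).
pose f s := 2 * sin eta * (sin (p * s) * (expR s - expR (- s)) * csch eta s ^+ 2).
(* Between -th and th only the sign of sin th changes, and cos(a + x) - cos(a - x) = -2 sin a sin x
   with a = ps. *)
have Ef s : \int[mu]_t (kap (cos (- th)) t * kap (cos (- th)) (t + s) *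
      cos (p * s - sin (- th) * (expR (- s) - 1) * expR (- t))) -
    \int[mu]_t (kap (cos th) t * kap (cos th) (t + s) *
      cos (p * s - sin th * (expR (- s) - 1) * expR (- t))) = f s.
  rewrite -(IntB (jA s) (jB s)).
  have A0 : 0 < cos th * (1 + expR (- s)).
    by rewrite mulr_gt0// addr_gt0// expR_gt0.
  have [ig Eg] := Int_gamma2_sin (sin th * (expR (- s) - 1)) A0.
  transitivity (\int[mu]_t (- 2 * expR (- s) * sin (p * s) *
     (expR (- t) ^+ 2 * expR (- (cos th * (1 + expR (- s)) * expR (- t))) *
      sin (sin th * (expR (- s) - 1) * expR (- t))))).
    apply: eq_Int => t; rewrite cosN sinN -mulrBr /kap.
    rewrite !mulNr opprK cosD cosB.
    rewrite (_ : - (cos th * (1 + expR (- s)) * expR (- t)) =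
       - (cos th * expR (- t)) + - (cos th * expR (- (t + s)))); last first.
      by rewrite opprD expRD; ring.
    by rewrite expRD opprD expRD; ring.
  rewrite IntZ// Eg /f /csch ceta seta.
  have d0 := csch_den s e0p.
  rewrite ceta in d0.
  have x0 := expR_gt0 s.
  have := cos2Dsin2 th.
  rewrite expRN in d0 *.
  move: (expR s) (cos th) (sin th) (sin (p * s)) x0 d0 => x c S v x0 d0 cS.
  rewrite [LHS](_ : _ = v * (- 2 * x^-1 * (2 * (c * (1 + x^-1)) * (S * (x^-1 - 1)) /
     ((c * (1 + x^-1)) ^+ 2 + (S * (x^-1 - 1)) ^+ 2) ^+ 2))); last by ring.
  rewrite energy_algebra// exprVn; ring.
have iF : intble f.
  rewrite (_ : f = (fun s => \int[mu]_t (kap (cos (- th)) t * kap (cos (- th)) (t + s) *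
      cos (p * s - sin (- th) * (expR (- s) - 1) * expR (- t))) -
    \int[mu]_t (kap (cos th) t * kap (cos th) (t + s) *
      cos (p * s - sin th * (expR (- s) - 1) * expR (- t))))).
    exact: (intbleB iA iB).
  by apply/funext => s; rewrite Ef.
rewrite (eq_Int Ef).
have iC := csch_intble e0p.
have ic : intble (fun s => csch eta s * cos (p * s)).
  by apply: (@intble_bdM _ 1); [meas|move=> s; exact: cos_max|exact: iC].
(* [f] is -2 sin(eta) sin(ps) times the derivative of [csch]; [H] decays at both ends, so its
   derivative integrates to 0. *)
pose H s := sin (p * s) * csch eta s.
have dH (s : R) : is_derive s 1 (fun s => 2 * sin eta * H s)
    (2 * sin eta * p * (csch eta s * cos (p * s)) - f s).
  have d0 := csch_den s e0p.
  rewrite /H /csch; derv; first by rewrite gt_eqF.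
  by rewrite /f /csch; field; rewrite gt_eqF.
have Hbd s : `|2 * sin eta * H s| <= 2 * (1 - `|cos eta|)^-1 * expN 1 s.
  have /andP[h1 h2] := csch_bd s e0p.
  rewrite /H !normrM (ger0_norm h1) (ger0_norm (ler0n _ 2)) -!mulrA ler_wpM2l//.
  rewrite mulrA -[leRHS]mul1r ler_pM ?mulr_ge0//.
  by rewrite -[leRHS]mul1r ler_pM ?sin_max.
have [L1 L2] := cvg_expdom ltr01 Hbd.
have id : intble (fun s => 2 * sin eta * p * (csch eta s * cos (p * s)) - f s).
  exact: (intbleB (intbleZ _ ic) iF).
have cd : continuous (fun s => 2 * sin eta * p * (csch eta s * cos (p * s)) - f s).
  rewrite /f /csch; cont => s; rewrite gt_eqF// csch_den//.
have := line_FTC dH cd id L1 L2.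
rewrite subrr (IntB (intbleZ _ ic) iF) (IntZ _ ic) => h.
rewrite [in RHS](@eq_Int _ _ (fun s => csch eta s * cos (p * s))); last first.
  by move=> s; rewrite mulrC.
lra.
Qed.

(** * The limit th -> pi/2 and the modulus of the coefficients *)

(** [p * gcoef b p] stands for [gX p b (pi / 2)], whose own integrand grows as t -> -oo; the
    integration by parts in [gX_reg] supplies the decaying weight. The coefficients c1 and c2 are
    its values at b = 0 and b = -pi/2. *)
Definition gcoef {R} (b p : R) : R :=
  \int[mu]_t (cos (p * t - expR (- t) + b) * (expR (- t) / (p + expR (- t)) ^+ 2)).

(** For t >= 0 the weight is at most e^(-t) / p^2; for t < 0 it is at most e^t / S, and S >= 1/2
    gives the 2. *)
Lemma amp_bd {R} (S p t : R) : 0 < p -> 2^-1 <= S -> S <= 1 ->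
  0 <= S * expR (- t) / (p + S * expR (- t)) ^+ 2 <= (2 + p ^- 2) * expN 1 t.
Proof.
move=> p0 S2 S1; have S0 : 0 < S by lra.
have x0 := expR_gt0 (- t).
have d0 : 0 < (p + S * expR (- t)) ^+ 2 by rewrite exprn_gt0// addr_gt0// mulr_gt0.
have pV : 0 < p ^- 2 by rewrite invr_gt0 exprn_gt0.
apply/andP; split; first by rewrite divr_ge0 ?ltW// mulr_gt0.
rewrite ler_pdivrMr// expN1E; case: ifPn => _.
  move: (expR (- t)) x0 d0 => x x0 d0.
  apply: (@le_trans _ _ (p ^- 2 * x * (p + S * x) ^+ 2)).
    have h1 : p ^+ 2 <= (p + S * x) ^+ 2.
      have hp : p <= p + S * x by rewrite lerDl ltW// mulr_gt0.
      by rewrite lerXn2r// nnegrE ltW// (lt_le_trans p0 hp).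
    have h2 : 1 <= (p + S * x) ^+ 2 / p ^+ 2 by rewrite ler_pdivlMr ?exprn_gt0// mul1r.
    rewrite [leRHS](_ : _ = x * ((p + S * x) ^+ 2 / p ^+ 2)); last by ring.
    apply: (@le_trans _ _ x); first by rewrite ler_piMl// ltW.
    by rewrite ler_peMr// ltW.
  by apply: ler_wpM2r; [exact: ltW|apply: ler_wpM2r; [exact: ltW|lra]].
have -> : expR t = (expR (- t))^-1 by rewrite -expRN opprK.
move: (expR (- t)) x0 d0 => x x0 d0.
apply: (@le_trans _ _ (2 * x^-1 * (p + S * x) ^+ 2)).
  rewrite mulrAC ler_pdivlMr// -subr_ge0.
  rewrite (_ : _ - _ = 2 * p * (p + 2 * S * x) + S * (2 * S - 1) * x ^+ 2); last by ring.
  have Sx : 0 < S * x by exact: mulr_gt0.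
  apply: addr_ge0; apply: mulr_ge0; rewrite ?sqr_ge0//.
  - by apply: mulr_ge0 => //; exact: ltW.
  - by rewrite -mulrA; lra.
  - by apply: mulr_ge0; [exact: ltW|lra].
by apply: ler_wpM2r; [exact: ltW|apply: ler_wpM2r; [rewrite invr_ge0; exact: ltW|lra]].
Qed.

Lemma mul_expRN_le {R} (x : R) : x * expR (- x) <= 1.
Proof.
rewrite expRN ler_pdivrMr ?expR_gt0// mul1r (le_trans _ (expR_ge1Dx x))//; lra.
Qed.

(** The bound is free of c because c E e^(-cE) <= 1 for E = e^(-t); so the term with cos th is
    dominated uniformly while its coefficient tends to 0. *)
Lemma rho_bd {R} (c S p t : R) : 0 < p -> 2^-1 <= S -> S <= 1 ->
  0 < c -> c <= 1 ->
  0 <= expR (- (c * expR (- t))) * (c * expR (- t) / (p + S * expR (- t))) <=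
   (2 + p^-1) * expN 1 t.
Proof.
move=> p0 S2 S1 c0 c1; have S0 : 0 < S by lra.
have x0 := expR_gt0 (- t).
have d0 : 0 < p + S * expR (- t) by rewrite addr_gt0// mulr_gt0.
have h := mul_expRN_le (c * expR (- t)).
have e0 := expR_ge0 (- (c * expR (- t))).
have e1 : expR (- (c * expR (- t))) <= 1.
  by rewrite expR_le1 oppr_le0 mulr_ge0 ?ltW.
have pV : 0 < p^-1 by rewrite invr_gt0.
apply/andP; split.
  by rewrite mulr_ge0// divr_ge0 ?ltW// mulr_gt0.
rewrite mulrA ler_pdivrMr// expN1E; case: ifPn => _.
  move: (expR (- t)) (expR (- (c * expR (- t)))) x0 d0 h e0 e1 => x e x0 d0 h e0 e1.
  apply: (@le_trans _ _ (p^-1 * x * (p + S * x))).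
    have h3 : e * (c * x) <= x.
      by rewrite mulrA -[leRHS]mul1r ler_wpM2r ?(ltW x0)// mulr_ile1 ?(ltW c0).
    have h2 : 1 <= (p + S * x) / p.
      by rewrite ler_pdivlMr// mul1r lerDl ltW// mulr_gt0.
    rewrite [leRHS](_ : _ = x * ((p + S * x) / p)); last by ring.
    by apply: (le_trans h3); rewrite ler_peMr// ltW.
  by apply: ler_wpM2r; [exact: ltW|apply: ler_wpM2r; [exact: ltW|lra]].
have -> : expR t = (expR (- t))^-1 by rewrite -expRN opprK.
move: (expR (- t)) (expR (- (c * expR (- t)))) x0 d0 h e0 e1 => x e x0 d0 h e0 e1.
apply: (@le_trans _ _ (2 * x^-1 * (p + S * x))).
  rewrite mulrAC ler_pdivlMr//.
  nra.
by apply: ler_wpM2r; [exact: ltW|apply: ler_wpM2r; [rewrite invr_ge0; exact: ltW|lra]].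
Qed.

(* The boundary term vanishes only for [0 < cos th]; at [th = pi / 2] the right-hand integral
   is no longer absolutely convergent, while the left-hand one is. *)
Lemma gX_reg {R} (p b th : R) : 0 < p -> 0 < cos th -> 2^-1 <= sin th ->
  [/\ intble (fun t => expR (- (cos th * expR (- t))) * cos (p * t - sin th * expR (- t) + b)
     * (sin th * expR (- t) / (p + sin th * expR (- t)) ^+ 2)),
     intble (fun t => expR (- (cos th * expR (- t))) * cos (p * t - sin th * expR (- t) + b)
     * (cos th * expR (- t) / (p + sin th * expR (- t)))) &
  p * (\int[mu]_t (expR (- (cos th * expR (- t))) * cos (p * t - sin th * expR (- t) + b)
     * (sin th * expR (- t) / (p + sin th * expR (- t)) ^+ 2)) +
   \int[mu]_t (expR (- (cos th * expR (- t))) * cos (p * t - sin th * expR (- t) + b)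
     * (cos th * expR (- t) / (p + sin th * expR (- t))))) = gX p b th].
Proof.
move=> p0 c0 S2; have S1 := sin_le1 th; have S0 : 0 < sin th by lra.
have C1 := cos_le1 th.
pose h t := expR (- (cos th * expR (- t))) * cos (p * t - sin th * expR (- t) + b)
     * (sin th * expR (- t) / (p + sin th * expR (- t)) ^+ 2).
pose r t := expR (- (cos th * expR (- t))) * cos (p * t - sin th * expR (- t) + b)
     * (cos th * expR (- t) / (p + sin th * expR (- t))).
have d0 t : 0 < p + sin th * expR (- t) by rewrite addr_gt0// mulr_gt0// expR_gt0.
have e1 t : expR (- (cos th * expR (- t))) <= 1.
  by rewrite expR_le1 oppr_le0 mulr_ge0 ?expR_ge0 ?ltW.
have ih : intble h.
  apply: (@intble_dom _ _ (fun t => (2 + p ^- 2) * expN 1 t)).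
  - by rewrite /h; meas.
  - exact: intble_expN.
  - move=> t; have /andP[a0 a1] := amp_bd t p0 S2 S1.
    apply: le_trans a1; rewrite /h normrM (ger0_norm a0) ler_piMl// normrM.
    by rewrite mulr_ile1 ?cos_max// (ger0_norm (expR_ge0 _)).
have ir : intble r.
  apply: (@intble_dom _ _ (fun t => (2 + p^-1) * expN 1 t)).
  - by rewrite /r; meas.
  - exact: intble_expN.
  - move=> t; have /andP[a0 a1] := rho_bd t p0 S2 S1 c0 C1.
    apply: le_trans a1; rewrite /r normrM normrM (ger0_norm (expR_ge0 _)).
    have q1 : 0 <= cos th * expR (- t) / (p + sin th * expR (- t)).
      by rewrite divr_ge0 ?(ltW (d0 t))// mulr_ge0 ?expR_ge0 ?ltW.
    by rewrite (ger0_norm q1) ler_wpM2r// ler_piMr ?expR_ge0 ?cos_max.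
split; [exact: ih|exact: ir|].
pose H t := - (expR (- (cos th * expR (- t))) * cos (p * t - sin th * expR (- t) + b) *
   (sin th * expR (- t) / (p + sin th * expR (- t)))).
have ig := gk_intble p b c0.
have dH (t : R) : is_derive t 1 H (p * (h t + r t) - gk p b th t).
  rewrite /H; derv; first by rewrite gt_eqF.
  rewrite /h /r /gk.
  have -> : cos (th + p * t - sin th * expR (- t) + b) =
    cos th * cos (p * t - sin th * expR (- t) + b) -
    sin th * sin (p * t - sin th * expR (- t) + b).
    by rewrite -cosD; congr cos; ring.
  have := d0 t; move: (expR (- t)) (sin th) => x S dx.
  by field; rewrite gt_eqF.
have Hbd t : `|H t| <= p^-1 * (3 + 18 / cos th ^+ 3) * expN 1 t.
  rewrite -mulrA (le_trans _ (ler_wpM2l _ (gkernel_dom t c0)))//; last by rewrite invr_ge0 ltW.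
  have x0 := expR_gt0 (- t).
  rewrite /H normrN normrM normrM (ger0_norm (expR_ge0 _)).
  rewrite (ger0_norm (divr_ge0 (mulr_ge0 (ltW S0) (ltW x0)) (ltW (d0 t)))).
  have e0 := expR_ge0 (- (cos th * expR (- t))).
  apply: (@le_trans _ _ (expR (- (cos th * expR (- t))) * (p^-1 * expR (- t)))).
    apply: ler_pM.
    - exact: mulr_ge0.
    - by rewrite divr_ge0 ?(ltW (d0 t))// mulr_ge0 ?ltW.
    - by rewrite ler_piMr ?cos_max.
    - rewrite ler_pdivrMr//.
      have -> : p^-1 * expR (- t) * (p + sin th * expR (- t)) =
        expR (- t) + p^-1 * expR (- t) * (sin th * expR (- t)).
        by field; rewrite gt_eqF.
      have := ler_piMl (ltW x0) S1.
      have : 0 <= p^-1 * expR (- t) * (sin th * expR (- t)).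
        by rewrite !mulr_ge0 ?invr_ge0 ?ltW.
      by lra.
  rewrite [leLHS](_ : _ = p^-1 * (expR (- t) * expR (- (cos th * expR (- t))))); last by ring.
  rewrite ler_wpM2l ?invr_ge0 ?(ltW p0)// ler_wpM2r// ler_peMr ?(ltW x0)//; lra.
have [L1 L2] := cvg_expdom ltr01 Hbd.
have ihr : intble (fun t => p * (h t + r t)) by exact/intbleZ/(intbleD ih ir).
have cd : continuous (fun t => p * (h t + r t) - gk p b th t).
  by rewrite /h /r /gk; cont => t; rewrite ?sqrf_eq0 gt_eqF// exprn_gt0.
have := line_FTC dH cd (intbleB ihr ig) L1 L2.
rewrite subrr (IntB ihr ig) (IntZ _ (intbleD ih ir)) (IntD ih ir) -/(gX p b th).
by move=> /eqP; rewrite subr_eq0 => /eqP.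
Qed.

Lemma half_itv {R} (q u : R) : 0 < u -> u < q ->
  [/\ - (q / 2) < (q - u) / 2, 0 < (q - u) / 2 & (q - u) / 2 < q / 2].
Proof. by move=> u0 uq; split; lra. Qed.

(** Both integrals of [gX_reg] are dominated uniformly along the angles; the second disappears in
    the limit with its factor cos th. *)
Lemma Int_gcoef_lim {R} (p b : R) : 0 < p ->
  gX p b ((pi - n.+1%:R^-1) / 2) @[n --> \oo] --> p * gcoef b p.
Proof.
move=> p0.
pose th (n : nat) : R := (pi - n.+1%:R^-1) / 2.
have e0p n := @harmonic_0pi R n.
have c0 n : 0 < cos (th n).
  apply: cos_gt0_pihalf; rewrite /th; have /andP[h1 h2] := e0p n.
  by have [-> _ ->] := half_itv h1 h2.
have cth : th n @[n --> \oo] --> (pi - 0) / 2.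
  apply: cvgMr_tmp; apply: cvgB; [exact: cvg_cst|exact: cvg_harmonic].
rewrite subr0 in cth.
have ccos : cos (th n) @[n --> \oo] --> 0.
  by rewrite -(cos_pihalf R); exact: (cvg_comp _ _ cth (@continuous_cos R _)).
have csin : sin (th n) @[n --> \oo] --> (1 : R).
  by rewrite -(sin_pihalf R); exact: (cvg_comp _ _ cth (@continuous_sin R _)).
have s2 n : 2^-1 <= sin (th n).
  rewrite (_ : th n = pi / 2 - n.+1%:R^-1 / 2); last by rewrite /th; move: pi => q; ring.
  rewrite sinB sin_pihalf cos_pihalf mul1r mul0r subr0.
  have := one_sub_cos_le (n.+1%:R^-1 / 2 : R).
  have h1 : n.+1%:R^-1 <= 1 :> R by rewrite invf_le1 ?ler1n ?ltr0n.
  have h0 : 0 <= n.+1%:R^-1 :> R by rewrite invr_ge0.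
  move: (n.+1%:R^-1 : R) h0 h1 => u h0 h1; nra.
pose h n t := expR (- (cos (th n) * expR (- t))) * cos (p * t - sin (th n) * expR (- t) + b)
     * (sin (th n) * expR (- t) / (p + sin (th n) * expR (- t)) ^+ 2).
pose r n t := expR (- (cos (th n) * expR (- t))) * cos (p * t - sin (th n) * expR (- t) + b)
     * (cos (th n) * expR (- t) / (p + sin (th n) * expR (- t))).
have cE t : expR (- (cos (th n) * expR (- t))) @[n --> \oo] --> (1 : R).
  have h1 : - (cos (th n) * expR (- t)) @[n --> \oo] --> - (0 * expR (- t)).
    by apply: cvgN; exact: cvgMr_tmp.
  rewrite mul0r oppr0 in h1.
  by rewrite -(expR0 R); exact: (cvg_comp _ _ h1 (@continuous_expR R _)).
have csE t : sin (th n) * expR (- t) @[n --> \oo] --> expR (- t).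
  by rewrite -[X in _ --> X]mul1r; exact: cvgMr_tmp.
have ccs t : cos (p * t - sin (th n) * expR (- t) + b) @[n --> \oo] --> cos (p * t - expR (- t) + b).
  have h1 : p * t - sin (th n) * expR (- t) + b @[n --> \oo] --> p * t - expR (- t) + b.
    by apply: cvgD; [apply: cvgB; [exact: cvg_cst|exact: csE]|exact: cvg_cst].
  exact: (cvg_comp _ _ h1 (@continuous_cos R _)).
have pt0 t : p + expR (- t) != 0 by rewrite gt_eqF// addr_gt0// expR_gt0.
have cden t : p + sin (th n) * expR (- t) @[n --> \oo] --> p + expR (- t).
  by apply: cvgD; [exact: cvg_cst|exact: csE].
have [ih Eh] : intble (fun t => 1 * cos (p * t - expR (- t) + b) * (expR (- t) / (p + expR (- t)) ^+ 2)) /\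
    \int[mu]_t h n t @[n --> \oo] -->
    \int[mu]_t (1 * cos (p * t - expR (- t) + b) * (expR (- t) / (p + expR (- t)) ^+ 2)).
  apply: (@Int_dct _ _ _ (fun t => (2 + p ^- 2) * expN 1 t)).
  - by move=> n; rewrite /h; meas.
  - move=> t; apply: cvgM; first by apply: cvgM; [exact: cE|exact: ccs].
    apply: cvgM; first exact: csE.
    apply: cvgV; first by rewrite sqrf_eq0.
    have c2 := cden t; rewrite expr2.
    rewrite (_ : (fun n => (p + sin (th n) * expR (- t)) ^+ 2) =
      (fun n => (p + sin (th n) * expR (- t)) * (p + sin (th n) * expR (- t)))).
      exact: cvgM.
    by apply/funext => n; rewrite expr2.
  - exact: intble_expN.
  - move=> n t; have /andP[a0 a1] := amp_bd t p0 (s2 n) (sin_le1 _).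
    apply: le_trans a1; rewrite /h normrM (ger0_norm a0) ler_piMl// normrM.
    rewrite mulr_ile1 ?cos_max// (ger0_norm (expR_ge0 _)) expR_le1 oppr_le0.
    by rewrite mulr_ge0 ?expR_ge0 ?ltW.
have [_ Er] : intble (fun t => 1 * cos (p * t - expR (- t) + b) * (0 * expR (- t) / (p + expR (- t)))) /\
    \int[mu]_t r n t @[n --> \oo] -->
    \int[mu]_t (1 * cos (p * t - expR (- t) + b) * (0 * expR (- t) / (p + expR (- t)))).
  apply: (@Int_dct _ _ _ (fun t => (2 + p^-1) * expN 1 t)).
  - by move=> n; rewrite /r; meas.
  - move=> t; apply: cvgM; first by apply: cvgM; [exact: cE|exact: ccs].
    apply: cvgM; first exact: cvgMr_tmp.
    by apply: cvgV; [exact: pt0|exact: cden].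
  - exact: intble_expN.
  - move=> n t; have /andP[a0 a1] := rho_bd t p0 (s2 n) (sin_le1 _) (c0 n) (cos_le1 _).
    apply: le_trans a1; rewrite /r normrM normrM (ger0_norm (expR_ge0 _)).
    have q0 : 0 <= cos (th n) * expR (- t) / (p + sin (th n) * expR (- t)).
      rewrite divr_ge0 ?mulr_ge0 ?expR_ge0 ?(ltW (c0 n))// addr_ge0 ?(ltW p0)//.
      by rewrite mulr_ge0 ?expR_ge0// (le_trans _ (s2 n)).
    by rewrite (ger0_norm q0) ler_wpM2r// ler_piMr ?expR_ge0 ?cos_max.
have R0 : \int[mu]_t (1 * cos (p * t - expR (- t) + b) * (0 * expR (- t) / (p + expR (- t)))) = 0.
  rewrite (@eq_Int _ _ (fun _ => 0)); first by rewrite Rintegral_cst// mul0r.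
  by move=> t; rewrite !mul0r mulr0.
rewrite R0 in Er.
have -> : p * gcoef b p = p * (\int[mu]_t (1 * cos (p * t - expR (- t) + b) *
   (expR (- t) / (p + expR (- t)) ^+ 2)) + 0).
  by rewrite addr0; congr (_ * _); apply: eq_Int => t; rewrite mul1r.
rewrite (_ : (fun n => _) = (fun n => p * (\int[mu]_t h n t + \int[mu]_t r n t))).
  by apply: cvgMl_tmp; apply: cvgD; [exact: Eh|exact: Er].
apply/funext => n; have [_ _ E] := gX_reg b p0 (c0 n) (s2 n).
by rewrite -/(th n) -E.
Qed.

(** Let [M] be the squared modulus at th = 0. By [gX_scale] those at -th and th are M e^(2p th) and
    M e^(-2p th). In the limit their difference gives M (e^(pi p) - e^(-pi p)) = 2 pi p, and the
    second alone says that p^2 times the left-hand side is M e^(-pi p); eliminating [M] gives the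
    Planck factor. *)
Lemma gcoef_modulus {R} (p : R) : 0 < p ->
  gcoef 0 p ^+ 2 + gcoef (- (pi / 2)) p ^+ 2 = 2 * pi / (p * (expR (2 * pi * p) - 1)).
Proof.
move=> p0; have q0 := @pi_gt0 R.
pose th (n : nat) : R := (pi - n.+1%:R^-1) / 2.
have e0p n := @harmonic_0pi R n.
have th0 n : 0 < th n < pi / 2.
  have /andP[h1 h2] := e0p n; have [_ h3 h4] := half_itv h1 h2.
  by rewrite /th h3 h4.
pose M := gX p 0 0 ^+ 2 + gX p (- (pi / 2)) 0 ^+ 2.
have Ep b n : gX p b (th n) = expR (- (p * th n)) * gX p b 0.
  have /andP[h1 h2] := th0 n.
  have h0 : - (pi / 2) < 0 :> R by move: pi q0 => q q0; lra.
  have := gX_scale p b h0 h1 h2.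
  by rewrite mulr0 expR0 mul1r => ->; rewrite mulrA -expRD addNr expR0 mul1r.
have Em b n : gX p b (- th n) = expR (p * th n) * gX p b 0.
  have /andP[h1 h2] := th0 n.
  have h0 : 0 < pi / 2 :> R by move: pi q0 => q q0; lra.
  have h3 : - th n < 0 by lra.
  have h4 : - (pi / 2) < - th n by lra.
  have := gX_scale p b h4 h3 h0.
  by rewrite mulr0 expR0 mul1r => <-; rewrite mulrA -expRD mulrN subrr expR0 mul1r.
have cth : th n @[n --> \oo] --> (pi - 0) / 2.
  apply: cvgMr_tmp; apply: cvgB; [exact: cvg_cst|exact: cvg_harmonic].
rewrite subr0 in cth.
have cexp a : expR (a * th n) @[n --> \oo] --> expR (a * (pi / 2)).
  have h1 : a * th n @[n --> \oo] --> a * (pi / 2) by exact: cvgMl_tmp.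
  exact: (cvg_comp _ _ h1 (@continuous_expR R _)).
have ME : M * (expR (p * pi) - expR (- (p * pi))) = p * (2 * pi).
  have D n : M * (expR (2 * p * th n) - expR (- 2 * p * th n)) =
     p * (2 * sin (n.+1%:R^-1) * \int[mu]_s (cos (p * s) * csch (n.+1%:R^-1) s)).
    rewrite -(gX_energy_diff p (e0p n)) -/(th n) !Ep !Em /M.
    have -> : expR (2 * p * th n) = expR (p * th n) ^+ 2.
      by rewrite -expRM_natl; congr expR; ring.
    have -> : expR (- 2 * p * th n) = expR (- (p * th n)) ^+ 2.
      by rewrite -expRM_natl; congr expR; ring.
    ring.
  have L1 : M * (expR (2 * p * th n) - expR (- 2 * p * th n)) @[n --> \oo] -->
      M * (expR (2 * p * (pi / 2)) - expR (- 2 * p * (pi / 2))).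
    by apply: cvgMl_tmp; apply: cvgB; exact: cexp.
  have L2 : M * (expR (2 * p * th n) - expR (- 2 * p * th n)) @[n --> \oo] --> p * (2 * pi).
    rewrite (_ : (fun n => _) = (fun n => p * (2 * sin (n.+1%:R^-1) *
      \int[mu]_s (cos (p * s) * csch (n.+1%:R^-1) s)))); last exact/funext.
    by apply: cvgMl_tmp; exact: Int_cos_csch_lim.
  have := cvg_unique _ L1 L2.
  have -> : 2 * p * (pi / 2) = p * pi by move: pi => q; field.
  have -> : - 2 * p * (pi / 2) = - (p * pi) by move: pi => q; field.
  by apply.
have L3 : gX p 0 (th n) ^+ 2 + gX p (- (pi / 2)) (th n) ^+ 2 @[n --> \oo] -->
    (p * gcoef 0 p) ^+ 2 + (p * gcoef (- (pi / 2)) p) ^+ 2.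
  rewrite !expr2.
  rewrite (_ : (fun n => _) = (fun n => gX p 0 (th n) * gX p 0 (th n) +
      gX p (- (pi / 2)) (th n) * gX p (- (pi / 2)) (th n))); last first.
    by apply/funext => n; rewrite !expr2.
  by apply: cvgD; apply: cvgM; exact: Int_gcoef_lim.
have L4 : gX p 0 (th n) ^+ 2 + gX p (- (pi / 2)) (th n) ^+ 2 @[n --> \oo] -->
    M * expR (- 2 * p * (pi / 2)).
  rewrite (_ : (fun n => _) = (fun n => M * expR (- 2 * p * th n))).
    by apply: cvgMl_tmp; exact: cexp.
  apply/funext => n; rewrite !Ep /M.
  have -> : expR (- 2 * p * th n) = expR (- (p * th n)) ^+ 2.
    by rewrite -expRM_natl; congr expR; ring.
  ring.
have E4 : (p * gcoef 0 p) ^+ 2 + (p * gcoef (- (pi / 2)) p) ^+ 2 = M * expR (- 2 * p * (pi / 2)).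
  exact: (cvg_unique _ L3 L4).
have E5 : - 2 * p * (pi / 2) = - (p * pi) by move: pi => q; field.
rewrite E5 in E4.
have x1 : 1 < expR (p * pi) by rewrite expR_gt1 mulr_gt0.
have E6 : expR (2 * pi * p) = expR (p * pi) ^+ 2.
  by rewrite -expRM_natl; congr expR; move: pi => q; ring.
rewrite E6; rewrite expRN in ME E4.
move: (gcoef 0 p) (gcoef (- (pi / 2)) p) E4 => g1 g2 E4.
move: (expR (p * pi)) x1 ME E4 => x x1 ME E4 {E6 L3 L4 cexp cth Ep Em}.
have x0 : 0 < x by lra.
have x20 : 0 < x ^+ 2 - 1.
  by rewrite subr_gt0 exprn_egt1.
have ME' : M = p * (2 * pi) * x / (x ^+ 2 - 1).
  have x2n : x ^+ 2 - 1 != 0 by rewrite gt_eqF.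
  by apply: (mulIf x2n); rewrite mulfVK// -ME; field; rewrite gt_eqF.
rewrite ME' in E4.
have : p ^+ 2 * (g1 ^+ 2 + g2 ^+ 2) = p ^+ 2 * (2 * pi / (p * (x ^+ 2 - 1))).
  rewrite mulrDr -!exprMn E4; move: pi => q; field.
  by rewrite !gt_eqF.
by apply: mulfI; rewrite sqrf_eq0 gt_eqF.
Qed.

(** * Integration by parts in y and asymptotics for large k *)

(** Forces p into [m, P] with m > 0, so that denominators and coefficients are continuous and
    bounded for all p. Under an integral it comes with a factor g supported in [m, P], and then
    changes nothing ([supp_clamp]). *)
Definition clamp {R} (m P p : R) : R := Num.max m (Num.min p P).

Definition supp_in {R} (m P : R) (g : R -> R) :=
  forall p, g p != 0 -> m <= p <= P.

Lemma clamp_itv {R} (m P p : R) : m <= P -> m <= clamp m P p <= P.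
Proof. by move=> mP; rewrite /clamp le_max lexx/= ge_max mP/= ge_min lexx orbT. Qed.

Lemma supp_clamp {R} (m P : R) (g : R -> R) (F : R -> R) (p : R) :
  supp_in m P g -> g p * F (clamp m P p) = g p * F p.
Proof.
move=> gs; have [->|/gs /andP[mp pP]] := eqVneq (g p) 0; first by rewrite !mul0r.
by rewrite /clamp min_l// max_r.
Qed.

Lemma continuous_clamp {R} (m P : R) : continuous (clamp m P).
Proof.
rewrite /clamp; apply: cfun_max; first exact: cfun_cst.
by move=> x; apply: continuous_min; [exact: cvg_id|exact: cst_continuous].
Qed.

Lemma measurable_clamp {R} (m P : R) : measurable_fun setT (clamp m P).
Proof. by apply: continuous_measurable_fun; exact: continuous_clamp. Qed.

Lemma supp_expdom {R} (m P : R) (g : R -> R) :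
  0 < m -> m <= P -> continuous g -> supp_in m P g -> exists K, expdom K g.
Proof.
move=> m0 mP cg gs.
have cg' : {within `[m, P], continuous (fun p => `|g p|)}.
  by apply: continuous_subspaceT; apply: cfun_norm.
have [c _ hc] := EVT_max mP cg'.
exists (`|g c| * expR P) => x.
have [->|gx] := eqVneq (g x) 0.
  by rewrite normr0 mulr_ge0// ?mulr_ge0 ?expR_ge0.
have /andP[mx xP] := gs x gx.
rewrite -mulrA (le_trans (hc x _))//; first by rewrite in_itv/= mx xP.
rewrite ler_peMr// /expN mul1r -expRD -[leLHS](expR0 R) ler_expR ger0_norm; last by rewrite (le_trans _ mx)// ltW.
by rewrite subr_ge0.
Qed.

Lemma Riemann_Lebesgue_near {R} (K : R) (G : R -> R) (T beta : nat -> R) :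
  continuous G -> expdom K G -> (\forall n \near \oo, T n != 0) ->
  (T n)^-1 @[n --> \oo] --> 0 ->
  \int[mu]_p (G p * sin (p * T n + beta n)) @[n --> \oo] --> 0.
Proof.
move=> cG GK T0 Tn.
pose T' n := if T n == 0 then 1 else T n.
have TT' : \forall n \near \oo, T n = T' n.
  by apply: filterS T0 => n; rewrite /T'; case: ifP.
have T'0 n : T' n != 0 by rewrite /T'; case: ifPn => //; rewrite oner_eq0.
have cT' : (T' n)^-1 @[n --> \oo] --> 0.
  by apply: cvg_trans Tn; apply: near_eq_cvg; apply: filterS TT' => n ->.
apply: cvg_trans (Riemann_Lebesgue beta cG GK T'0 cT').
by apply: near_eq_cvg; apply: filterS TT' => n ->.
Qed.

Lemma cvg_invr_shift {R} (a : R) :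
  (\forall n \near \oo, (n%:R + a : R) != 0) /\ (n%:R + a)^-1 @[n --> \oo] --> (0 : R).
Proof.
split.
  near=> n; rewrite gt_eqF//.
  have : 1 - a <= n%:R by near: n; exact: nbhs_infty_ger.
  lra.
apply/cvgr0Pnorm_le => e e0; near=> n.
have h : e^-1 - a <= n%:R by near: n; exact: nbhs_infty_ger.
have e1 : 0 < e^-1 by rewrite invr_gt0.
have h1 : 0 < n%:R + a by lra.
by rewrite gtr0_norm ?invr_gt0// -[leRHS]invrK lef_pV2 ?posrE//; lra.
Unshelve. all: by end_near. Qed.

(* [dx] is the derivative of [xmap], [dphi] that of the phase [p * (y - yo) + k * xmap y],
   and [amp] that of [1 / dphi]. *)
Definition dx {R} (y : R) : R := (1 + expR y)^-1.
Definition dphi {R} (p k y : R) : R := p + k * dx y.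
Definition phi {R} (p k yo b y : R) : R := p * (y - yo) + k * xmap y + b.
Definition amp {R} (p k y : R) : R :=
  k * (expR y * dx y ^+ 2) / dphi p k y ^+ 2.

Lemma is_derive_xmap {R} (y : R) : is_derive y 1 xmap (dx y).
Proof.
have y0 := expR_gt0 y.
rewrite /xmap; derv; first by rewrite addr_gt0 ?expR_gt0.
by rewrite /dx expRN; field; rewrite !gt_eqF//= ?addr_gt0// addrC addr_gt0.
Qed.

Lemma dx_gt0 {R} (y : R) : 0 < dx y.
Proof. by rewrite invr_gt0 addr_gt0 ?expR_gt0. Qed.

Lemma dphi_ge {R} (p k y : R) : 0 <= k -> p <= dphi p k y.
Proof. by move=> k0; rewrite lerDl mulr_ge0// ltW// dx_gt0. Qed.

Lemma is_derive_dx {R} (y : R) : is_derive y 1 dx (- (expR y * dx y ^+ 2)).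
Proof.
have y0 := expR_gt0 y.
rewrite /dx; derv; first by rewrite gt_eqF// addr_gt0.
by field; rewrite gt_eqF// addr_gt0.
Qed.

Lemma continuous_dx {R} : continuous (@dx R).
Proof. by rewrite /dx; cont => y; rewrite gt_eqF// addr_gt0// expR_gt0. Qed.

Lemma continuous_xmap {R} : continuous (@xmap R).
Proof. by rewrite /xmap; cont => y; rewrite addr_gt0// expR_gt0. Qed.

Lemma logistic_bd {R} (y : R) : 0 <= expR y * dx y ^+ 2 <= expN 1 y.
Proof.
have y0 := expR_gt0 y; have d0 := dx_gt0 y.
apply/andP; split; first by apply: mulr_ge0; [exact: ltW|exact: sqr_ge0].
rewrite /dx exprVn ler_pdivrMr ?exprn_gt0 ?addr_gt0// expN1E; case: ifPn => _.
  rewrite expRN; move: (expR y) y0 => x x0.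
  by rewrite mulrC ler_pdivlMr//; nra.
by move: (expR y) y0 => x x0; nra.
Qed.

Lemma amp_dom {R} (m p k y : R) : 0 < m -> m <= p -> 0 <= k ->
  0 <= amp p k y <= k / m ^+ 2 * expN 1 y.
Proof.
move=> m0 mp k0; have /andP[l0 l1] := logistic_bd y.
have d0 : m <= dphi p k y := le_trans mp (dphi_ge p y k0).
have d1 : 0 < dphi p k y := lt_le_trans m0 d0.
apply/andP; split.
  by rewrite /amp divr_ge0 ?sqr_ge0// mulr_ge0.
have hV : (dphi p k y ^+ 2)^-1 <= (m ^+ 2)^-1.
  by rewrite lef_pV2 ?posrE ?exprn_gt0// lerXn2r// nnegrE ltW.
rewrite [leRHS](_ : _ = k * (expN 1 y * m ^- 2)); last by ring.
rewrite /amp -[leLHS]mulrA; apply: ler_wpM2l => //.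
by apply: ler_pM => //; rewrite invr_ge0 sqr_ge0.
Qed.

(** The basic step of non-stationary phase, (sin phi / phi')' = cos phi + (1 / phi')' sin phi,
    possible because phi' >= p > 0. The gain is that [amp] is integrable in y, while the cosine is
    not. *)
Lemma is_derive_boundary {R} (p k yo b y : R) : 0 < p -> 0 <= k ->
  is_derive y 1 (fun y => sin (phi p k yo b y) / dphi p k y)
    (cos (phi p k yo b y) + sin (phi p k yo b y) * amp p k y).
Proof.
move=> p0 k0.
have d1 : 0 < dphi p k y := lt_le_trans p0 (dphi_ge p y k0).
have hx : has_deriv y (@xmap R) (dx y) := is_derive_xmap y.
have hd : has_deriv y (@dx R) _ := is_derive_dx y.
rewrite /phi /dphi; derv; first by rewrite gt_eqF.
rewrite /amp /dphi; move: d1; rewrite /dphi => d1.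
by field; rewrite gt_eqF.
Qed.

Lemma measurable_xmap {R} : measurable_fun setT (@xmap R).
Proof. by apply: continuous_measurable_fun; exact: continuous_xmap. Qed.

Lemma measurable_dx {R} : measurable_fun setT (@dx R).
Proof. by apply: continuous_measurable_fun; exact: continuous_dx. Qed.

Definition ampint {R} (k yo b p : R) : R :=
  \int[mu]_y (sin (phi p k yo b y) * amp p k y).

Lemma ampint_intble {R} (k yo b p : R) : 0 < p -> 0 <= k ->
  intble (fun y => sin (phi p k yo b y) * amp p k y).
Proof.
move=> p0 k0; have ? := @measurable_xmap R; have ? := @measurable_dx R.
apply: (@intble_dom _ _ (fun y => k / p ^+ 2 * expN 1 y)).
- by rewrite /phi /amp /dphi; meas.
- exact: intble_expN.
- move=> y; have /andP[a0 a1] := amp_dom y p0 (lexx _) k0.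
  by rewrite normrM (ger0_norm a0) (le_trans _ a1)// ler_piMl ?sin_max.
Qed.

Lemma continuous_ampint {R} (k yo b p : R) : 0 < p -> 0 <= k ->
  continuous (fun y => sin (phi p k yo b y) * amp p k y).
Proof.
move=> p0 k0; have ? := @continuous_xmap R; have ? := @continuous_dx R.
rewrite /phi /amp /dphi; cont => y; rewrite sqrf_eq0 gt_eqF//.
exact: lt_le_trans p0 (dphi_ge p y k0).
Qed.

Lemma ampint_bd {R} (m k yo b p : R) : 0 < m -> m <= p -> 0 <= k ->
  `|ampint k yo b p| <= 2 * k / m ^+ 2.
Proof.
move=> m0 mp k0; have p0 := lt_le_trans m0 mp.
have [iN EN] := expN_intble (@ltr01 R).
have -> : 2 * k / m ^+ 2 = \int[mu]_y (k / m ^+ 2 * expN 1 y).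
  by rewrite IntZ// EN divr1; ring.
apply: normr_Int_le; [exact: ampint_intble|exact: intbleZ|].
move=> y; have /andP[a0 a1] := amp_dom y m0 mp k0.
by rewrite normrM (ger0_norm a0) (le_trans _ a1)// ler_piMl ?sin_max.
Qed.

(** The integrand of [fcheck_re] (b = 0) and [fcheck_im] (b = -pi/2) for the packet moved to yo,
    without normalising constants. *)
Definition osc {R} (g : R -> R) (k yo b y : R) : R :=
  ftC g (y - yo) * cos (k * xmap y + b) - ftS g (y - yo) * sin (k * xmap y + b).

Lemma oscE {R} (g : R -> R) (k yo b y : R) : intble g ->
  osc g k yo b y = \int[mu]_p (g p * cos (phi p k yo b y)).
Proof.
move=> ig; rewrite /osc /ftC /ftS [X in X - _]mulrC [X in _ - X]mulrC.
rewrite -IntZ; last exact: intble_cos0.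
rewrite -IntZ; last exact: intble_sin0.
rewrite -IntB; [|exact/intbleZ/intble_cos0|exact/intbleZ/intble_sin0].
apply: eq_Int => p.
have -> : phi p k yo b y = p * (y - yo) + (k * xmap y + b) by rewrite /phi addrA.
by rewrite [in RHS]cosD; ring.
Qed.

Definition bdry {R} (m P : R) (g : R -> R) (k yo b y : R) : R :=
  \int[mu]_p (g p * (sin (phi (clamp m P p) k yo b y) / dphi (clamp m P p) k y)).

Definition dbdry {R} (m P : R) (g : R -> R) (k yo b y p : R) : R :=
  g p * (cos (phi (clamp m P p) k yo b y) +
     sin (phi (clamp m P p) k yo b y) * amp (clamp m P p) k y).

Lemma dbdry_bd {R} (m P : R) (g : R -> R) (k yo b y p : R) :
  0 < m -> m <= P -> 0 <= k -> `|dbdry m P g k yo b y p| <= `|g p| * (1 + k / m ^+ 2).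
Proof.
move=> m0 mP k0; have /andP[q1 q2] := clamp_itv p mP.
have /andP[a0 a1] := amp_dom y m0 q1 k0.
rewrite normrM ler_wpM2l// (le_trans (ler_normD _ _))// lerD ?cos_max//.
rewrite normrM (ger0_norm a0) (le_trans (ler_piMl a0 (sin_max _)))// (le_trans a1)//.
by rewrite ler_piMr ?expN_le1// divr_ge0// sqr_ge0.
Qed.

Lemma measurable_phi_clamp {R} (m P k yo b y : R) :
  measurable_fun setT (fun p => phi (clamp m P p) k yo b y).
Proof. by have ? := @measurable_clamp R m P; rewrite /phi; meas. Qed.

Lemma measurable_dphi_clamp {R} (m P k y : R) :
  measurable_fun setT (fun p => dphi (clamp m P p) k y).
Proof. by have ? := @measurable_clamp R m P; rewrite /dphi; meas. Qed.

Lemma is_derive_bdry {R} (m P : R) (g : R -> R) (k yo b y : R) :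
  0 < m -> m <= P -> 0 <= k -> intble g ->
  is_derive y 1 (bdry m P g k yo b) (\int[mu]_p dbdry m P g k yo b y p).
Proof.
move=> m0 mP k0 ig; have mg := intble_measurable ig.
pose F x p := g p * (sin (phi (clamp m P p) k yo b x) / dphi (clamp m P p) k x).
have dF (x p : R) : is_derive x 1 (fun x => F x p) (dbdry m P g k yo b x p).
  have /andP[q1 q2] := clamp_itv p mP.
  have hb : has_deriv x _ _ := is_derive_boundary yo b x (lt_le_trans m0 q1) k0.
  by rewrite /F; derv; rewrite /dbdry; ring.
have Iy : (`]y - 1, y + 1[%classic : set R) y by rewrite /= in_itv/=; apply/andP; split; lra.
have intF x : (`]y - 1, y + 1[%classic : set R) x -> mu.-integrable setT (EFin \o F x).
  move=> _; have ? := measurable_phi_clamp m P k yo b x.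
  have ? := measurable_dphi_clamp m P k x.
  apply: (@intble_bdM _ m^-1); [by meas| |exact: ig].
  move=> p; have /andP[q1 q2] := clamp_itv p mP.
  have d1 := le_trans q1 (dphi_ge (clamp m P p) x k0).
  have d0 := lt_le_trans m0 d1.
  rewrite normrM normfV (gtr0_norm d0) (le_trans (ler_piMl _ (sin_max _)))//.
    by rewrite invr_ge0 ltW.
  by rewrite lef_pV2.
have derF x (p : R) : (`]y - 1, y + 1[%classic : set R) x -> setT p ->
    derivable (fun x => F x p) x 1.
  by move=> _ _; have [] := dF x p.
pose G p := `|g p| * (1 + k / m ^+ 2).
have G0 p : 0 <= G p by rewrite mulr_ge0// addr_ge0// divr_ge0// sqr_ge0.
have iG : mu.-integrable setT (EFin \o G).
  rewrite (_ : G = fun p => (1 + k / m ^+ 2) * `|g p|).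
    by apply: intbleZ; exact: (intble_norm ig).
  by apply/funext => p; rewrite mulrC.
have Gub x (p : R) : (`]y - 1, y + 1[%classic : set R) x -> setT p ->
    `|derive1 (fun x => F x p) x| <= G p.
  by move=> _ _; rewrite derive1E; have [_ ->] := dF x p; exact: dbdry_bd.
have h1 := @derivable_under_integral R _ _ mu F setT measurableT y (y - 1) (y + 1)
  Iy intF derF G G0 iG Gub.
have h2 := @differentiation_under_integral R _ _ mu F setT measurableT y (y - 1) (y + 1)
  Iy intF derF G G0 iG Gub.
apply: DeriveDef; first exact: h1.
rewrite -derive1E [LHS]h2; apply: eq_Int => p.
by rewrite partial1of2E; have [_ ->] := dF y p.
Qed.

Lemma cvg_subK {R} (f h : nat -> R) (a : R) :
  f n - h n @[n --> \oo] --> 0 -> h n @[n --> \oo] --> a -> f n @[n --> \oo] --> a.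
Proof.
move=> h1 h2; have h3 := cvgD h1 h2; rewrite add0r in h3.
have E : (fun n => f n - h n) + [eta h] = f by apply/funext => n; rewrite fctE subrK.
by rewrite E in h3; apply: h3.
Qed.

(** At fixed p the boundary term oscillates without decay; the average over p vanishes by
    Riemann-Lebesgue at frequency y - yo. Since phi' tends exponentially fast to p at +oo and to p +
    k at -oo, it is first replaced by its limit. *)
Lemma bdry_cvg {R} (m P : R) (g : R -> R) (k yo b : R) :
  0 < m -> m <= P -> 0 <= k -> continuous g -> supp_in m P g ->
  bdry m P g k yo b n%:R @[n --> \oo] --> 0 /\
  bdry m P g k yo b (- n%:R) @[n --> \oo] --> 0.
Proof.
move=> m0 mP k0 cg gs; have [K gK] := supp_expdom m0 mP cg gs.
have mg := continuous_measurable_fun cg; have ig := expdom_intble mg gK.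
have cq := @continuous_clamp R m P; have mq := @measurable_clamp R m P.
have q1 p : m <= clamp m P p by have /andP[] := clamp_itv p mP.
have q0 p : 0 < clamp m P p by exact: lt_le_trans (q1 p).
(* [k'] is the limit of k dx(y): 0 at +oo and k at -oo. The phase k x(y) + b goes into the arbitrary
   [beta] of Riemann-Lebesgue. *)
suff main (k' : R) (y : nat -> R) : 0 <= k' ->
    (\forall n \near \oo, y n - yo != 0) -> (y n - yo)^-1 @[n --> \oo] --> 0 ->
    (forall n, `|k * dx (y n) - k'| <= k * expN 1 n%:R) ->
    bdry m P g k yo b (y n) @[n --> \oo] --> 0.
  split.
    apply: (main 0) => //.
    - exact: (cvg_invr_shift (- yo)).1.
    - exact: (cvg_invr_shift (- yo)).2.
    - move=> n; rewrite subr0 normrM (ger0_norm k0) ler_wpM2l//.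
      rewrite (gtr0_norm (dx_gt0 _)) expN1E ler0n expRN /dx lef_pV2 ?posrE ?expR_gt0 ?lerDr//.
  apply: (main k) => //.
  - have := (cvg_invr_shift yo).1; apply: filterS => n.
    by rewrite -[- n%:R - yo]opprD oppr_eq0.
  - rewrite (_ : (fun n => _) = (fun n => - (n%:R + yo)^-1)).
      by rewrite -oppr0; apply: cvgN; exact: (cvg_invr_shift yo).2.
    by apply/funext => n; rewrite -invrN opprD.
  - move=> n; rewrite -{2}(mulr1 k) -mulrBr normrM (ger0_norm k0) ler_wpM2l//.
    have e0 := expR_gt0 (- n%:R : R).
    rewrite expN1E ler0n distrC.
    have -> : 1 - dx (- n%:R) = expR (- n%:R) * dx (- n%:R) :> R.
      by rewrite /dx; field; rewrite gt_eqF// addr_gt0.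
    rewrite normrM (gtr0_norm e0) (gtr0_norm (dx_gt0 _)) ler_piMr ?(ltW e0)//.
    by rewrite invf_le1 ?addr_gt0// lerDl ltW.
move=> k'0 T0 Tn hk.
pose G p := g p / (clamp m P p + k').
have d0 p : 0 < clamp m P p + k' by rewrite ltr_pwDl.
have cG : continuous G by rewrite /G; cont => p; rewrite gt_eqF.
have GK : expdom (K / m) G.
  move=> p; rewrite /G normrM normfV (gtr0_norm (d0 p)) mulrAC.
  rewrite ler_pM ?invr_ge0 ?(ltW (d0 p))// lef_pV2 ?posrE//.
  by rewrite (le_trans (q1 p))// lerDl.
have RL := Riemann_Lebesgue_near (fun n => k * xmap (y n) + b) cG GK T0 Tn.
have iG := expdom_intble (continuous_measurable_fun cG) GK.
pose C := \int[mu]_p `|g p| / m ^+ 2 * k.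
have E n : `|bdry m P g k yo b (y n) -
    \int[mu]_p (G p * sin (p * (y n - yo) + (k * xmap (y n) + b)))| <= C * expN 1 n%:R.
  have ? := measurable_phi_clamp m P k yo b (y n).
  have ? := measurable_dphi_clamp m P k (y n).
  have dd p : m <= dphi (clamp m P p) k (y n) by exact: le_trans (q1 p) (dphi_ge _ _ k0).
  have dd0 p : 0 < dphi (clamp m P p) k (y n) := lt_le_trans m0 (dd p).
  have i1 : intble (fun p => g p * (sin (phi (clamp m P p) k yo b (y n)) / dphi (clamp m P p) k (y n))).
    apply: (@intble_bdM _ m^-1); [by meas| |exact: ig].
    move=> p; rewrite normrM normfV (gtr0_norm (dd0 p)) (le_trans (ler_piMl _ (sin_max _)))//.
      by rewrite invr_ge0 ltW.
    by rewrite lef_pV2 ?posrE.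
  have i2 : intble (fun p => G p * sin (p * (y n - yo) + (k * xmap (y n) + b))).
    exact: (intble_sin _ _ iG).
  rewrite /bdry -(IntB i1 i2).
  rewrite (_ : C * _ = \int[mu]_p (k * expN 1 n%:R / m ^+ 2 * `|g p|)); last first.
    by rewrite IntZ; [rewrite /C; ring|exact: (intble_norm ig)].
  apply: normr_Int_le; [exact: (intbleB i1 i2)|by apply: intbleZ; exact: (intble_norm ig)|].
  move=> p.
  have -> : p * (y n - yo) + (k * xmap (y n) + b) = phi p k yo b (y n) by rewrite /phi addrA.
  have -> : G p * sin (phi p k yo b (y n)) =
     g p * (sin (phi (clamp m P p) k yo b (y n)) / (clamp m P p + k')).
    rewrite (supp_clamp (fun q => sin (phi q k yo b (y n)) / (clamp m P p + k')) p gs).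
    by rewrite /G; ring.
  have -> : forall u v a c : R, u * (v / a) - u * (v / c) = u * (v * (a^-1 - c^-1)).
    by move=> u v a c; ring.
  have dn0 := dd0 p; have e0 := d0 p.
  have -> : (dphi (clamp m P p) k (y n))^-1 - (clamp m P p + k')^-1 =
     (k' - k * dx (y n)) * ((dphi (clamp m P p) k (y n))^-1 * (clamp m P p + k')^-1).
    by move: dn0; rewrite /dphi => dn0; field; rewrite !gt_eqF.
  rewrite !normrM mulrC ler_wpM2r// (le_trans (ler_piMl _ (sin_max _)))//.
  rewrite distrC ler_pM//.
  rewrite !normfV (gtr0_norm dn0) (gtr0_norm e0) expr2 invfM.
  rewrite ler_pM ?invr_ge0 ?(ltW dn0) ?(ltW e0)// lef_pV2 ?posrE//.
  by rewrite (le_trans (q1 p))// lerDl.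
have D0 : bdry m P g k yo b (y n) -
    \int[mu]_p (G p * sin (p * (y n - yo) + (k * xmap (y n) + b))) @[n --> \oo] --> 0.
  apply/norm_cvg0P.
  apply: (@squeeze_cvgr _ _ _ _ (fun _ => 0) (fun n => C * expN 1 n%:R)).
  - by apply: nearW => n; rewrite normr_ge0/= E.
  - exact: cvg_cst.
  - by rewrite -(mulr0 C); apply: cvgMl_tmp; exact: (expN_cvg ltr01).1.
exact: cvg_subK D0 RL.
Qed.

(** The derivative of [bdry] is [osc] plus the amplitude term, and [bdry] vanishes at both ends.
    [osc] is integrable because the packet in position space is; the amplitude term has a separated
    bound, so its integrals can be exchanged. *)
Lemma Int_osc {R} (m P : R) (g : R -> R) (k yo b : R) :
  0 < m -> m <= P -> 0 <= k -> continuous g -> supp_in m P g ->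
  intble (ftC g) -> intble (ftS g) ->
  \int[mu]_y osc g k yo b y = - \int[mu]_p (g p * ampint k yo b (clamp m P p)).
Proof.
move=> m0 mP k0 cg gs iC iS; have [K gK] := supp_expdom m0 mP cg gs.
have mg := continuous_measurable_fun cg; have ig := expdom_intble mg gK.
have cq := @continuous_clamp R m P; have mq := @measurable_clamp R m P.
have cx := @continuous_xmap R; have cdx := @continuous_dx R.
have mx := @measurable_xmap R; have mdx := @measurable_dx R.
have q1 p : m <= clamp m P p by have /andP[] := clamp_itv p mP.
have q0 p : 0 < clamp m P p by exact: lt_le_trans (q1 p).
have dd p y : m <= dphi (clamp m P p) k y by exact: le_trans (q1 p) (dphi_ge _ _ k0).
have dd0 p y : 0 < dphi (clamp m P p) k y := lt_le_trans m0 (dd p y).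
have kn y : 0 <= k / m ^+ 2 by rewrite divr_ge0// sqr_ge0.
have iO : intble (osc g k yo b).
  have c1 := (Int_shift (- yo) iC).1; have c2 := (Int_shift (- yo) iS).1.
  apply: intbleB.
    by apply: (@intble_bdM _ 1); [by meas|move=> y; exact: cos_max|exact: c1].
  by apply: (@intble_bdM _ 1); [by meas|move=> y; exact: sin_max|exact: c2].
pose f y p := g p * (sin (phi (clamp m P p) k yo b y) * amp (clamp m P p) k y).
have mf : measurable_fun (plane R) (fun z => f z.1 z.2).
  have ? := mfun_snd mq; have ? := mfun_snd mg; have ? := mfun_fst mx; have ? := mfun_fst mdx.
  by rewrite /f /phi /amp /dphi; meas.
have fd y p : `|f y p| <= (k / m ^+ 2 * expN 1 y) * (K * expN 1 p).
  have /andP[a0 a1] := amp_dom y m0 (q1 p) k0.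
  rewrite /f normrM mulrC; apply: ler_pM; [exact: normr_ge0|exact: normr_ge0| |exact: gK].
  by rewrite normrM (ger0_norm a0) (le_trans _ a1)// ler_piMl ?sin_max.
have iN := (expN_intble (@ltr01 R)).1.
have [f1 _ f3 _ fE] := Int_Fubini mf (intbleZ _ iN) (intbleZ K iN) fd.
pose V y := \int[mu]_p f y p.
have Ed y : \int[mu]_p dbdry m P g k yo b y p = osc g k yo b y + V y.
  have iosc : intble (fun p => g p * cos (phi p k yo b y)).
    rewrite (_ : (fun p => _) = (fun p => g p * cos (p * (y - yo) + (k * xmap y + b)))).
      exact: (intble_cos _ _ ig).
    by apply/funext => p; rewrite /phi addrA.
  rewrite (oscE k yo b y ig) /V -(IntD iosc (f1 y)).
  apply: eq_Int => p; rewrite /f /dbdry mulrDr; congr (_ + _).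
  exact: (supp_clamp (fun q => cos (phi q k yo b y)) p gs).
have dB (y : R) : is_derive y 1 (bdry m P g k yo b) (osc g k yo b y + V y).
  by rewrite -Ed; exact: is_derive_bdry.
have cO : continuous (osc g k yo b).
  have cC := continuous_ftC ig; have cS := continuous_ftS ig.
  rewrite /osc; cont.
    by apply: (cfun_comp cC); cont.
  by apply: (cfun_comp cS); cont.
have cV : continuous V.
  apply: (@Int_continuous _ _ (fun p => k / m ^+ 2 * (K * expN 1 p))).
  - by move=> y; have := measurable_fun_pair2 y mf.
  - move=> p; apply: cfunM; [exact: cfun_cst|].
    exact: (@continuous_ampint R k yo b _ (q0 p) k0).
  - by apply: intbleZ; exact: (intbleZ _ iN).
  - move=> y p; apply: (le_trans (fd y p)); apply: ler_wpM2r.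
      exact: le_trans (normr_ge0 _) (gK p).
    by apply: ler_piMr; [exact: kn|apply: expN_le1; exact: ler01].
have cOV : continuous (fun y => osc g k yo b y + V y) by cont.
have [B1 B2] := bdry_cvg yo b m0 mP k0 cg gs.
have := line_FTC dB cOV (intbleD iO f3) B1 B2.
rewrite subrr (IntD iO f3) fE => /eqP; rewrite addr_eq0 => /eqP ->.
apply: (congr1 (fun x => - x)); apply: eq_Int => p.
exact: (IntZ (g p) (ampint_intble yo b (q0 p) k0)).
Qed.

(* [amp] at the point [t + s] for [k = e^s], with [e = e^(-s)]. *)
Definition wgt {R} (e p t : R) : R :=
  expR (- t) / (p * (1 + e * expR (- t)) + expR (- t)) ^+ 2.

Lemma wgt0E {R} (p t : R) : wgt 0 p t = expR (- t) / (p + expR (- t)) ^+ 2.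
Proof. by rewrite /wgt mul0r addr0 mulr1. Qed.

Lemma wgt_den {R} (e p t : R) : 0 <= e -> 0 < p ->
  0 < p * (1 + e * expR (- t)) + expR (- t).
Proof.
move=> e0 p0; rewrite ltr_wpDl ?expR_gt0// mulr_ge0 ?(ltW p0)// addr_ge0// mulr_ge0// expR_ge0.
Qed.

Lemma wgt_ge0 {R} (e p t : R) : 0 <= wgt e p t.
Proof. by rewrite /wgt divr_ge0 ?expR_ge0// sqr_ge0. Qed.

Lemma wgt0_le {R} (m p t : R) : 0 < m -> m <= p ->
  wgt 0 p t <= (2 + m ^- 2) * expN 1 t.
Proof.
move=> m0 mp; have p0 := lt_le_trans m0 mp.
have h1 : 2^-1 <= 1 :> R by lra.
have /andP[_ ] := amp_bd t p0 h1 (lexx 1).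
rewrite wgt0E mul1r => h; apply: (le_trans h); apply: ler_wpM2r; first exact: expN_ge0.
by rewrite lerD2l lef_pV2 ?posrE ?exprn_gt0// lerXn2r// nnegrE ltW.
Qed.

Lemma wgt_diff {R} (e p t : R) : 0 <= e -> 0 < p ->
  0 <= wgt 0 p t - wgt e p t <= 2 * p * e * wgt 0 p t.
Proof.
move=> e0 p0; have d1 := wgt_den t e0 p0; have d0 := wgt_den t (lexx 0) p0.
move: d0 d1; rewrite /wgt mul0r addr0 mulr1; move: (expR_gt0 (- t)).
move: (expR (- t)) => x x0 d0 d1.
set D := p * (1 + e * x) + x; have D0 : 0 < D by [].
have D1 : D = p + x + p * e * x by rewrite /D; ring.
have pex : 0 <= p * e * x by apply: mulr_ge0; [apply: mulr_ge0|]; [exact: ltW|exact: e0|exact: ltW].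
have -> : x / (p + x) ^+ 2 - x / D ^+ 2 =
   x / (p + x) ^+ 2 * (p * e * x * (p + x + D) / D ^+ 2).
  have -> : p * e * x * (p + x + D) = D ^+ 2 - (p + x) ^+ 2 by rewrite D1; ring.
  by move: D D0 {D1} => D D0; field; rewrite !gt_eqF.
have w0 : 0 <= x / (p + x) ^+ 2 by rewrite divr_ge0 ?ltW// exprn_gt0.
have q0 : 0 <= p * e * x * (p + x + D) / D ^+ 2.
  by rewrite divr_ge0 ?sqr_ge0// mulr_ge0// addr_ge0 ?ltW.
rewrite mulr_ge0//= mulrC ler_wpM2r//.
rewrite ler_pdivrMr ?exprn_gt0//.
have pe : 0 <= p * e by rewrite mulr_ge0// ltW.
have h1 : x * (p + x + D) <= 2 * D ^+ 2.
  rewrite [leRHS](_ : _ = D * (D + D)); last by ring.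
  by apply: ler_pM; lra.
rewrite [leLHS](_ : _ = p * e * (x * (p + x + D))); last by ring.
rewrite [leRHS](_ : _ = p * e * (2 * D ^+ 2)); last by ring.
by rewrite ler_wpM2l.
Qed.

Lemma ln1D_approx {R} (x : R) : 0 <= x -> `|x - ln (1 + x)| <= x ^+ 2.
Proof.
move=> x0; have h1 : ln (1 + x) <= x by apply: le_ln1Dx; lra.
have x1 : 0 < 1 + x by lra.
rewrite ger0_norm ?subr_ge0//.
have := expR_ge1Dx (- ln (1 + x)).
rewrite expRN lnK ?posrE// => h2.
have : x - x ^+ 2 <= 1 - (1 + x)^-1.
  rewrite -subr_ge0 (_ : _ - _ = x ^+ 3 / (1 + x)); last by field; rewrite gt_eqF.
  by rewrite divr_ge0 ?exprn_ge0// ltW.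
move: h2; move: (ln (1 + x)) ((1 + x)^-1) (x ^+ 2) => l u v.
lra.
Qed.

(** Interpolates between a smallness bound and the trivial bound 2. In [ampint_asym] the phase error
    e^(-s-2t) is too large as t -> -oo for a weight of order e^(-|t|); its fourth root leaves
    e^(-t/2), which the weight absorbs. *)
Lemma min_quarter {R} (u d : R) : d <= expR u -> d <= 2 -> d <= 2 * expR (u / 4).
Proof.
move=> h1 h2; have [u0|u0] := leP u 0.
  have : expR u <= expR (u / 4) by rewrite ler_expR; lra.
  by have := expR_gt0 (u / 4); lra.
have : 1 <= expR (u / 4) by rewrite -{1}(expR0 R) ler_expR; lra.
lra.
Qed.

Lemma expN_half {R} (t : R) : expN 1 t * expR (- t / 2) <= expN 2^-1 t.
Proof.
rewrite /expN -expRD ler_expR; have := ler_norm t; have := ler_norm (- t); rewrite normrN.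
lra.
Qed.

Lemma sin_pert {R} (p s b L x : R) :
  `|sin (p + s - L + b) - sin (p + s - x + b)| <= `|L - x|.
Proof.
apply: (le_trans (sin_lipschitz _ _)).
rewrite (_ : _ - _ = - (L - x)); last by ring.
by rewrite normrN.
Qed.

Lemma amp_alg {R} (p a c : R) : 0 < p -> 0 < a -> 0 < c ->
  a * (c * a * (1 + c * a)^-1 ^+ 2) / (p + a * (1 + c * a)^-1) ^+ 2 =
  c^-1 / (p * (1 + a^-1 * c^-1) + c^-1) ^+ 2.
Proof.
move=> p0 a0 c0; have h : 0 < a * c by exact: mulr_gt0.
have h2 : 0 < p * (a * c) by exact: mulr_gt0.
field; do ?[apply/andP; split]; rewrite gt_eqF//; nra.
Qed.

(** In the translated variable k x(y) is -e^s ln(1 + e^(-s-t)), which tends to -e^(-t): the origin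
    of the exponential in the phase of [gcoef]. *)
Lemma ampint_shift {R} (s yo b p : R) : 0 < p ->
  intble (fun t => sin (p * t + p * (s - yo) - expR s * ln (1 + expR (- s) * expR (- t)) + b) * wgt (expR (- s)) p t) /\
  ampint (expR s) yo b p =
  \int[mu]_t (sin (p * t + p * (s - yo) - expR s * ln (1 + expR (- s) * expR (- t)) + b) * wgt (expR (- s)) p t).
Proof.
move=> p0; have [i E] := Int_shift s (ampint_intble yo b p0 (expR_ge0 s)).
have F t : sin (phi p (expR s) yo b (t + s)) * amp p (expR s) (t + s) =
  sin (p * t + p * (s - yo) - expR s * ln (1 + expR (- s) * expR (- t)) + b) * wgt (expR (- s)) p t.
  congr (sin _ * _).
    by rewrite /phi /xmap -expRD opprD [- t + _]addrC; ring.
  rewrite /amp /dphi /dx /wgt expRD !expRN.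
  exact: (amp_alg p0 (expR_gt0 s) (expR_gt0 t)).
split.
  by move: i; congr (lebesgue_measure.-integrable _ (EFin \o _)); apply/funext.
by rewrite /ampint -E; apply: eq_Int.
Qed.

Definition ampint_lim {R} (s b p : R) : R :=
  sin (p * s + b) * gcoef 0 p + cos (p * s + b) * gcoef (- (pi / 2)) p.

Lemma gcoef_intble {R} (b p : R) : 0 < p ->
  intble (fun t => cos (p * t - expR (- t) + b) * wgt 0 p t).
Proof.
move=> p0; apply: (@intble_dom _ _ (fun t => (2 + p ^- 2) * expN 1 t)).
- by rewrite /wgt; meas.
- exact: intble_expN.
- move=> t; rewrite normrM (ger0_norm (wgt_ge0 _ _ _)).
  apply: le_trans (wgt0_le t p0 (lexx p)).
  by rewrite ler_piMl ?wgt_ge0// cos_max.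
Qed.

Lemma gcoefE {R} (b p : R) :
  gcoef b p = \int[mu]_t (cos (p * t - expR (- t) + b) * wgt 0 p t).
Proof. by apply: eq_Int => t; rewrite wgt0E. Qed.

(** The addition formula merges the two coefficients into one integral of the shape of
    [ampint_shift], so the two can be compared pointwise. *)
Lemma ampint_limE {R} (s b p : R) : 0 < p ->
  intble (fun t => sin (p * t + p * s - expR (- t) + b) * wgt 0 p t) /\
  ampint_lim s b p = \int[mu]_t (sin (p * t + p * s - expR (- t) + b) * wgt 0 p t).
Proof.
move=> p0; have i1 := gcoef_intble 0 p0; have i2 := gcoef_intble (- (pi / 2)) p0.
have F t : sin (p * s + b) * (cos (p * t - expR (- t) + 0) * wgt 0 p t) +
  cos (p * s + b) * (cos (p * t - expR (- t) + - (pi / 2)) * wgt 0 p t) =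
  sin (p * t + p * s - expR (- t) + b) * wgt 0 p t.
  rewrite addr0 [cos (_ - pi / 2)]cosB cos_pihalf sin_pihalf mulr0 add0r mulr1.
  rewrite (_ : p * t + p * s - expR (- t) + b = (p * s + b) + (p * t - expR (- t))); last by ring.
  by rewrite [in RHS]sinD; ring.
have iZ := intbleD (intbleZ (sin (p * s + b)) i1) (intbleZ (cos (p * s + b)) i2).
split.
  by move: iZ; congr (lebesgue_measure.-integrable _ (EFin \o _)); apply/funext.
rewrite /ampint_lim !gcoefE -(IntZ _ i1) -(IntZ _ i2).
rewrite -(IntD (intbleZ (sin (p * s + b)) i1) (intbleZ (cos (p * s + b)) i2)).
exact: eq_Int.
Qed.

Lemma perturb_bd {R} (a c w w' d q W W' : R) : 0 <= w' -> w' <= w ->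
  `|a| <= 1 -> `|c| <= 1 -> `|a - c| <= d -> d * w <= W -> w - w' <= W' ->
  `|a * w' - c * w| <= W + W'.
Proof.
move=> w0 ww a1 c1 acd dW wW.
rewrite (_ : a * w' - c * w = (a - c) * w' - c * (w - w')); last by ring.
apply: (le_trans (ler_normB _ _)); apply: lerD.
  rewrite normrM (ger0_norm w0); apply: le_trans dW.
  by apply: ler_pM.
have ww0 : 0 <= w - w' by rewrite subr_ge0.
rewrite normrM (ger0_norm ww0); apply: le_trans wW.
by rewrite ler_piMl.
Qed.

(** Two errors: the logarithm against its linear part in the phase, and [wgt] at e^(-s) against
    [wgt] at 0. The constants 8 and 4 P are 2 and 2 P times the masses 4 and 2 of [expN 2^-1] and
    [expN 1]. *)
Lemma ampint_asym {R} (m P s yo b p : R) : 0 < m -> m <= p -> p <= P ->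
  `|ampint (expR s) yo b p - ampint_lim (s - yo) b p| <=
   (2 + m ^- 2) * (8 * expR (- s / 4) + 4 * P * expR (- s)).
Proof.
move=> m0 mp pP; have p0 := lt_le_trans m0 mp.
have [i1 ->] := ampint_shift s yo b p0; have [i2 ->] := ampint_limE (s - yo) b p0.
have h2 : 0 < 2^-1 :> R by rewrite invr_gt0.
have [iN EN] := expN_intble (@ltr01 R); have [iH EH] := expN_intble h2.
have E0 : (2 + m ^- 2) * (8 * expR (- s / 4) + 4 * P * expR (- s)) =
  \int[mu]_t (2 * expR (- s / 4) * (2 + m ^- 2) * expN 2^-1 t +
     2 * P * expR (- s) * (2 + m ^- 2) * expN 1 t).
  rewrite (IntD (intbleZ _ iH) (intbleZ _ iN)) (IntZ _ iH) (IntZ _ iN) EH EN divr1 invrK.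
  by move: (2 + m ^- 2) (expR (- s / 4)) (expR (- s)) => C u v; ring.
pose C := 2 + m ^- 2.
have C0 : 0 <= C by rewrite /C addr_ge0// invr_ge0 sqr_ge0.
rewrite E0 -(IntB i1 i2).
apply: normr_Int_le; [exact: intbleB i1 i2|exact: intbleD (intbleZ _ iH) (intbleZ _ iN)|].
move=> t; have e0 := expR_ge0 (- s); have /andP[w0 w1] := wgt_diff t e0 p0.
have wC := wgt0_le t m0 mp.
apply: (@perturb_bd _ _ _ _ _ (2 * expR ((- s - 2 * t) / 4))); first exact: 0.
- exact: wgt_ge0.
- by rewrite -subr_ge0.
- exact: sin_max.
- exact: sin_max.
- apply: min_quarter; last first.
    apply: (le_trans (ler_normB _ _)); rewrite [leRHS](_ : 2 = 1 + 1)//.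
    by apply: lerD; exact: sin_max.
  apply: (le_trans (sin_pert _ _ _ _ _)).
  have x0 : 0 <= expR (- s) * expR (- t) by rewrite mulr_ge0 ?expR_ge0.
  have := ln1D_approx x0; rewrite -(ler_pM2l (expR_gt0 s)).
  have -> : expR s * (expR (- s) * expR (- t)) ^+ 2 = expR (- s - 2 * t).
    rewrite exprMn -!expRM_natl -!expRD; congr expR; ring.
  apply: le_trans.
  rewrite -[X in _ <= X * _](gtr0_norm (expR_gt0 s)) -normrM mulrBr.
  rewrite [expR s * (expR (- s) * _)]mulrA -[expR s * expR (- s)]expRD subrr expR0 mul1r.
  by rewrite distrC.
- have -> : expR ((- s - 2 * t) / 4) = expR (- s / 4) * expR (- t / 2).
    by rewrite -expRD; congr expR; field.
  apply: (@le_trans _ _ (2 * (expR (- s / 4) * expR (- t / 2)) * (C * expN 1 t))).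
    by apply: ler_wpM2l => //; rewrite !mulr_ge0 ?expR_ge0.
  rewrite [leLHS](_ : _ = 2 * expR (- s / 4) * C * (expN 1 t * expR (- t / 2))); last by ring.
  by apply: ler_wpM2l; [rewrite !mulr_ge0 ?expR_ge0|exact: expN_half].
- apply: (le_trans w1).
  rewrite -[leRHS]mulrA.
  apply: ler_pM => //.
  + by rewrite !mulr_ge0 ?expR_ge0 ?ltW.
  + exact: wgt_ge0.
  + by apply: ler_wpM2r => //; apply: ler_wpM2l.
Qed.

Lemma continuous_gcoef {R} (m P b : R) : 0 < m -> m <= P ->
  continuous (fun p => gcoef b (clamp m P p)).
Proof.
move=> m0 mP; have cq := @continuous_clamp R m P.
have q1 p : m <= clamp m P p by have /andP[] := clamp_itv p mP.
apply: (@Int_continuous _ _ (fun t => (2 + m ^- 2) * expN 1 t)).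
- by move=> p; meas.
- move=> t; cont => p; rewrite sqrf_eq0 gt_eqF// addr_gt0 ?expR_gt0//.
  exact: lt_le_trans (q1 p).
- exact: intble_expN.
- move=> p t; rewrite -wgt0E normrM (ger0_norm (wgt_ge0 _ _ _)).
  apply: le_trans (wgt0_le t m0 (q1 p)).
  by rewrite ler_piMl ?wgt_ge0// cos_max.
Qed.

(** * From the spectrum in k to the particle number *)

(** The factor 1/2 of the theorem enters here: only s >= 0 is integrated, and an even E has half of
    its mass there. Finiteness of the integral of Q follows from the comparison. *)
Lemma half_line_bound {R} (Q E Z : R -> R) (M eta : R) :
  measurable_fun setT Q -> continuous E -> (forall s, 0 <= E s) ->
  (forall s, E (- s) = E s) -> intble E -> intble Z -> (forall s, 0 <= Z s) ->
  (forall s, 0 <= s -> `|Q s - M * E s| <= eta * (M * E s) + Z s) ->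
  exists I, (\int[mu]_(s in `[0%R, +oo[) (Q s)%:E = I%:E)%E /\
    `|I - M / 2 * \int[mu]_s E s| <= eta * (M / 2 * \int[mu]_s E s) + \int[mu]_s Z s.
Proof.
move=> mQ cE E0 EN iE iZ Z0 h.
pose D : set (measurableTypeR R) := `[0, +oo[%classic.
have mD : measurable D by exact: measurable_itv.
have iD f : intble f -> mu.-integrable D (EFin \o f).
  by move=> fi; exact: (integrableS measurableT mD _ fi).
have D0 x : D x -> 0 <= x by rewrite /D/= in_itv/= andbT.
have hE : \int[mu]_(s in D) E s = 2^-1 * \int[mu]_s E s.
  have := ge0_symfun_integralT E0 cE (fun x => esym (EN x)).
  rewrite (_ : [set x | 0 <= x] = D); last by rewrite /D -set_itvcy.
  move=> hh; have -> : \int[mu]_s E s = 2 * \int[mu]_(s in D) E s.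
    apply: EFin_inj; rewrite EFinM (EFin_Int iE) /Rintegral fineK; first exact: hh.
    exact: integrable_fin_num (iD _ iE).
  by rewrite mulrA mulVf ?mul1r.
have iME : intble (fun s => M * E s) := intbleZ M iE.
have iEZ : intble (fun s => eta * (M * E s) + Z s) := intbleD (intbleZ eta iME) iZ.
have iQ : mu.-integrable D (EFin \o Q).
  apply: (@le_integrable _ _ _ mu D mD _ (EFin \o (fun s => `|M * E s| + (eta * (M * E s) + Z s)))).
  - by apply/measurable_EFinP; exact: (measurable_funS measurableT _ mQ).
  - move=> x Dx /=; rewrite lee_fin; apply: le_trans (ler_norm _).
    have := h x (D0 _ Dx); have := ler_normD (Q x - M * E x) (M * E x); rewrite subrK.
    by move: `|Q x - _| `|Q x| => a b; lra.
  - by apply: iD; exact: intbleD (intble_norm iME) iEZ.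
exists (\int[mu]_(s in D) Q s); split.
  by rewrite /Rintegral fineK//; exact: integrable_fin_num.
have -> : M / 2 * \int[mu]_s E s = \int[mu]_(s in D) (M * E s).
  by rewrite (RintegralZl M mD (iD _ iE)) hE mulrA.
rewrite -(RintegralB mD iQ (iD _ iME)).
apply: (le_trans (le_normr_Rintegral mD (integrableB mD iQ (iD _ iME)))).
have hZ : \int[mu]_(s in D) Z s <= \int[mu]_s Z s.
  rewrite -lee_fin (EFin_Int iZ) fineK; last exact: integrable_fin_num (iD _ iZ).
  apply: ge0_subset_integral => //.
  - by apply/measurable_EFinP; exact: intble_measurable.
  - by move=> x _; rewrite lee_fin.
apply: le_trans (lerD (lexx _) hZ).
rewrite -(RintegralZl eta mD (iD _ iME)) -(RintegralD mD (iD _ (intbleZ eta iME)) (iD _ iZ)).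
apply: le_Rintegral => //.
- by apply: integrable_norm; exact: (integrableB mD iQ (iD _ iME)).
- exact: iD.
- by move=> x Dx; exact: h (D0 _ Dx).
Qed.

Lemma log_substitution {R} (G : R -> R) (yo : R) :
  continuous G -> (forall s, 0 <= G s) ->
  (\int[mu]_(s in `[0%R, +oo[) (G s)%:E =
   \int[mu]_(k in `[expR yo, +oo[) (G (ln k - yo) / k)%:E)%E.
Proof.
move=> cG G0; pose F (k : R) := ln k - yo.
have dF (k : R) : 0 < k -> is_derive k 1 F k^-1.
  by move=> k0; rewrite /F; derv; [exact: k0|ring].
have a0 := expR_gt0 yo.
have Fa : F (expR yo) = 0 by rewrite /F expRK subrr.
have dFE k : 0 < k -> derive1 F k = k^-1.
  by move=> k0; rewrite derive1E; have [_ ->] := dF k k0.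
have cF k : 0 < k -> {for k, continuous F}.
  by move=> k0; apply/differentiable_continuous/derivable1_diffP; have [] := dF k k0.
have cV (k : R) : 0 < k -> derive1 F x @[x --> k] --> k^-1.
  move=> k0; have hk : k^-1 = k^-1 by [].
  apply: cvg_trans (cvgV (lt0r_neq0 k0) (@cvg_id _ (nbhs k))).
  apply: near_eq_cvg; near=> x; rewrite dFE//.
  by near: x; exact: lt_nbhsr.
rewrite -{1}Fa (@increasing_ge0_integration_by_substitutiony R F G (expR yo)).
- apply: eq_integral => k; rewrite inE/= in_itv/= andbT => ak.
  by rewrite /= [X in (X)%:E]/(_ * _) /= dFE// (lt_le_trans a0 ak).
- move=> x y; rewrite !in_itv/= !andbT => ax ay xy; rewrite /F ltrD2r ltr_ln// posrE (lt_le_trans a0)//.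
- move=> x; rewrite in_itv/= andbT => ax.
  have x0 := lt_trans a0 ax.
  by rewrite /continuous_at dFE//; exact: cV.
- apply/cvg_ex; exists (expR yo)^-1; apply: cvg_at_right_filter; exact: cV.
- apply/cvg_ex; exists 0; apply/cvgr0Pnorm_le => e e0; near=> x.
  have x1 : e^-1 <= x by near: x; apply: nbhs_pinfty_ge; rewrite num_real.
  have x0 : 0 < x by rewrite (lt_le_trans _ x1)// invr_gt0.
  by rewrite dFE// gtr0_norm ?invr_gt0// -[leRHS]invrK lef_pV2 ?posrE ?invr_gt0.
- split.
    by move=> x; rewrite in_itv/= andbT => ax; have [] := dF x (lt_trans a0 ax).
  by apply: cvg_at_right_filter; exact: cF.
- apply/cvgryPge => A; near=> x.
  have x1 : expR (A + yo) <= x by near: x; apply: nbhs_pinfty_ge; rewrite num_real.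
  by rewrite /F lerBrDr -[leLHS]expRK ler_ln// posrE ?expR_gt0// (lt_le_trans _ x1)// expR_gt0.
- exact: continuous_subspaceT.
- by move=> x _; exact: G0.
Unshelve. all: by end_near. Qed.

Lemma osc_intble {R} (g : R -> R) (k yo b : R) :
  intble (ftC g) -> intble (ftS g) -> intble (osc g k yo b).
Proof.
move=> iC iS; have mx := @measurable_xmap R.
have c1 := (Int_shift (- yo) iC).1; have c2 := (Int_shift (- yo) iS).1.
apply: intbleB.
  by apply: (@intble_bdM _ 1); [by meas|move=> y; exact: cos_max|exact: c1].
by apply: (@intble_bdM _ 1); [by meas|move=> y; exact: sin_max|exact: c2].
Qed.

Lemma continuous_Int_osc {R} (g : R -> R) (yo b : R) :
  intble (ftC g) -> intble (ftS g) -> continuous (fun k => \int[mu]_y osc g k yo b y).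
Proof.
move=> iC iS.
have c1 := (Int_shift (- yo) iC).1; have c2 := (Int_shift (- yo) iS).1.
apply: (@Int_continuous _ _ (fun y => `|ftC g (y - yo)| + `|ftS g (y - yo)|)).
- by move=> k; exact: intble_measurable (osc_intble _ _ _ iC iS).
- by move=> y; rewrite /osc; cont.
- exact: intbleD (intble_norm c1) (intble_norm c2).
- move=> k y; rewrite /osc; apply: (le_trans (ler_normB _ _)); apply: lerD.
    by rewrite normrM ler_piMr ?cos_max.
  by rewrite normrM ler_piMr ?sin_max.
Qed.

(** Squared modulus of the transform without constants; [fcheckE] restores (2 pi)^-2, one factor 1 /
    (2 pi) from the transform and one from the packet. *)
Definition spec {R} (g : R -> R) (yo k : R) : R :=
  (\int[mu]_y osc g k yo 0 y) ^+ 2 + (\int[mu]_y osc g k yo (- (pi / 2)) y) ^+ 2.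

Lemma spec_ge0 {R} (g : R -> R) (yo k : R) : 0 <= spec g yo k.
Proof. by apply: addr_ge0; exact: sqr_ge0. Qed.

Lemma continuous_spec {R} (g : R -> R) (yo : R) :
  intble (ftC g) -> intble (ftS g) -> continuous (spec g yo).
Proof.
move=> iC iS; have c1 := @continuous_Int_osc R g yo 0 iC iS.
have c2 := @continuous_Int_osc R g yo (- (pi / 2)) iC iS.
by rewrite /spec; cont.
Qed.

Lemma fcheckE {R} (g : R -> R) (yo k : R) :
  intble (ftC g) -> intble (ftS g) ->
  let u := wp_shift (fun y => c2pi * ftC g y) yo in
  let v := wp_shift (fun y => c2pi * ftS g y) yo in
  fcheck_re u v k ^+ 2 + fcheck_im u v k ^+ 2 = (2 * pi) ^- 2 * spec g yo k.
Proof.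
move=> iC iS u v.
have -> : fcheck_re u v k = c2pi * (c2pi * \int[mu]_y osc g k yo 0 y).
  rewrite /fcheck_re -(IntZ _ (osc_intble k yo 0 iC iS)); congr (_ * _).
  by apply: eq_Int => y; rewrite /u /v /wp_shift /osc addr0; ring.
have -> : fcheck_im u v k = c2pi * (c2pi * \int[mu]_y osc g k yo (- (pi / 2)) y).
  rewrite /fcheck_im -(IntZ _ (osc_intble k yo (- (pi / 2)) iC iS)); congr (_ * _).
  by apply: eq_Int => y; rewrite /u /v /wp_shift /osc sinBpihalf cosBpihalf; ring.
rewrite /spec; have c2 : c2pi * c2pi = (2 * pi)^-1 :> R.
  by rewrite /c2pi -expr2 exprVn sqr_sqrtr// mulr_ge0// pi_ge0.
rewrite !(mulrA c2pi c2pi) c2; move: (2 * pi) => q.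
by rewrite !exprMn !exprVn mulrDr.
Qed.

(** Young's inequality for the cross term 2 a (d + r). The loss in a^2 is relative, so after
    integration it remains a small multiple of the main term. *)
Lemma component_compare {R} (eta a d r : R) : 0 < eta ->
  `|(a + (d + r)) ^+ 2 - a ^+ 2| <= eta * a ^+ 2 + (1 + eta^-1) * (2 * (d ^+ 2 + r ^+ 2)).
Proof.
move=> e0; have i0 : 0 < eta^-1 by rewrite invr_gt0.
have ei : eta * eta^-1 = 1 by rewrite mulfV// gt_eqF.
have h1 : (d + r) ^+ 2 <= 2 * (d ^+ 2 + r ^+ 2) by have := sqr_ge0 (d - r); lra.
have h3 : (1 + eta^-1) * (d + r) ^+ 2 <= (1 + eta^-1) * (2 * (d ^+ 2 + r ^+ 2)).
  by apply: ler_wpM2l => //; lra.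
apply: le_trans (lerD (lexx _) h3); move: (d + r) => e.
have h4 : `|2 * (a * e)| <= eta * a ^+ 2 + eta^-1 * e ^+ 2.
  have p1 : 0 <= eta * (a - eta^-1 * e) ^+ 2 by rewrite mulr_ge0 ?sqr_ge0// ltW.
  have p2 : 0 <= eta * (a + eta^-1 * e) ^+ 2 by rewrite mulr_ge0 ?sqr_ge0// ltW.
  have q1 : eta * (a - eta^-1 * e) ^+ 2 = eta * a ^+ 2 + eta^-1 * e ^+ 2 - 2 * (a * e).
    by field; rewrite gt_eqF.
  have q2 : eta * (a + eta^-1 * e) ^+ 2 = eta * a ^+ 2 + eta^-1 * e ^+ 2 + 2 * (a * e).
    by field; rewrite gt_eqF.
  by rewrite ler_norml; lra.
have -> : (a + e) ^+ 2 - a ^+ 2 = 2 * (a * e) + e ^+ 2 by ring.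
apply: (le_trans (ler_normD _ _)); rewrite (ger0_norm (sqr_ge0 e)).
have -> : (1 + eta^-1) * e ^+ 2 = e ^+ 2 + eta^-1 * e ^+ 2 by ring.
by lra.
Qed.

Lemma continuous_ampint_clamp {R} (m P k yo b : R) :
  0 < m -> m <= P -> 0 <= k -> continuous (fun p => ampint k yo b (clamp m P p)).
Proof.
move=> m0 mP k0; have cq := @continuous_clamp R m P.
have q1 p : m <= clamp m P p by have /andP[] := clamp_itv p mP.
have q0 p : 0 < clamp m P p by exact: lt_le_trans (q1 p).
apply: (@Int_continuous _ _ (fun y => k / m ^+ 2 * expN 1 y)).
- by move=> p; exact: intble_measurable (ampint_intble _ _ (q0 p) k0).
- move=> y; rewrite /phi /amp /dphi; cont => p; rewrite sqrf_eq0 gt_eqF//.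
  exact: lt_le_trans (q0 p) (dphi_ge _ _ k0).
- exact: intble_expN.
- move=> p y; have /andP[a0 a1] := amp_dom y m0 (q1 p) k0.
  by rewrite normrM (ger0_norm a0) (le_trans _ a1)// ler_piMl ?sin_max.
Qed.

Lemma supp_intble {R} (m P : R) (g c : R -> R) : 0 < m -> m <= P ->
  continuous g -> supp_in m P g -> continuous c -> intble (fun p => g p * c p).
Proof.
move=> m0 mP cg gs cc.
have [K gK] : exists K, expdom K (fun p => g p * c p).
  apply: (supp_expdom m0 mP); first exact: cfunM.
  by move=> p gc; apply: gs; apply: contraNneq gc => ->; rewrite mul0r.
by apply: expdom_intble gK; apply: continuous_measurable_fun; exact: cfunM.
Qed.

Definition coef_err {R} (m P b C : R) (g : R -> R) (p : R) : R :=
  g p * (gcoef b (clamp m P p) - C).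

Definition ampint_err {R} (m P yo : R) (s : R) : R :=
  (2 + m ^- 2) * (8 * expR (- (s + yo) / 4) + 4 * P * expR (- (s + yo))).

(** Main term with frozen constants, freezing error and remainder. The remainder comes from
    [ampint_asym] and is measured by the L1 norm of g, whereas the freezing error is kept as a
    Fourier transform, to be measured in L2. *)
Lemma Int_osc_split {R} (m P : R) (g : R -> R) (s yo b C1 C2 : R) :
  0 < m -> m <= P -> continuous g -> supp_in m P g -> intble (ftC g) -> intble (ftS g) ->
  exists r, `|r| <= ampint_err m P yo s * \int[mu]_p `|g p| /\
  - (\int[mu]_y osc g (expR (s + yo)) yo b y) =
    (C1 * \int[mu]_p (g p * sin (p * s + b)) + C2 * \int[mu]_p (g p * cos (p * s + b))) +
    ((\int[mu]_p (coef_err m P 0 C1 g p * sin (p * s + b)) +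
      \int[mu]_p (coef_err m P (- (pi / 2)) C2 g p * cos (p * s + b))) + r).
Proof.
move=> m0 mP cg gs iC iS; have k0 := expR_ge0 (s + yo).
have cq := @continuous_clamp R m P.
have cA := @continuous_ampint_clamp R m P (expR (s + yo)) yo b m0 mP k0.
have c1 := @continuous_gcoef R m P 0 m0 mP.
have c2 := @continuous_gcoef R m P (- (pi / 2)) m0 mP.
have cL : continuous (fun p => ampint_lim s b (clamp m P p)) by rewrite /ampint_lim; cont.
have iA := supp_intble m0 mP cg gs cA.
have iL := supp_intble m0 mP cg gs cL.
have ig := expdom_intble (continuous_measurable_fun cg) (projT2 (cid (supp_expdom m0 mP cg gs))).
have q1 p : m <= clamp m P p by have /andP[] := clamp_itv p mP.
have q2 p : clamp m P p <= P by have /andP[] := clamp_itv p mP.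
rewrite (Int_osc yo b m0 mP k0 cg gs iC iS) opprK.
exists (\int[mu]_p (g p * ampint (expR (s + yo)) yo b (clamp m P p)) -
        \int[mu]_p (g p * ampint_lim s b (clamp m P p))); split.
  rewrite -(IntB iA iL) -(IntZ _ (intble_norm ig)).
  apply: normr_Int_le; [exact: intbleB iA iL|exact: intbleZ (intble_norm ig)|].
  move=> p; rewrite -mulrBr normrM mulrC; apply: ler_wpM2r; first exact: normr_ge0.
  by have := ampint_asym (s + yo) yo b m0 (q1 p) (q2 p); rewrite addrK.
have is1 : intble (fun p => g p * sin (p * s + b)) := intble_sin s b ig.
have ic1 : intble (fun p => g p * cos (p * s + b)) := intble_cos s b ig.
have ih1 : intble (coef_err m P 0 C1 g).
  by apply: (supp_intble m0 mP cg gs); cont.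
have ih2 : intble (coef_err m P (- (pi / 2)) C2 g).
  by apply: (supp_intble m0 mP cg gs); cont.
have is2 := intble_sin s b ih1; have ic2 := intble_cos s b ih2.
have -> : \int[mu]_p (g p * ampint_lim s b (clamp m P p)) =
  (C1 * \int[mu]_p (g p * sin (p * s + b)) + C2 * \int[mu]_p (g p * cos (p * s + b))) +
    (\int[mu]_p (coef_err m P 0 C1 g p * sin (p * s + b)) +
      \int[mu]_p (coef_err m P (- (pi / 2)) C2 g p * cos (p * s + b))).
  rewrite -(IntZ C1 is1) -(IntZ C2 ic1) -(IntD (intbleZ C1 is1) (intbleZ C2 ic1)).
  rewrite -(IntD is2 ic2).
  rewrite -(IntD (intbleD (intbleZ C1 is1) (intbleZ C2 ic1)) (intbleD is2 ic2)).
  apply: eq_Int => p; rewrite /ampint_lim /coef_err.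
  have h1 := supp_clamp (fun q => sin (q * s + b)) p gs.
  have h2 := supp_clamp (fun q => cos (q * s + b)) p gs.
  rewrite mulrDr !mulrA h1 h2; ring.
by move: (\int[mu]_p (g p * ampint _ _ _ _)) => I; ring.
Qed.

Definition ftE {R} (g : R -> R) (s : R) : R := ftC g s ^+ 2 + ftS g s ^+ 2.

(** Between the two offsets (S, C) turns by a quarter, and (C1 S + C2 C)^2 + (C2 S - C1 C)^2 = (C1^2
    + C2^2)(C^2 + S^2). So the cross terms cancel and the main part is a multiple of the energy of
    g. *)
Lemma split_bound {R} (eta C1 C2 C S C' S' C'' S'' r0 r1 B0 B1 E : R) :
  0 < eta -> `|r0| <= E -> `|r1| <= E ->
  - B0 = (C1 * S + C2 * C) + ((S' + C'') + r0) ->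
  - B1 = (C1 * - C + C2 * S) + ((- C' + S'') + r1) ->
  `|B0 ^+ 2 + B1 ^+ 2 - (C1 ^+ 2 + C2 ^+ 2) * (C ^+ 2 + S ^+ 2)| <=
   eta * ((C1 ^+ 2 + C2 ^+ 2) * (C ^+ 2 + S ^+ 2)) +
   (1 + eta^-1) * (4 * (C' ^+ 2 + S' ^+ 2) + 4 * (C'' ^+ 2 + S'' ^+ 2) + 4 * E ^+ 2).
Proof.
move=> e0 hr0 hr1 E0 E1.
rewrite -(sqrrN B0) -(sqrrN B1) E0 E1.
have sq r : `|r| <= E -> r ^+ 2 <= E ^+ 2.
  move=> h; rewrite -(real_normK (num_real r)) lerXn2r ?nnegrE//.
  exact: le_trans (normr_ge0 _) h.
have h0 := sq _ hr0; have h1 := sq _ hr1.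
have -> : (C1 ^+ 2 + C2 ^+ 2) * (C ^+ 2 + S ^+ 2) =
  (C1 * S + C2 * C) ^+ 2 + (C1 * - C + C2 * S) ^+ 2 by ring.
have k0 := component_compare (C1 * S + C2 * C) (S' + C'') r0 e0.
have k1 := component_compare (C1 * - C + C2 * S) (- C' + S'') r1 e0.
have i0 : 0 <= 1 + eta^-1 by rewrite addr_ge0// invr_ge0 ltW.
move: (C1 * S + C2 * C) (C1 * - C + C2 * S) k0 k1 => a0 a1 k0 k1.
rewrite opprD addrACA; apply: (le_trans (ler_normD _ _)).
apply: (le_trans (lerD k0 k1)); rewrite addrACA -mulrDr lerD2l -mulrDr ler_wpM2l//.
have := sqr_ge0 (S' - C''); have := sqr_ge0 (C' + S'').
have -> : (S' - C'') ^+ 2 = S' ^+ 2 - 2 * (S' * C'') + C'' ^+ 2 by ring.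
have -> : (C' + S'') ^+ 2 = C' ^+ 2 + 2 * (C' * S'') + S'' ^+ 2 by ring.
have -> : (S' + C'') ^+ 2 = S' ^+ 2 + 2 * (S' * C'') + C'' ^+ 2 by ring.
have -> : (- C' + S'') ^+ 2 = C' ^+ 2 - 2 * (C' * S'') + S'' ^+ 2 by ring.
move: (S' ^+ 2) (C'' ^+ 2) (C' ^+ 2) (S'' ^+ 2) (S' * C'') (C' * S'') h0 h1 => a b c d e f.
move: (r0 ^+ 2) (r1 ^+ 2) (E ^+ 2) => x y z.
lra.
Qed.

Lemma ampint_err_half {R} (m P yo s : R) : 0 < P -> 0 <= s ->
  0 <= ampint_err m P yo s <= ampint_err m P yo 0 * expN 4^-1 s.
Proof.
move=> P0 s0; have mV : 0 <= 2 + m ^- 2 by rewrite addr_ge0// invr_ge0 sqr_ge0.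
rewrite /ampint_err add0r; apply/andP; split.
  by apply: mulr_ge0 => //; rewrite addr_ge0// !mulr_ge0 ?expR_ge0// ltW.
rewrite -[leRHS]mulrA ler_wpM2l// [leRHS]mulrDl; apply: lerD; rewrite -[leRHS]mulrA; apply: ler_wpM2l => //.
- by rewrite /expN (ger0_norm s0) -expRD ler_expR; lra.
- by rewrite mulr_ge0// ltW.
- by rewrite /expN (ger0_norm s0) -expRD ler_expR; lra.
Qed.

Lemma spec_approx {R} (m P : R) (g : R -> R) (s yo C1 C2 eta : R) :
  0 < m -> m <= P -> continuous g -> supp_in m P g -> intble (ftC g) -> intble (ftS g) ->
  0 < eta -> 0 <= s ->
  `|spec g yo (expR (s + yo)) - (C1 ^+ 2 + C2 ^+ 2) * ftE g s| <=
   eta * ((C1 ^+ 2 + C2 ^+ 2) * ftE g s) + (1 + eta^-1) *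
   (4 * ftE (coef_err m P 0 C1 g) s + 4 * ftE (coef_err m P (- (pi / 2)) C2 g) s +
    4 * (ampint_err m P yo 0 * \int[mu]_p `|g p|) ^+ 2 * expN 2^-1 s).
Proof.
move=> m0 mP cg gs iC iS e0 s0; have P0 := lt_le_trans m0 mP.
have [r0 [R0 E0]] := Int_osc_split s yo 0 C1 C2 m0 mP cg gs iC iS.
have [r1 [R1 E1]] := Int_osc_split s yo (- (pi / 2)) C1 C2 m0 mP cg gs iC iS.
have G0 : 0 <= \int[mu]_p `|g p|.
  by apply: Rintegral_ge0 => x _; exact: normr_ge0.
have /andP[e1 e2] := ampint_err_half m yo P0 s0.
have RE (r : R) : `|r| <= ampint_err m P yo s * \int[mu]_p `|g p| ->
    `|r| <= (ampint_err m P yo 0 * \int[mu]_p `|g p|) * expN 4^-1 s.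
  by move=> h; apply: (le_trans h); rewrite [leRHS]mulrAC; apply: ler_wpM2r.
have ex : expN 2^-1 s = expN 4^-1 s ^+ 2.
  by rewrite /expN -expRM_natl; congr expR; field.
rewrite ex -[X in _ + (1 + _) * (_ + X)]mulrA -[X in _ + 4 * X]exprMn.
have V0 (f : R -> R) : \int[mu]_p (f p * sin (p * s + 0)) = ftS f s.
  by apply: eq_Int => p; rewrite addr0.
have W0 (f : R -> R) : \int[mu]_p (f p * cos (p * s + 0)) = ftC f s.
  by apply: eq_Int => p; rewrite addr0.
have V1 (f : R -> R) : intble f -> \int[mu]_p (f p * sin (p * s - pi / 2)) = - ftC f s.
  move=> fi; rewrite /ftC -(IntN (intble_cos0 s fi)).
  by apply: eq_Int => p; rewrite sinBpihalf mulrN.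
have W1 (f : R -> R) : \int[mu]_p (f p * cos (p * s - pi / 2)) = ftS f s.
  by apply: eq_Int => p; rewrite cosBpihalf.
have cg1 : continuous (fun p => gcoef 0 (clamp m P p) - C1).
  by have := @continuous_gcoef R m P 0 m0 mP => c; cont.
have ig := expdom_intble (continuous_measurable_fun cg) (projT2 (cid (supp_expdom m0 mP cg gs))).
have ih : intble (coef_err m P 0 C1 g) := supp_intble m0 mP cg gs cg1.
rewrite !V0 !W0 in E0; rewrite (V1 _ ig) (V1 _ ih) !W1 in E1.
exact: (split_bound e0 (RE _ R0) (RE _ R1) E0 E1).
Qed.

(** By [Bessel], since the transforms of [coef_err] are not known to be integrable. *)
Lemma coef_err_energy {R} (m P b C eta : R) (g : R -> R) :
  0 < m -> m <= P -> continuous g -> supp_in m P g -> 0 < eta ->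
  (forall p, g p != 0 -> `|gcoef b p - C| <= eta) ->
  intble (ftE (coef_err m P b C g)) /\
  \int[mu]_s ftE (coef_err m P b C g) s <= 2 * pi * (eta ^+ 2 * \int[mu]_p g p ^+ 2).
Proof.
move=> m0 mP cg gs e0 hb; have [K gK] := supp_expdom m0 mP cg gs.
have cG := @continuous_gcoef R m P b m0 mP.
have ce : continuous (coef_err m P b C g) by rewrite /coef_err; cont.
have es : supp_in m P (coef_err m P b C g).
  by move=> p; rewrite /coef_err => gc; apply: gs; apply: contraNneq gc => ->; rewrite mul0r.
have [K' eK] := supp_expdom m0 mP ce es.
have [i1 i2] := Bessel (continuous_measurable_fun ce) eK.
split; first exact: i1.
apply: (le_trans i2); apply: ler_wpM2l; first by rewrite mulr_ge0// pi_ge0.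
have ig2 : intble (fun p => g p ^+ 2) := supp_intble m0 mP cg gs cg.
rewrite -(IntZ _ ig2); apply: le_Int; [exact: (supp_intble m0 mP ce es ce)|exact: intbleZ|].
move=> p; rewrite /coef_err; have [->|gp] := eqVneq (g p) 0.
  by rewrite mul0r expr0n/= mulr0.
have /andP[h1 h2] := gs p gp.
have -> : clamp m P p = p by rewrite /clamp min_l// max_r.
rewrite exprMn mulrC ler_wpM2r ?sqr_ge0//.
rewrite -(real_normK (num_real (gcoef b p - C))) lerXn2r ?nnegrE ?(ltW e0)//.
exact: hb.
Qed.

Lemma ftC_even {R} (g : R -> R) (s : R) : ftC g (- s) = ftC g s.
Proof. by apply: eq_Int => p; rewrite mulrN cosN. Qed.

Lemma ftS_odd {R} (g : R -> R) (s : R) : intble g -> ftS g (- s) = - ftS g s.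
Proof.
move=> ig; rewrite /ftS -(IntN (intble_sin0 s ig)).
by apply: eq_Int => p; rewrite mulrN sinN mulrN.
Qed.

Lemma ftE_ge0 {R} (g : R -> R) (s : R) : 0 <= ftE g s.
Proof. by rewrite addr_ge0 ?sqr_ge0. Qed.

(** [spec_approx] integrated over s >= 0. The constant 16 pi is two times 4 times the Bessel
    constant 2 pi; the other 16 is 4 times the mass 4 of [expN 2^-1]. *)
Lemma spec_energy {R} (m P : R) (g : R -> R) (yo C1 C2 eta : R) :
  0 < m -> m <= P -> continuous g -> supp_in m P g -> intble (ftC g) -> intble (ftS g) ->
  0 < eta ->
  (forall p, g p != 0 -> `|gcoef 0 p - C1| <= eta /\ `|gcoef (- (pi / 2)) p - C2| <= eta) ->
  exists I, (\int[mu]_(s in `[0%R, +oo[) (spec g yo (expR (s + yo)))%:E = I%:E)%E /\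
    `|I - (C1 ^+ 2 + C2 ^+ 2) * (pi * \int[mu]_p g p ^+ 2)| <=
    eta * ((C1 ^+ 2 + C2 ^+ 2) * (pi * \int[mu]_p g p ^+ 2)) +
    (1 + eta^-1) * (16 * pi * (eta ^+ 2 * \int[mu]_p g p ^+ 2) +
      16 * (ampint_err m P yo 0 * \int[mu]_p `|g p|) ^+ 2).
Proof.
move=> m0 mP cg gs iC iS e0 hb; have [K gK] := supp_expdom m0 mP cg gs.
have mg := continuous_measurable_fun cg; have ig := expdom_intble mg gK.
have [e1 b1] := coef_err_energy m0 mP cg gs e0 (fun p h => (hb p h).1).
have [e2 b2] := coef_err_energy m0 mP cg gs e0 (fun p h => (hb p h).2).
have [iE _] := Bessel mg gK; have EE := Plancherel cg gK iC iS.
have h2 : 0 < 2^-1 :> R by rewrite invr_gt0.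
have [iH EH] := expN_intble h2.
have cs := @continuous_spec R g yo iC iS.
have cC := continuous_ftC ig; have cS := continuous_ftS ig.
pose X := 4 * (ampint_err m P yo 0 * \int[mu]_p `|g p|) ^+ 2.
pose Z s := (1 + eta^-1) * (4 * ftE (coef_err m P 0 C1 g) s +
    4 * ftE (coef_err m P (- (pi / 2)) C2 g) s + X * expN 2^-1 s).
have i0 : 0 <= 1 + eta^-1 by rewrite addr_ge0// invr_ge0 ltW.
have X0 : 0 <= X by rewrite mulr_ge0// sqr_ge0.
have i12 := intbleD (intbleZ 4 e1) (intbleZ 4 e2).
have i123 := intbleD i12 (intbleZ X iH).
have iZ : intble Z := intbleZ (1 + eta^-1) i123.
have Z0 s : 0 <= Z s.
  apply: mulr_ge0 => //; apply: addr_ge0; last by apply: mulr_ge0 => //; exact: expN_ge0.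
  by apply: addr_ge0; apply: mulr_ge0 => //; exact: ftE_ge0.
have mQ : measurable_fun setT (fun s : R => spec g yo (expR (s + yo))).
  by apply: continuous_measurable_fun; apply: (cfun_comp cs); cont.
have cE : continuous (ftE g) by rewrite /ftE; cont.
have EN s : ftE g (- s) = ftE g s by rewrite /ftE ftC_even (ftS_odd s ig) sqrrN.
have [I [I1 I2]] := half_line_bound mQ cE (ftE_ge0 g) EN iE iZ Z0
  (fun s s0 => spec_approx yo C1 C2 m0 mP cg gs iC iS e0 s0).
exists I; split; first exact: I1.
have E1 : (C1 ^+ 2 + C2 ^+ 2) / 2 * \int[mu]_s ftE g s =
    (C1 ^+ 2 + C2 ^+ 2) * (pi * \int[mu]_p g p ^+ 2).
  by rewrite EE; field.
rewrite E1 in I2; apply: (le_trans I2); rewrite lerD2l.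
rewrite /Z (IntZ _ i123) (IntD i12 (intbleZ X iH)) (IntD (intbleZ 4 e1) (intbleZ 4 e2)).
rewrite (IntZ 4 e1) (IntZ 4 e2) (IntZ X iH) EH invrK.
apply: ler_wpM2l => //; apply: lerD; last first.
  by rewrite /X; move: ((_ * _) ^+ 2) => x; rewrite le_eqVlt; apply/orP; left; apply/eqP; ring.
move: b1 b2; move: (eta ^+ 2 * _) => x; move: (\int[mu]_s ftE _ s) (\int[mu]_s ftE _ s) => y z.
rewrite -[2 * pi * x]mulrA -[16 * pi * x]mulrA; move: (pi * x) => q; lra.
Qed.

Lemma Int_osc_bd {R} (m P : R) (g : R -> R) (k yo b : R) :
  0 < m -> m <= P -> 0 <= k -> continuous g -> supp_in m P g ->
  intble (ftC g) -> intble (ftS g) ->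
  `|\int[mu]_y osc g k yo b y| <= 2 * k / m ^+ 2 * \int[mu]_p `|g p|.
Proof.
move=> m0 mP k0 cg gs iC iS; have [K gK] := supp_expdom m0 mP cg gs.
have ig := expdom_intble (continuous_measurable_fun cg) gK.
rewrite (Int_osc yo b m0 mP k0 cg gs iC iS) normrN -(IntZ _ (intble_norm ig)).
have cA := @continuous_ampint_clamp R m P k yo b m0 mP k0.
apply: normr_Int_le; [exact: supp_intble m0 mP cg gs cA|exact: intbleZ (intble_norm ig)|].
move=> p; have /andP[q1 _] := clamp_itv p mP.
rewrite normrM mulrC; apply: ler_wpM2r; first exact: normr_ge0.
exact: ampint_bd.
Qed.

(** The transform is O(k), because [amp] carries a factor k; its square outweighs the singular 1 /
    (2k) at k = 0. *)
Lemma spec_bd {R} (m P : R) (g : R -> R) (k yo : R) :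
  0 < m -> m <= P -> 0 < k -> continuous g -> supp_in m P g ->
  intble (ftC g) -> intble (ftS g) ->
  0 <= spec g yo k / (2 * k) <= 4 * k * (\int[mu]_p `|g p| / m ^+ 2) ^+ 2.
Proof.
move=> m0 mP k0 cg gs iC iS.
have h b := Int_osc_bd yo b m0 mP (ltW k0) cg gs iC iS.
have k2 : 0 < 2 * k by rewrite mulr_gt0.
rewrite divr_ge0 ?spec_ge0 ?(ltW k2)//= ler_pdivrMr//.
have sq b : (\int[mu]_y osc g k yo b y) ^+ 2 <= (2 * k / m ^+ 2 * \int[mu]_p `|g p|) ^+ 2.
  rewrite -(real_normK (num_real (\int[mu]_y osc g k yo b y))) lerXn2r ?nnegrE//.
  exact: le_trans (normr_ge0 _) (h b).
apply: (le_trans (lerD (sq 0) (sq (- (pi / 2))))).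
rewrite le_eqVlt; apply/orP; left; apply/eqP.
by move: (\int[mu]_p `|g p|) (m ^+ 2) => G q; ring.
Qed.

(** The momenta are cut at k = e^yo, that is s = 0: above, [spec_energy] after the logarithmic
    substitution; below, [spec_bd] on an interval of length e^yo, which gives the last summand. *)
Lemma Nbar_bound {R} (m P : R) (g : R -> R) (yo C1 C2 eta : R) :
  0 < m -> m <= P -> continuous g -> supp_in m P g -> intble (ftC g) -> intble (ftS g) ->
  0 < eta ->
  (forall p, g p != 0 -> `|gcoef 0 p - C1| <= eta /\ `|gcoef (- (pi / 2)) p - C2| <= eta) ->
  let G1 := \int[mu]_p `|g p| in let G2 := \int[mu]_p g p ^+ 2 in
  exists N, Nbar (wp_shift (fun y => c2pi * ftC g y) yo)
                 (wp_shift (fun y => c2pi * ftS g y) yo) = N%:E /\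
   `|N - (2 * pi) ^- 2 / 2 * ((C1 ^+ 2 + C2 ^+ 2) * (pi * G2))| <=
    (2 * pi) ^- 2 / 2 * (eta * ((C1 ^+ 2 + C2 ^+ 2) * (pi * G2)) +
    (1 + eta^-1) * (16 * pi * (eta ^+ 2 * G2) + 16 * (ampint_err m P yo 0 * G1) ^+ 2)) +
    (2 * pi) ^- 2 * (4 * expR yo ^+ 2 * (G1 / m ^+ 2) ^+ 2).
Proof.
move=> m0 mP cg gs iC iS e0 hb G1 G2.
have [I [I1 I2]] := spec_energy yo m0 mP cg gs iC iS e0 hb.
have cs := @continuous_spec R g yo iC iS; have ms := continuous_measurable_fun cs.
set c := (2 * pi) ^- 2 : R; have c0 : 0 <= c by rewrite invr_ge0 sqr_ge0.
set K := expR yo; have K0 : 0 < K := expR_gt0 yo.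
pose f k := c * (spec g yo k / (2 * k)).
have mf : measurable_fun setT f by rewrite /f; meas.
pose D1 : set (measurableTypeR R) := `]0, K[%classic.
pose D2 : set (measurableTypeR R) := `[K, +oo[%classic.
have mD1 : measurable D1 by exact: measurable_itv.
have mD2 : measurable D2 by exact: measurable_itv.
have f0 k : 0 < k -> 0 <= f k.
  by move=> k0; have /andP[h _] := spec_bd yo m0 mP k0 cg gs iC iS; rewrite mulr_ge0.
have EN : Nbar (wp_shift (fun y => c2pi * ftC g y) yo)
    (wp_shift (fun y => c2pi * ftS g y) yo) =
    (\int[mu]_(k in D1) (f k)%:E + \int[mu]_(k in D2) (f k)%:E)%E.
  rewrite -ge0_integral_setU//.
  - rewrite /Nbar (_ : [set k | 0 < k] = D1 `|` D2).
      by apply: eq_integral => k _; rewrite fcheckE// -/c -mulrA.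
    rewrite /D1 /D2; apply/seteqP; split => k /=; rewrite !in_itv/= andbT.
      by move=> k0; have [kK|kK] := ltP k K; [left|right]; rewrite ?k0.
    by move=> [/andP[]//|]; exact: lt_le_trans.
  - by apply/measurable_EFinP; exact: (measurable_funS measurableT _ mf).
  - move=> k; rewrite /D1/D2/= !in_itv/= andbT lee_fin => -[/andP[k0 _]|k0]; apply: f0 => //.
    exact: lt_le_trans k0.
  - rewrite /D1 /D2; apply/disj_setPS => k [] /=; rewrite !in_itv/= andbT => /andP[_ kK] Kk.
    by have := lt_le_trans kK Kk; rewrite ltxx.
have E2 : (\int[mu]_(k in D2) (f k)%:E = (c / 2 * I)%:E)%E.
  have cG : continuous (fun s : R => spec g yo (expR (s + yo))) by apply: (cfun_comp cs); cont.
  have := log_substitution yo cG (fun s => spec_ge0 _ _ _); rewrite I1 EFinM => ->.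
  rewrite -ge0_integralZl//; last first.
  - by rewrite lee_fin divr_ge0.
  - move=> k; rewrite /= in_itv/= andbT => Kk; have k0 := lt_le_trans K0 Kk.
    by rewrite lee_fin divr_ge0 ?spec_ge0// ltW.
  - apply/measurable_EFinP; apply: (@measurable_funS _ _ _ _ setT) => //.
    have ? : measurable_fun setT (fun k : R => spec g yo (expR (ln k - yo + yo))).
      by apply: (mfun_comp ms); meas.
    by meas.
  - rewrite /D2; apply: eq_integral => k; rewrite inE/= in_itv/= andbT => Kk; have k0 := lt_le_trans K0 Kk.
    rewrite -EFinM subrK lnK ?posrE// /f; congr EFin; field; by rewrite gt_eqF.
pose B := 4 * K * (G1 / m ^+ 2) ^+ 2.
have B0 : 0 <= B by rewrite mulr_ge0 ?sqr_ge0// mulr_ge0// ltW.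
have E1 : (0 <= \int[mu]_(k in D1) (f k)%:E <= (c * (4 * K ^+ 2 * (G1 / m ^+ 2) ^+ 2))%:E)%E.
  apply/andP; split.
    by apply: integral_ge0 => k; rewrite /D1/= in_itv/= lee_fin => /andP[k0 _]; exact: f0.
  apply: (@le_trans _ _ (\int[mu]_(k in D1) (cst (c * B)%:E k))%E).
    apply: ge0_le_integral => //.
    - by move=> k; rewrite /D1/= in_itv/= lee_fin => /andP[k0 _]; exact: f0.
    - by apply/measurable_EFinP; exact: (measurable_funS measurableT _ mf).
    - move=> k; rewrite /D1/= in_itv/= lee_fin => /andP[k0 kK]; apply: ler_wpM2l => //.
      have /andP[_ h] := spec_bd yo m0 mP k0 cg gs iC iS; apply: (le_trans h).
      by rewrite /B ler_wpM2r ?sqr_ge0// ler_wpM2l// ltW.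
  have mu1 : (@lebesgue_measure R) D1 = K%:E.
    by rewrite /D1 lebesgue_measure_itv/= lte_fin K0 sube0.
  rewrite integral_cst//.
  rewrite [X in (_ * X <= _)%E](_ : _ = K%:E); last exact: mu1.
  rewrite -EFinM lee_fin.
  rewrite le_eqVlt; apply/orP; left; apply/eqP.
  by rewrite /B; move: (_ ^+ 2) => x; ring.
move: E1 EN; case: (\int[mu]_(k in D1) (f k)%:E)%E => [r| |]; last first.
- by move=> /andP[].
- by move=> /andP[_]; rewrite leye_eq.
move=> /andP[]; rewrite !lee_fin => r0 r1; rewrite E2 -EFinD => EN.
exists (r + c / 2 * I); split; first exact: EN.
rewrite [X in `|X|](_ : _ = c / 2 * (I - (C1 ^+ 2 + C2 ^+ 2) * (pi * G2)) + r); last by ring.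
apply: (le_trans (ler_normD _ _)); apply: lerD; last by rewrite ger0_norm.
have c2 : 0 <= c / 2 by rewrite divr_ge0.
by rewrite normrM (ger0_norm c2); apply: ler_wpM2l.
Qed.

Lemma eq_oppr0 {R} (x : R) : x = - x -> x = 0.
Proof. by move=> h; lra. Qed.

Lemma Int_odd {R} (f : R -> R) :
  continuous f -> intble f -> (forall x, f (- x) = - f x) -> \int[mu]_x f x = 0.
Proof.
move=> cf fi fN; have h := Int_truncate fi.
have E (n : nat) : \int[mu]_(x in `[- n%:R, n%:R]) f x = 0.
  have n0 : - n%:R <= n%:R :> R by rewrite (le_trans _ (ler0n R n))// oppr_le0.
  have cf' : {within `[(- n%:R), (- - n%:R)], continuous f} by exact: continuous_subspaceT.
  have := integration_by_substitution_oppr n0 cf'; rewrite opprK => h1.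
  have fi' : mu.-integrable `[- n%:R, n%:R] (EFin \o f).
    by apply: (integrableS measurableT _ _ fi) => //; exact: measurable_itv.
  have : \int[mu]_(x in `[- n%:R, n%:R]) f x = - \int[mu]_(x in `[- n%:R, n%:R]) f x.
    have mI : measurable (`[- n%:R, n%:R]%classic : set (measurableTypeR R)).
      exact: measurable_itv.
    rewrite -[RHS]mulN1r; apply: etrans (RintegralZl (-1) mI fi').
    rewrite /Rintegral h1; congr fine.
    by apply: eq_integral => x _ /=; rewrite fN mulN1r.
  exact: eq_oppr0.
apply: (@cvg_unique _ _ _ _ _ _ h) => //.
by rewrite (_ : (fun n => _) = (fun=> 0)); [exact: cvg_cst|apply/funext => n; exact: E].
Qed.

(** Translation by yo multiplies the transform by e^(-ip yo), which the modulus does not see. The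
    rest is inversion; its imaginary part is the integral of an odd function. *)
Lemma fourier_shiftE {R} (K : R) (g : R -> R) (yo p : R) :
  continuous g -> expdom K g -> intble (ftC g) -> intble (ftS g) ->
  let u := wp_shift (fun y => c2pi * ftC g y) yo in
  let v := wp_shift (fun y => c2pi * ftS g y) yo in
  fourier_re u v p ^+ 2 + fourier_im u v p ^+ 2 = g p ^+ 2.
Proof.
move=> cg gK iC iS u v; have ig := expdom_intble (continuous_measurable_fun cg) gK.
have cC := continuous_ftC ig; have cS := continuous_ftS ig.
pose A s := cos (p * s) * ftC g s + sin (p * s) * ftS g s.
pose B s := cos (p * s) * ftS g s - sin (p * s) * ftC g s.
have bdC (f : R -> R) (a : R) : intble f -> intble (fun s => cos (p * s) * f s).
  move=> fi; rewrite (_ : (fun s => _) = (fun s => f s * cos (p * s))).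
    by apply: (@intble_bdM _ 1) => //; [meas|move=> x; exact: cos_max].
  by apply/funext => s; rewrite mulrC.
have bdS (f : R -> R) (a : R) : intble f -> intble (fun s => sin (p * s) * f s).
  move=> fi; rewrite (_ : (fun s => _) = (fun s => f s * sin (p * s))).
    by apply: (@intble_bdM _ 1) => //; [meas|move=> x; exact: sin_max].
  by apply/funext => s; rewrite mulrC.
have iA : intble A := intbleD (bdC _ 0 iC) (bdS _ 0 iS).
have iB : intble B := intbleB (bdC _ 0 iS) (bdS _ 0 iC).
have EA : \int[mu]_s A s = 2 * pi * g p := Fourier_inversion p cg gK iC iS.
have EB : \int[mu]_s B s = 0.
  apply: Int_odd; [by rewrite /B; cont|exact: iB|].
  by move=> s; rewrite /B ftC_even (ftS_odd s ig) (mulrN p s) cosN sinN; ring.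
have c2 : c2pi * (c2pi * (2 * pi)) = 1 :> R.
  rewrite mulrA /c2pi -expr2 exprVn sqr_sqrtr; last by rewrite mulr_ge0// pi_ge0.
  by rewrite mulVf// mulf_neq0// gt_eqF// pi_gt0.
have Ere : fourier_re u v p = c2pi * (c2pi * (cos (p * yo) * (2 * pi * g p))).
  have i1 := intbleB (intbleZ (cos (p * yo)) iA) (intbleZ (- sin (p * yo)) iB).
  have [i2 E2] := Int_shift (- yo) (intbleZ c2pi i1).
  rewrite /fourier_re (_ : (fun y => _) = fun y => c2pi * (cos (p * yo) * A (y - yo) - - sin (p * yo) * B (y - yo))).
    rewrite E2 (IntZ c2pi i1) (IntB (intbleZ (cos (p * yo)) iA) (intbleZ (- sin (p * yo)) iB)).
    by rewrite (IntZ _ iA) (IntZ _ iB) EA EB mulr0 subr0.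
  apply/funext => y; rewrite /u /v /wp_shift /A /B.
  have -> : p * y = p * yo + p * (y - yo) by ring.
  by rewrite cosD sinD; ring.
have Eim : fourier_im u v p = c2pi * (c2pi * (- sin (p * yo) * (2 * pi * g p))).
  have i1 := intbleD (intbleZ (cos (p * yo)) iB) (intbleZ (- sin (p * yo)) iA).
  have [i2 E2] := Int_shift (- yo) (intbleZ c2pi i1).
  rewrite /fourier_im (_ : (fun y => _) = fun y => c2pi * (cos (p * yo) * B (y - yo) + - sin (p * yo) * A (y - yo))).
    rewrite E2 (IntZ c2pi i1) (IntD (intbleZ (cos (p * yo)) iB) (intbleZ (- sin (p * yo)) iA)).
    by rewrite (IntZ _ iA) (IntZ _ iB) EA EB mulr0 add0r.
  apply/funext => y; rewrite /u /v /wp_shift /A /B.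
  have -> : p * y = p * yo + p * (y - yo) by ring.
  by rewrite cosD sinD; ring.
have alg (x : R) : c2pi * (c2pi * (x * (2 * pi * g p))) = x * g p.
  transitivity (c2pi * (c2pi * (2 * pi)) * (x * g p)); first by ring.
  by rewrite c2 mul1r.
by rewrite Ere Eim !alg !exprMn sqrrN -mulrDl cos2Dsin2 mul1r.
Qed.

(** * The packets and the limit delta -> 0 *)

Lemma cvge_of_approx {R} (F : R -> \bar R) (t : R) :
  (forall e, 0 < e -> \forall d \near 0^'+, exists N, F d = N%:E /\ `|N - t| <= e) ->
  F d @[d --> 0^'+] --> t%:E.
Proof.
move=> h; apply/fine_cvgP; split.
  by apply: filterS (h _ ltr01) => d [N [-> _]].
apply/cvgrPdist_le => e e0; apply: filterS (h _ e0) => d [N [E1 E2]].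
by rewrite /= E1 /= distrC.
Qed.

Lemma packet_continuous {R} (po d : R) (Delta : R -> R) :
  0 < d -> d <= po / 2 -> wp_conditions po d Delta ->
  continuous (wp_tilde Delta po).
Proof. move=> d0 dpo wp; set g := wp_tilde Delta po. by have [_ [_ [[r [/(_ 0%N (leq0n r))]]]]] := wp. Qed.

Lemma packet_near {R} (po d : R) (Delta : R -> R) (p : R) :
  0 < d -> d <= po / 2 -> wp_conditions po d Delta ->
  wp_tilde Delta po p != 0 -> `|p - po| < d.
Proof.
move=> d0 dpo wp; set g := wp_tilde Delta po.
move=> gp; have [_ [sD _]] := wp.
have : Delta (p - po) != 0.
  by apply: contraNneq gp => D0; rewrite /g /wp_tilde D0 mulr0.
by move=> /sD; rewrite ltr_norml.
Qed.

(** The condition d <= po / 2 keeps the support away from p = 0, where 1 / p and the bounds on the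
    coefficients blow up. *)
Lemma packet_supp {R} (po d : R) (Delta : R -> R) :
  0 < d -> d <= po / 2 -> wp_conditions po d Delta ->
  supp_in (po / 2) (2 * po) (wp_tilde Delta po).
Proof.
move=> d0 dpo wp; set g := wp_tilde Delta po.
move=> p gp; have := packet_near d0 dpo wp gp; rewrite ltr_norml => /andP[h1 h2].
by apply/andP; split; lra.
Qed.

(** For p <= 0 both sides are 0, [Delta] vanishing there since d <= po / 2. The quotient is the
    density in which both the normalisation and the thermal integrand are written. *)
Lemma packet_sqr {R} (po d : R) (Delta : R -> R) (p : R) :
  0 < d -> d <= po / 2 -> wp_conditions po d Delta ->
  Delta (p - po) ^+ 2 = wp_tilde Delta po p ^+ 2 / (2 * p).
Proof.
move=> d0 dpo wp; set g := wp_tilde Delta po.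
have [_ [sD _]] := wp; have [p0|p0] := ltP 0 p.
  rewrite /g /wp_tilde /heaviside (ltW p0) mul1r exprMn sqr_sqrtr ?mulr_ge0//.
  by rewrite gtr0_norm//; field; rewrite gt_eqF.
have D0 : Delta (p - po) = 0.
  by apply/eqP; apply/negPn/negP => /sD/andP[h1 h2]; lra.
by rewrite /g /wp_tilde D0 mulr0 expr0n/= mul0r.
Qed.

Lemma packet_mass {R} (po d : R) (Delta : R -> R) :
  0 < d -> d <= po / 2 -> wp_conditions po d Delta ->
  intble (fun p => wp_tilde Delta po p ^+ 2 / (2 * p)) /\
  \int[mu]_p (wp_tilde Delta po p ^+ 2 / (2 * p)) = 1.
Proof.
move=> d0 dpo wp; set g := wp_tilde Delta po.
have mg := continuous_measurable_fun (packet_continuous d0 dpo wp).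
have [D1 _] := wp.
(* [Delta] itself is not assumed measurable; its square is, being this expression in the continuous
   packet. *)
pose h q := g (q + po) ^+ 2 / (2 * (q + po)).
have mh : measurable_fun setT h.
  by have ? := measurable_shift po mg; rewrite /h; meas.
have hE : (\int[mu]_q (h q)%:E = 1)%E.
  rewrite -D1; apply: eq_integral => q _; congr EFin.
  by rewrite real_normK ?num_real// /h -(packet_sqr _ d0 dpo wp) addrK.
have h0 q : 0 <= h q by rewrite /h -(packet_sqr _ d0 dpo wp) sqr_ge0.
have ih : intble h.
  apply/integrableP; split; first exact/measurable_EFinP.
  rewrite (_ : (\int[mu]_q `|(EFin \o h) q| = 1)%E) ?ltry// -hE.
  by apply: eq_integral => q _ /=; rewrite ger0_norm.
have [i1 E1] := Int_shift (- po) ih.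
rewrite (_ : (fun p => g p ^+ 2 / (2 * p)) = (fun p => h (p - po))).
  by split; [exact: i1|rewrite E1 /Rintegral hE].
by apply/funext => p; rewrite /h subrK.
Qed.

Lemma packet_intble {R} (po d : R) (Delta : R -> R) :
  0 < d -> d <= po / 2 -> wp_conditions po d Delta ->
  intble (ftC (wp_tilde Delta po)) /\ intble (ftS (wp_tilde Delta po)).
Proof.
move=> d0 dpo wp; set g := wp_tilde Delta po.
have [_ [_ [_ [_ [iu [iv _]]]]]] := wp.
have c0 : c2pi != 0 :> R.
  by rewrite invr_neq0// gt_eqF// sqrtr_gt0 mulr_gt0// pi_gt0.
split; [move: (intbleZ c2pi^-1 iu)|move: (intbleZ c2pi^-1 iv)];
  congr (lebesgue_measure.-integrable _ (EFin \o _)); apply/funext => y;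
  by rewrite /wp_re /wp_im /invF_re /invF_im mulrA mulVf// mul1r.
Qed.

(** On the support 2 p differs from 2 po by at most 2 d, and the density g^2 / (2p) has mass 1. *)
Lemma packet_energy {R} (po d : R) (Delta : R -> R) :
  0 < d -> d <= po / 2 -> wp_conditions po d Delta ->
  `|\int[mu]_p wp_tilde Delta po p ^+ 2 - 2 * po| <= 2 * d.
Proof.
move=> d0 dpo wp; set g := wp_tilde Delta po.
have [ih Eh] := (packet_mass d0 dpo wp); have m0 : 0 < po / 2 by lra.
have mP : po / 2 <= 2 * po by lra.
have ig2 : intble (fun p => g p ^+ 2) := supp_intble m0 mP (packet_continuous d0 dpo wp) (packet_supp d0 dpo wp) (packet_continuous d0 dpo wp).
have E1 : 2 * po = \int[mu]_p (2 * po * (g p ^+ 2 / (2 * p))) by rewrite (IntZ _ ih) Eh mulr1.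
have E2 : 2 * d = \int[mu]_p (2 * d * (g p ^+ 2 / (2 * p))) by rewrite (IntZ _ ih) Eh mulr1.
rewrite E1 E2 -(IntB ig2 (intbleZ (2 * po) ih)).
apply: normr_Int_le; [exact: intbleB ig2 (intbleZ _ ih)|exact: intbleZ|].
move=> p; rewrite -/g; have [->|gp] := eqVneq (g p) 0.
  by rewrite expr0n/= mul0r !mulr0 subrr normr0.
have h := packet_near d0 dpo wp gp; have /andP[p1 _] := packet_supp d0 dpo wp gp; have p0 : 0 < p by lra.
have -> : g p ^+ 2 - 2 * po * (g p ^+ 2 / (2 * p)) =
  2 * (p - po) * (g p ^+ 2 / (2 * p)) by field; rewrite gt_eqF.
rewrite -(packet_sqr _ d0 dpo wp) normrM (ger0_norm (sqr_ge0 _)) ler_wpM2r ?sqr_ge0//.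
by rewrite normrM (@ger0_norm _ 2)// ler_wpM2l// ltW.
Qed.

(** Cauchy-Schwarz in the form |g| <= 1 / (2t) + t g^2 / 2 on an interval of length 2 d, with t =
    sqrt(d): the two integrals are t and at most 2 po t. *)
Lemma packet_L1 {R} (po d : R) (Delta : R -> R) :
  0 < d -> d <= po / 2 -> wp_conditions po d Delta ->
  (\int[mu]_p `|wp_tilde Delta po p|) ^+ 2 <= d * (1 + 2 * po) ^+ 2.
Proof.
move=> d0 dpo wp; set g := wp_tilde Delta po.
have m0 : 0 < po / 2 by lra.
have mP : po / 2 <= 2 * po by lra.
have ig2 : intble (fun p => g p ^+ 2) := supp_intble m0 mP (packet_continuous d0 dpo wp) (packet_supp d0 dpo wp) (packet_continuous d0 dpo wp).
have cn : continuous (fun p => `|g p|) by have := (packet_continuous d0 dpo wp); exact: cfun_norm.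
have ign : intble (fun p => `|g p|).
  have [K gK] := supp_expdom m0 mP (packet_continuous d0 dpo wp) (packet_supp d0 dpo wp).
  exact: intble_norm (expdom_intble (continuous_measurable_fun (packet_continuous d0 dpo wp)) gK).
pose t := Num.sqrt d; have t0 : 0 < t by rewrite sqrtr_gt0.
have tt : t ^+ 2 = d by rewrite sqr_sqrtr// ltW.
pose A : set R := `[po - d, po + d]%classic.
have mA : measurable A by exact: measurable_itv.
have EA : (\int[mu]_p (\1_A p)%:E = (2 * d)%:E)%E.
  have muA : (@lebesgue_measure R) A = (2 * d)%:E.
    rewrite /A lebesgue_measure_itv/= lte_fin ifT; last by lra.
    by rewrite -EFinB; congr EFin; ring.
  by rewrite integral_indic// setIT; exact: muA.
have iA : intble (\1_A : R -> R).
  apply/integrableP; split; first by apply/measurable_EFinP; exact: measurable_indic.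
  rewrite (_ : (\int[mu]_p `|(EFin \o \1_A) p| = (2 * d)%:E)%E) ?ltry// -EA.
  by apply: eq_integral => p _ /=; rewrite ger0_norm.
have EA' : \int[mu]_p \1_A p = 2 * d by rewrite /Rintegral EA.
have L1 : \int[mu]_p `|g p| <= t * (1 + 2 * po).
  apply: (@le_trans _ _ (\int[mu]_p ((2 * t)^-1 * \1_A p + t / 2 * g p ^+ 2))).
    apply: le_Int; [exact: ign|exact: intbleD (intbleZ _ iA) (intbleZ _ ig2)|].
    move=> p; have [->|gp] := eqVneq (g p) 0.
      by rewrite normr0 expr0n/= mulr0 addr0 mulr_ge0// invr_ge0 mulr_ge0// ltW.
    have -> : \1_A p = 1 :> R.
      rewrite indicE mem_set// /A/= in_itv/=.
      by have := packet_near d0 dpo wp gp; rewrite ltr_norml => /andP[h1 h2]; apply/andP; split; lra.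
    have -> : g p ^+ 2 = `|g p| ^+ 2 by rewrite real_normK ?num_real.
    rewrite mulr1 -subr_ge0.
    have -> : (2 * t)^-1 + t / 2 * `|g p| ^+ 2 - `|g p| = (2 * t)^-1 * (t * `|g p| - 1) ^+ 2.
      by field; rewrite gt_eqF.
    by rewrite mulr_ge0 ?sqr_ge0// invr_ge0 mulr_ge0// ltW.
  rewrite (IntD (intbleZ _ iA) (intbleZ _ ig2)) (IntZ _ iA) (IntZ _ ig2) EA'.
  have := (packet_energy d0 dpo wp); rewrite ler_norml => /andP[_ h].
  have h2 : \int[mu]_p g p ^+ 2 <= 4 * po by move: h; rewrite -/g; lra.
  have -> : (2 * t)^-1 * (2 * d) = t by rewrite -tt; field; rewrite gt_eqF.
  rewrite mulrDr mulr1 lerD2l -mulrA ler_wpM2l ?(ltW t0)//; lra.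
rewrite -tt -exprMn lerXn2r// nnegrE; last by rewrite mulr_ge0 ?(ltW t0)//; lra.
by apply: Rintegral_ge0 => p _; exact: normr_ge0.
Qed.

Definition planck {R} (p : R) : R := (expR (2 * pi * p) - 1)^-1.

Lemma planck_den {R} (p : R) : 0 < p -> 0 < expR (2 * pi * p) - 1.
Proof.
by move=> p0; rewrite subr_gt0 -[ltLHS](expR0 R) ltr_expR !mulr_gt0// pi_gt0.
Qed.

Lemma near_right_pos {R} (a : R) : 0 < a -> \forall d \near 0^'+, 0 < d /\ d <= a.
Proof. by move=> a0; near=> d; split; near: d; [exact: nbhs_right_gt|exact: nbhs_right_le]. 
Unshelve. all: by end_near. Qed.

Lemma cvg_dist_near {R} (f : R -> R) (a e : R) : 0 < e ->
  f x @[x --> a] --> f a -> exists2 r, 0 < r & forall x, `|x - a| < r -> `|f x - f a| <= e.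
Proof.
move=> e0 fa; have : \forall x \near a, `|f a - f x| <= e.
  by move/cvgrPdist_le : fa; apply.
move=> /nbhs_ballP[r /= r0 h]; exists r => // x xr.
by rewrite distrC; apply: h; rewrite /ball/= distrC.
Qed.

(** The thermal number is the average of the Planck factor against the probability density g^2 /
    (2p), which concentrates at po. *)
Lemma NTh_approx {R} (po : R) (Delta : R -> R -> R) (yo e : R) :
  0 < po -> (forall d, 0 < d <= po -> wp_conditions po d (Delta d)) -> 0 < e ->
  \forall d \near 0^'+, exists T,
    NTh2pi (wp_shift (wp_re (Delta d) po) yo) (wp_shift (wp_im (Delta d) po) yo) = T%:E /\
    `|T - planck po| <= e.
Proof.
move=> po0 hwp e0; have m0 : 0 < po / 2 by lra.
have mP : po / 2 <= 2 * po by lra.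
have cpl : planck x @[x --> po] --> planck po.
  apply: cvgV; first by rewrite gt_eqF// planck_den.
  have h : continuous (fun p : R => expR (2 * pi * p) - 1) by cont.
  exact: (h po).
have [r r0 hr] := cvg_dist_near e0 cpl.
have s0 : 0 < Num.min (po / 2) r by rewrite lt_min m0 r0.
apply: filterS (near_right_pos s0) => d [d0]; rewrite le_min => /andP[dpo dr].
have wp : wp_conditions po d (Delta d).
  by apply: hwp; rewrite d0/=; apply: (le_trans dpo); rewrite ler_pdivrMr// ler_peMr ?(ltW po0)//; rewrite ler1n.
set g := wp_tilde (Delta d) po.
have cg : continuous g := packet_continuous d0 dpo wp.
have gs : supp_in (po / 2) (2 * po) g := packet_supp d0 dpo wp.
have [iC iS] := packet_intble d0 dpo wp.
have [K gK] := supp_expdom m0 mP cg gs.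
have [ih Eh] := packet_mass d0 dpo wp.
pose q p := clamp (po / 2) (2 * po) p.
have q0 p : 0 < q p by have /andP[h _] := clamp_itv p mP; exact: lt_le_trans m0 h.
have cq : continuous q by exact: continuous_clamp.
pose f p := planck (q p) * (g p ^+ 2 / (2 * p)).
have fE p : f p = planck p * (g p ^+ 2 / (2 * p)).
  have := supp_clamp planck p gs; rewrite -/(q p) => h.
  rewrite /f; move: (planck (q p)) (planck p) h => a b h.
  have -> : a * (g p ^+ 2 / (2 * p)) = g p * a * (g p / (2 * p)) by ring.
  by rewrite h; ring.
have df p : `|f p - planck po * (g p ^+ 2 / (2 * p))| <= e * (g p ^+ 2 / (2 * p)).
  rewrite fE -mulrBl; have [->|gp] := eqVneq (g p) 0.
    by rewrite expr0n/= mul0r !mulr0 normr0.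
  rewrite -(packet_sqr p d0 dpo wp) normrM (ger0_norm (sqr_ge0 _)) ler_wpM2r ?sqr_ge0//.
  by apply: hr; exact: lt_le_trans (packet_near d0 dpo wp gp) dr.
have mf : measurable_fun setT f.
  have mg := continuous_measurable_fun cg; have mq := continuous_measurable_fun cq.
  by rewrite /f /planck; meas.
have if_ : intble f.
  apply: (@intble_dom _ _ (fun p => (e + `|planck po|) * (g p ^+ 2 / (2 * p)))); [exact: mf|exact: intbleZ|].
  move=> p; have h0 : 0 <= g p ^+ 2 / (2 * p) by rewrite -(packet_sqr p d0 dpo wp) sqr_ge0.
  rewrite -[f p](subrK (planck po * (g p ^+ 2 / (2 * p)))) [leRHS]mulrDl.
  apply: (le_trans (ler_normD _ _)); apply: lerD; first exact: df.
  by rewrite normrM (ger0_norm h0).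
exists (\int[mu]_p f p); split.
  rewrite (EFin_Int if_) /NTh2pi integral_mkcond; apply: eq_integral => p _.
  rewrite patchE; case: ifPn => [|].
    move=> _; congr EFin.
    rewrite (fourier_shiftE yo p cg gK iC iS) fE mulrC; congr (_ * _).
  rewrite notin_setE/= => /negP; rewrite -leNgt => p0.
  have -> : f p = 0; last by [].
  have g0 : g p = 0.
    by apply/eqP/negPn/negP => /gs/andP[h _]; have := lt_le_trans m0 (le_trans h p0); rewrite ltxx.
  by rewrite /f g0 expr0n/= mul0r mulr0.
have -> : planck po = \int[mu]_p (planck po * (g p ^+ 2 / (2 * p))) by rewrite (IntZ _ ih) Eh mulr1.
rewrite -(IntB if_ (intbleZ _ ih)).
have -> : e = \int[mu]_p (e * (g p ^+ 2 / (2 * p))) by rewrite (IntZ _ ih) Eh mulr1.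
by apply: normr_Int_le; [exact: intbleB if_ (intbleZ _ ih)|exact: intbleZ|exact: df].
Qed.

Lemma cvg_gcoef {R} (po b : R) : 0 < po -> gcoef b p @[p --> po] --> gcoef b po.
Proof.
move=> po0; have m0 : 0 < po / 2 by lra.
have mP : po / 2 <= 2 * po by lra.
have h := @continuous_gcoef R (po / 2) (2 * po) b m0 mP po.
have cl p : po / 2 <= p -> p <= 2 * po -> clamp (po / 2) (2 * po) p = p.
  by move=> h1 h2; rewrite /clamp min_l// max_r.
have e1 : gcoef b (clamp (po / 2) (2 * po) po) = gcoef b po by rewrite cl//; lra.
rewrite /continuous_at e1 in h; apply: cvg_trans h; apply: near_eq_cvg.
near=> p; rewrite cl//; apply: ltW; near: p.
- by apply: lt_nbhsr; lra.
- by apply: lt_nbhsl; lra.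
Unshelve. all: by end_near. Qed.

Lemma error_budget {R} (c M q X A W G2 G1 po d eta kap : R) :
  0 <= c -> 0 <= M -> 0 <= q -> 0 <= X -> 0 < eta -> eta <= 1 -> 0 <= G2 -> G2 <= 4 * po ->
  `|G2 - 2 * po| <= 2 * d -> G1 ^+ 2 <= d * kap ->
  `|W - c * (M * (q * G2))| <= c * (eta * (M * (q * G2)) +
     (1 + eta^-1) * (16 * q * (eta ^+ 2 * G2) + 16 * (A * G1) ^+ 2)) + X * G1 ^+ 2 ->
  `|W - c * (M * (q * (2 * po)))| <=
    eta * (c * (M * q * (4 * po) + 32 * q * (4 * po))) +
    d * (kap * (c * (1 + eta^-1) * 16 * A ^+ 2 + X) + 2 * c * M * q).
Proof.
move=> c0 M0 q0 X0 e0 e1 g0 g4 gd gk h.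
have i0 : 0 <= 1 + eta^-1 by rewrite addr_ge0// invr_ge0 ltW.
have ee : (1 + eta^-1) * eta ^+ 2 = eta ^+ 2 + eta by field; rewrite gt_eqF.
rewrite -(subrK (c * (M * (q * G2))) W) -addrA; apply: (le_trans (ler_normD _ _)).
have h1 : `|c * (M * (q * G2)) - c * (M * (q * (2 * po)))| <= d * (2 * c * M * q).
  have -> : c * (M * (q * G2)) - c * (M * (q * (2 * po))) = (c * M * q) * (G2 - 2 * po) by ring.
  have -> : d * (2 * c * M * q) = (c * M * q) * (2 * d) by ring.
  by rewrite normrM ger0_norm ?ler_wpM2l// !mulr_ge0.
apply: (le_trans (lerD h h1)).
rewrite [leRHS](_ : _ = eta * (c * (M * q * (4 * po) + 32 * q * (4 * po))) +
   (d * kap) * (c * (1 + eta^-1) * 16 * A ^+ 2 + X) + d * (2 * c * M * q)); last by ring.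
apply: lerD => //.
rewrite [leLHS](_ : _ = (eta * (c * M * q) * G2 + c * q * 16 * ((1 + eta^-1) * eta ^+ 2) * G2) +
   G1 ^+ 2 * (c * (1 + eta^-1) * 16 * A ^+ 2 + X)); last by ring.
have w0 : 0 <= c * (1 + eta^-1) * 16 * A ^+ 2 + X.
  by apply: addr_ge0 => //; apply: mulr_ge0 (sqr_ge0 A); rewrite !mulr_ge0.
apply: lerD; last exact: ler_wpM2r.
rewrite ee [leRHS](_ : _ = eta * (c * M * q) * (4 * po) + c * q * 16 * (eta * 2) * (4 * po)); last by ring.
have eta2 : eta ^+ 2 + eta <= eta * 2 by rewrite expr2; nra.
apply: lerD.
  by apply: ler_wpM2l => //; rewrite !mulr_ge0// ltW.
apply: ler_pM => //; first by rewrite !mulr_ge0// addr_ge0 ?sqr_ge0// ltW.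
by apply: ler_wpM2l => //; rewrite !mulr_ge0.
Qed.

Lemma small_factor {R} (e Y : R) : 0 < e -> 0 <= Y ->
  exists2 r, 0 < r & forall x, 0 <= x -> x <= r -> x * Y <= e.
Proof.
move=> e0 Y0; exists (e / (Y + 1)); first by rewrite divr_gt0// ltr_wpDl.
move=> x x0; rewrite ler_pdivlMr ?ltr_wpDl// => h; apply: le_trans h.
by rewrite ler_wpM2l// lerDl.
Qed.

Lemma Nbar_approx {R} (po : R) (Delta : R -> R -> R) (yo e : R) :
  0 < po -> (forall d, 0 < d <= po -> wp_conditions po d (Delta d)) -> 0 < e ->
  \forall d \near 0^'+, exists N,
    Nbar (wp_shift (wp_re (Delta d) po) yo) (wp_shift (wp_im (Delta d) po) yo) = N%:E /\
    `|N - 2^-1 * planck po| <= e.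
Proof.
move=> po0 hwp e0; have m0 : 0 < po / 2 by lra.
have mP : po / 2 <= 2 * po by lra.
have pi0 : 0 < pi :> R := pi_gt0 R.
pose C1 := gcoef 0 po; pose C2 := gcoef (- (pi / 2)) po.
pose M := C1 ^+ 2 + C2 ^+ 2; have M0 : 0 <= M by rewrite addr_ge0 ?sqr_ge0.
pose c : R := (2 * pi) ^- 2 / 2.
have c0 : 0 <= c by rewrite divr_ge0// invr_ge0 sqr_ge0.
(* (2 pi)^-2 / 2 times 2 pi / (po (e^(2 pi po) - 1)) times pi times 2 po: the 2 po of the energy
   cancels the po of the modulus. *)
have target : c * (M * (pi * (2 * po))) = 2^-1 * planck po.
  rewrite /M gcoef_modulus// /c /planck.
  have := planck_den po0; move: (expR _ - 1) => x x0.
  by move: pi pi0 => q qq0; field; rewrite !gt_eqF.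
pose A := ampint_err (po / 2) (2 * po) yo 0.
pose X : R := (2 * pi) ^- 2 * (4 * expR yo ^+ 2 * ((po / 2) ^+ 2)^-1 ^+ 2).
have X0 : 0 <= X by rewrite !mulr_ge0 ?invr_ge0 ?sqr_ge0.
have Y0 : 0 <= c * (M * pi * (4 * po) + 32 * pi * (4 * po)).
  by rewrite mulr_ge0// addr_ge0// !mulr_ge0// ltW.
have e2 : 0 < e / 2 by rewrite divr_gt0.
have [r r0 hr] := small_factor e2 Y0.
pose eta := Num.min 1 r; have eta0 : 0 < eta by rewrite lt_min ltr01.
have eta1 : eta <= 1 by rewrite ge_min lexx.
have etar : eta <= r by rewrite ge_min lexx orbT.
pose kap := (1 + 2 * po) ^+ 2.
have Z0 : 0 <= kap * (c * (1 + eta^-1) * 16 * A ^+ 2 + X) + 2 * c * M * pi.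
  have i0 : 0 <= 1 + eta^-1 by rewrite addr_ge0// invr_ge0 ltW.
  apply: addr_ge0; last by apply: (mulr_ge0 (mulr_ge0 (mulr_ge0 _ c0) M0) (ltW pi0)).
  apply: mulr_ge0 (sqr_ge0 _) _; apply: addr_ge0 X0.
  by apply: mulr_ge0 (sqr_ge0 A); apply: mulr_ge0 => //; exact: mulr_ge0.
have [r' r'0 hr'] := small_factor e2 Z0.
have [r1 r10 hr1] := cvg_dist_near eta0 (@cvg_gcoef R po 0 po0).
have [r2 r20 hr2] := cvg_dist_near eta0 (@cvg_gcoef R po (- (pi / 2)) po0).
(* d <= po / 2 serves the packet lemmas, r' the error budget, and r1, r2 keep the coefficients
   within eta of their values at po on the support. *)
have s0 : 0 < Num.min (Num.min (po / 2) r') (Num.min r1 r2) by rewrite !lt_min m0 r'0 r10 r20.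
apply: filterS (near_right_pos s0) => d [d0]; rewrite !le_min => /andP[/andP[dpo dr] /andP[d1 d2]].
have wp : wp_conditions po d (Delta d).
  by apply: hwp; rewrite d0/=; apply: (le_trans dpo); lra.
have cg := packet_continuous d0 dpo wp; have gs := packet_supp d0 dpo wp.
have [iC iS] := packet_intble d0 dpo wp.
have hb p : wp_tilde (Delta d) po p != 0 ->
    `|gcoef 0 p - C1| <= eta /\ `|gcoef (- (pi / 2)) p - C2| <= eta.
  move=> gp; have h := packet_near d0 dpo wp gp.
  by split; [apply: hr1; exact: lt_le_trans h d1|apply: hr2; exact: lt_le_trans h d2].
have [N [EN hN]] := Nbar_bound yo m0 mP cg gs iC iS eta0 hb.
exists N; split; first exact: EN.
rewrite -target; have gE := packet_energy d0 dpo wp; have gL := packet_L1 d0 dpo wp.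
move: hN gE gL; set G2 := \int[mu]_p _ ^+ 2; set G1 := \int[mu]_p `|_| => hN gE gL.
have G20 : 0 <= G2 by apply: Rintegral_ge0 => p _; exact: sqr_ge0.
have G24 : G2 <= 4 * po by move: gE; rewrite ler_norml => /andP[_ h]; lra.
have hN' : `|N - c * (M * (pi * G2))| <= c * (eta * (M * (pi * G2)) +
     (1 + eta^-1) * (16 * pi * (eta ^+ 2 * G2) + 16 * (A * G1) ^+ 2)) + X * G1 ^+ 2.
  apply: (le_trans hN); rewrite lerD2l le_eqVlt; apply/orP; left; apply/eqP.
  by rewrite /X; move: ((2 * pi) ^- 2) (((po / 2) ^+ 2)^-1) => a b; ring.
apply: (le_trans (error_budget c0 M0 (ltW pi0) X0 eta0 eta1 G20 G24 gE gL hN')).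
rewrite [e in _ <= e](splitr e); apply: lerD.
  exact: hr (ltW eta0) etar.
exact: hr' (ltW d0) dr.
Qed.

Theorem theorem7 (R : realType) (po : R) (Delta : R -> R -> R) :
  0 < po ->
  (forall delta, 0 < delta <= po -> wp_conditions po delta (Delta delta)) ->
  (forall yo : R,
     Nbar (wp_shift (wp_re (Delta delta) po) yo) (wp_shift (wp_im (Delta delta) po) yo)
       @[delta --> 0^'+]
     --> ((2 : R)^-1 * (expR (2 * pi * po) - 1)^-1)%:E) /\
  (exists L : R -> R,
     (forall yo : R,
        (Nbar (wp_shift (wp_re (Delta delta) po) yo) (wp_shift (wp_im (Delta delta) po) yo)
         - ((2 : R)^-1)%:E *
           NTh2pi (wp_shift (wp_re (Delta delta) po) yo) (wp_shift (wp_im (Delta delta) po) yo))%E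
          @[delta --> 0^'+] --> (L yo)%:E) /\
     L yo @[yo --> +oo] --> 0 /\
     L yo @[yo --> -oo] --> 0).
Proof.
move=> po0 hwp; split.
  by move=> yo; apply: cvge_of_approx => e e0; exact: Nbar_approx yo e po0 hwp e0.
(* For each yo the inner limit is already 0, as both particle numbers have limits independent of yo;
   the outer limits are those of a constant. *)
exists (fun=> 0); split; last by split; exact: cvg_cst.
move=> yo; apply: cvge_of_approx => e e0; have e2 : 0 < e / 2 by rewrite divr_gt0.
near=> d.
have [N [-> hN]] : exists N,
    Nbar (wp_shift (wp_re (Delta d) po) yo) (wp_shift (wp_im (Delta d) po) yo) = N%:E /\
    `|N - 2^-1 * planck po| <= e / 2.
  by near: d; exact: Nbar_approx.
have [T [-> hT]] : exists T,
    NTh2pi (wp_shift (wp_re (Delta d) po) yo) (wp_shift (wp_im (Delta d) po) yo) = T%:E /\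
    `|T - planck po| <= e.
  by near: d; exact: NTh_approx.
exists (N - 2^-1 * T); split; first by rewrite -EFinM -EFinB.
have -> : N - 2^-1 * T - 0 = N - 2^-1 * planck po - 2^-1 * (T - planck po) by ring.
apply: (le_trans (ler_normB _ _)); rewrite [leRHS](splitr e); apply: lerD; first exact: hN.
by rewrite normrM ger0_norm ?invr_ge0// mulrC ler_wpM2r ?invr_ge0.
Unshelve. all: by end_near. Qed.
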